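(* Let $N\ge3$, $p=\frac{N+2}{N-2}$ and $\lambda<\left(\frac{N-1}{2}\right)^2$. If $\lambda\le\frac{N(N-2)}{4}$ or $N=3$, then the equation $$-\Delta_{\mathbb{B}^N}u-\lambda u=|u|^{p-1}u\quad\text{in }\mathbb{B}^N,\qquad u\in H^1(\mathbb{B}^N),$$ does not have a radial sign-changing solution.
   Context: $\mathbb{B}^N=\{x\in\mathbb{R}^N:|x|<1\}$ is the ball model of hyperbolic space, with metric $g_{ij}=\left(\frac{2}{1-|x|^2}\right)^2\delta_{ij}$, volume $dV_{\mathbb{B}^N}=\left(\frac{2}{1-|x|^2}\right)^N dx$, and Laplace-Beltrami operator $\Delta_{\mathbb{B}^N}=\left(\frac{1-|x|^2}{2}\right)^2\Delta+(N-2)\frac{1-|x|^2}{2}\langle x,\nabla\cdot\rangle$. $H^1(\mathbb{B}^N)$ is the Sobolev space of this Riemannian manifold, with squared norm $\int_{\mathbb{B}^N}(|\nabla_{\mathbb{B}^N}u|^2_{\mathbb{B}^N}+u^2)\,dV_{\mathbb{B}^N}$, where $|\nabla_{\mathbb{B}^N}u|^2_{\mathbb{B}^N}=\left(\frac{1-|x|^2}{2}\right)^2|\nabla u|^2$. Solutions are understood in the weak sense. Radial means depending only on $|x|$. A function is sign changing if both its positive part and its negative part are nontrivial. *)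

(* Defs.v *)
From HB Require Import structures.
From mathcomp Require Import all_boot all_order all_algebra.
From mathcomp Require Import all_classical all_reals all_analysis.
Set Implicit Arguments.
Unset Strict Implicit.
Unset Printing Implicit Defensive.
Import Order.TTheory GRing.Theory Num.Theory.
Import numFieldNormedType.Exports.
Local Open Scope classical_set_scope.
Local Open Scope ring_scope.

(* [R^n] is ['rV[R]_n], with the sigma-algebra generated by the coordinates,
   i.e. the Borel sigma-algebra. *)
Definition row_display : measure_display.
Proof. exact: (measure_tuple_display default_measure_display). Qed.

Section row_measurable.
Context {R : realType} (n : nat).

Let coord (i : 'I_n) (x : 'rV[R]_n) : measurableTypeR R := x 0 i.

Let row_measurable0 : g_sigma_preimage coord set0.
Proof. exact: sigma_algebra0. Qed.

Let row_measurableC A : g_sigma_preimage coord A -> g_sigma_preimage coord (~` A).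
Proof. exact: sigma_algebraC. Qed.

Let row_measurable_bigcup (F : (set 'rV[R]_n)^nat) :
  (forall i, g_sigma_preimage coord (F i)) ->
  g_sigma_preimage coord (\bigcup_i (F i)).
Proof. exact: sigma_algebra_bigcup. Qed.

HB.instance Definition _ := @isMeasurable.Build row_display 'rV[R]_n
  (g_sigma_preimage coord) row_measurable0 row_measurableC row_measurable_bigcup.

Lemma measurable_coord (i : 'I_n) :
  measurable_fun [set: 'rV[R]_n] (coord i).
Proof.
move=> _ Y mY; rewrite setTI; apply: sub_sigma_algebra => /=.
rewrite -bigcup_seq/=; exists i => /=; first by rewrite mem_index_enum.
by exists Y => //; rewrite setTI.
Qed.

Lemma measurable_fun_row d (T : measurableType d) (f : T -> 'rV[R]_n) :
  (forall i, measurable_fun [set: T] (coord i \o f)) ->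
  measurable_fun [set: T] f.
Proof.
move=> mf _ A mA; rewrite setTI.
suff : g_sigma_preimage (fun i => coord i \o f) `<=` measurable.
  by rewrite g_sigma_preimage_comp; apply; exists A => //; rewrite setTI.
apply: smallest_sub; first exact: sigma_algebra_measurable.
rewrite -bigcup_seq/=; apply: bigcup_sub => i _.
by move=> B [C mC <-]; exact: mf.
Qed.

End row_measurable.

Section lebesgue_row.
Context {R : realType}.

Definition row_cons n (p : measurableTypeR R * 'rV[R]_n) : 'rV[R]_n.+1 :=
  \row_i if unlift ord0 i is Some j then p.2 0 j else p.1.

Definition row_behead n (x : 'rV[R]_n.+1) : 'rV[R]_n :=
  \row_j x 0 (lift ord0 j).

Lemma row_consK n (x : 'rV[R]_n.+1) : row_cons (x 0 ord0, row_behead x) = x.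
Proof.
apply/rowP => i; rewrite mxE; case: unliftP => [j ->|->] //=.
by rewrite mxE.
Qed.

Lemma row_cons0 n (p : measurableTypeR R * 'rV[R]_n) : row_cons p 0 ord0 = p.1.
Proof. by rewrite mxE unlift_none. Qed.

Lemma row_beheadK n (p : measurableTypeR R * 'rV[R]_n) :
  row_behead (row_cons p) = p.2.
Proof. by apply/rowP => j; rewrite !mxE liftK. Qed.

Lemma measurable_row_cons n :
  measurable_fun [set: measurableTypeR R * 'rV[R]_n] (@row_cons n).
Proof.
apply: measurable_fun_row => i.
case: (unliftP ord0 i) => [j ->|->].
- rewrite (_ : _ \o _ = (fun x : 'rV[R]_n => x 0 j : measurableTypeR R) \o snd).
    by apply: measurableT_comp => //; exact: measurable_coord.
  by apply/funext => p /=; rewrite mxE liftK.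
- rewrite (_ : _ \o _ = fst) //.
  by apply/funext => p /=; rewrite row_cons0.
Qed.

Lemma measurable_row_behead n :
  measurable_fun [set: 'rV[R]_n.+1] (@row_behead n).
Proof.
apply: measurable_fun_row => j.
rewrite (_ : _ \o _ = fun x : 'rV[R]_n.+1 => x 0 (lift ord0 j) : measurableTypeR R).
  exact: measurable_coord.
by apply/funext => x /=; rewrite mxE.
Qed.

Section cons_measure.
Context n (m : {sigma_finite_measure set 'rV[R]_n -> \bar R}).

Definition cons_measure : set 'rV[R]_n.+1 -> \bar R :=
  pushforward (@lebesgue_measure R \x m)%E (@row_cons n).

Let cons_measure0 : cons_measure set0 = 0%E.
Proof. by rewrite /cons_measure /pushforward preimage_set0 measure0. Qed.

Let cons_measure_ge0 A : (0 <= cons_measure A)%E.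
Proof. by rewrite /cons_measure /pushforward; exact: measure_ge0. Qed.

Let cons_measure_sigma_additive : semi_sigma_additive cons_measure.
Proof.
move=> F mF tF mUF; rewrite /cons_measure /pushforward preimage_bigcup.
apply: measure_semi_sigma_additive.
- by move=> k; rewrite -[X in measurable X]setTI; exact: measurable_row_cons.
- apply/trivIsetP => /= i j _ _ ij; rewrite -preimage_setI.
  by move/trivIsetP : tF => /(_ _ _ _ _ ij) ->//; rewrite preimage_set0.
- rewrite -preimage_bigcup -[X in measurable X]setTI.
  exact: measurable_row_cons.
Qed.

HB.instance Definition _ := isMeasure.Build _ _ _ cons_measure
  cons_measure0 cons_measure_ge0 cons_measure_sigma_additive.

Let cons_measure_sigma_finite : sigma_finite setT cons_measure.
Proof.
have /sigma_finiteP[F [TF ndF Foo]] := sigma_finiteT (@lebesgue_measure R).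
have /sigma_finiteP[G [TG ndG Goo]] := sigma_finiteT m.
have mFG k : measurable [set x : 'rV[R]_n.+1 | F k (x 0 ord0) /\ G k (row_behead x)].
  apply: measurableI.
    rewrite -[X in measurable X]setTI.
    by apply: (measurable_coord ord0) => //; have [] := Foo k.
  rewrite -[X in measurable X]setTI.
  by apply: measurable_row_behead => //; have [] := Goo k.
exists (fun k => [set x : 'rV[R]_n.+1 | F k (x 0 ord0) /\ G k (row_behead x)]).
  apply/esym/seteqP; split=> // x _.
  have [i _ Fi] : (\bigcup_k F k) (x 0 ord0) by rewrite -TF.
  have [j _ Gj] : (\bigcup_k G k) (row_behead x) by rewrite -TG.
  exists (maxn i j) => //; split.
  - by move: Fi; exact/subsetPset/ndF/leq_maxl.
  - by move: Gj; exact/subsetPset/ndG/leq_maxr.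
move=> k; split => //; have [mF Fk] := Foo k; have [mG Gk] := Goo k.
rewrite /cons_measure /pushforward.
rewrite (_ : _ @^-1` _ = F k `*` G k); last first.
  by apply/seteqP; split => p /=; rewrite row_cons0 row_beheadK.
rewrite (product_measure1E _ _ mF mG) lte_mul_pinfty //.
by rewrite ge0_fin_numE.
Qed.

HB.instance Definition _ := Measure_isSigmaFinite.Build _ _ _ cons_measure
  cons_measure_sigma_finite.

End cons_measure.

(* Lebesgue measure on [R^n], as the iterated product of Lebesgue measure on [R];
   see [lebesgue_row_box]. *)
Fixpoint lebesgue_row n : {sigma_finite_measure set 'rV[R]_n -> \bar R} :=
  match n with
  | 0 => @dirac _ 'rV[R]_0 0 R
  | k.+1 => cons_measure (lebesgue_row k)
  end.

Lemma lebesgue_row_box n (A : 'I_n -> set (measurableTypeR R)) :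
  (forall i, measurable (A i)) ->
  lebesgue_row n [set x | forall i, A i (x 0 i)] =
  (\prod_(i < n) lebesgue_measure (A i))%E.
Proof.
elim: n A => [|n IH] A mA.
  rewrite big_ord0 /= diracE mem_set //=.
  by case.
have mB : measurable [set x : 'rV[R]_n | forall i, A (lift ord0 i) (x 0 i)].
  rewrite (_ : [set _ | _] = \bigcap_(i in [set: 'I_n])
    ((fun x : 'rV[R]_n => x 0 i : measurableTypeR R) @^-1` A (lift ord0 i))).
    apply: fin_bigcap_measurable => // i _.
    by rewrite -[X in measurable X]setTI; exact: measurable_coord.
  by apply/seteqP; split => [x H i _|x H i]; exact: H.
rewrite big_ord_recl -(IH (fun i => A (lift ord0 i))) //.
rewrite -(product_measure1E _ _ (mA ord0) mB).
rewrite /= /cons_measure /pushforward; congr (product_measure1 _ _ _).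
apply/seteqP; split => -[a b] /=.
- move=> H; split; first by have := H ord0; rewrite row_cons0.
  by move=> i; have := H (lift ord0 i); rewrite mxE liftK.
- by move=> [Ha Hb] i; rewrite mxE; case: unliftP => [j ->|->] /=.
Qed.

End lebesgue_row.

Section hyperbolic_ball.
Context {R : realType} {N : nat}.
Implicit Types (x : 'rV[R]_N) (u phi : 'rV[R]_N -> R) (g : 'rV[R]_N -> 'rV[R]_N).

Local Notation leb := (@lebesgue_row R N).

(* The library norm on ['rV[R]_N] is the sup norm, hence these. *)
Definition dotr (x y : 'rV[R]_N) : R := \sum_(i < N) x 0 i * y 0 i.
Definition enorm x : R := Num.sqrt (dotr x x).

Definition hball : set 'rV[R]_N := [set x | enorm x < 1].

(* [g_ij = (conformal x) ^+ 2 delta_ij] and [dV = (conformal x) ^+ N dx] *)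
Definition conformal x : R := 2 / (1 - enorm x ^+ 2).

(* Riemannian inner product of the gradients of two functions whose Euclidean
   gradients at [x] are [v] and [w]. *)
Definition hyp_grad_dot x (v w : 'rV[R]_N) : R :=
  ((1 - enorm x ^+ 2) / 2) ^+ 2 * dotr v w.

Definition basis_vec (i : 'I_N) : 'rV[R]_N := delta_mx 0 i.

(* [phi] is C^oo iff all its iterated partial derivatives are differentiable. *)
Definition iter_partial (s : seq 'I_N) phi : 'rV[R]_N -> R :=
  foldr (fun i (f : 'rV[R]_N -> R) => 'D_(basis_vec i) f) phi s.

Definition gradient phi x : 'rV[R]_N := \row_i 'D_(basis_vec i) phi x.

Definition smooth phi : Prop :=
  forall (s : seq 'I_N) x, differentiable (iter_partial s phi) x.

(* [C_c^oo(B^N)], extended by zero to [R^N] *)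
Definition test_function phi : Prop :=
  [/\ smooth phi, compact (closure [set x | phi x != 0]) &
      closure [set x | phi x != 0] `<=` hball].

Definition locally_integrable_ball u : Prop :=
  measurable_fun hball u /\
  forall K, K `<=` hball -> compact K ->
    (\int[leb]_(x in K) `|u x|%:E < +oo)%E.

Definition weak_gradient u g : Prop :=
  [/\ locally_integrable_ball u,
      forall i, locally_integrable_ball (fun x => g x 0 i) &
      forall phi, test_function phi -> forall i,
        \int[leb]_(x in hball) (u x * 'D_(basis_vec i) phi x) =
        - \int[leb]_(x in hball) (g x 0 i * phi x)].

(* Membership in the Sobolev space of the hyperbolic ball: [u] and its gradient
   are square integrable for the metric.  The values of [u] outside the ball are
   irrelevant. *)
Definition H1_ball u : Prop :=
  exists2 g, weak_gradient u g &
    (\int[leb]_(x in hball)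
       ((hyp_grad_dot x (g x) (g x) + u x ^+ 2) * conformal x ^+ N)%:E < +oo)%E.

(* Weak form of [- Delta u - lambda u = |u|^(p-1) u] for [u] in [H1_ball], where
   [Delta] is the Laplace-Beltrami operator of the metric, for which Green's
   formula reads [int (- Delta u) phi dV = int <grad u, grad phi> dV].  The weak
   gradient is unique up to null sets and exists by [H1_ball u], so the
   universal quantifier on [g] is not vacuous. *)
Definition weak_solution (lambda p : R) u : Prop :=
  H1_ball u /\
  forall g, weak_gradient u g -> forall phi, test_function phi ->
    \int[leb]_(x in hball)
      (hyp_grad_dot x (g x) (gradient phi x) * conformal x ^+ N)
    - lambda * \int[leb]_(x in hball) (u x * phi x * conformal x ^+ N)
    = \int[leb]_(x in hball)
        (`|u x| `^ (p - 1) * u x * phi x * conformal x ^+ N).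

Definition radial u : Prop :=
  exists f : R -> R, {ae leb, forall x, hball x -> u x = f (enorm x)}.

Definition sign_changing u : Prop :=
  ~ {ae leb, forall x, hball x -> u^\+ x = 0} /\
  ~ {ae leb, forall x, hball x -> u^\- x = 0}.

End hyperbolic_ball.

(* Main.v *)
Require Import Defs.
From HB Require Import structures.
From mathcomp Require Import all_boot all_order all_algebra.
From mathcomp Require Import all_classical all_reals all_analysis.
From mathcomp Require Import ring lra.
From mathcomp Require Import measurable_realfun.
Set Implicit Arguments.
Unset Strict Implicit.
Unset Printing Implicit Defensive.
Import Order.TTheory GRing.Theory Num.Theory.
Import numFieldNormedType.Exports.
Local Open Scope classical_set_scope.
Local Open Scope ring_scope.

(** A radial solution is [u x = F (|x|^2)].  Testing the weak gradient [g] of [u] with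
    [x_i chi(|x|^2)] shows that [F] has a continuous version, whose increments are the
    integrals over shells of the flux [<x, g> |x|^-n]; testing the equation with radial
    functions and applying the du Bois-Reymond lemma then gives an ordinary differential
    equation for [F].  In terms of the geodesic distance [s] to the origin, of
    [y s = F (tanh (s/2) ^ 2)] and of [S = sinh s], [C = cosh s], it reads
    [(S^(n-1) y')' = - S^(n-1) (lambda y + |y|^(p-1) y)].  Finite energy gives
    [S^(n-2) y^2 -> 0] and [S^n y'^2 -> 0] along a sequence [s -> 0].

    If [lambda <= n(n-2)/4], the Pohozaev function
    [S^(n-1) (S y'^2/2 + (n-2)/2 C y y' + (lambda - (n-2)/2) S y^2/2 + S |y|^(p+1)/(p+1))]
    is nonincreasing, its derivative being [S^(n-1) C (lambda - n(n-2)/4) y^2].  If [n = 3]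
    and [3/4 < lambda < 1], the same is true of
    [a v'^2/2 - a' v v'/2 + (1-lambda) a v^2/2 + a S^2 |y|^6/6], where [v = S y],
    [a = sinh (k s)] and [k = 2 sqrt (1-lambda) < 1].  Both tend to [0] along the sequence,
    and at a zero of [y] they reduce to a positive multiple of [y'^2].  Hence [y' = 0] there,
    and [y = 0] by uniqueness, so that the profile of a solution cannot change sign. *)

(** * Lebesgue measure in polar coordinates *)

(** The variable is [t = |x|^2] rather than [|x|] because [chi(|x|^2)] is smooth at the origin for
    every smooth [chi]. No measure on spheres is introduced: the image of Lebesgue measure under
    [|x|^2] is computed from volumes of balls, and the flux enters only through its integrals over
    shells.

    No regularity at the origin is proved. Boundary terms that vanish along a sequence suffice,
    because a nonincreasing function is bounded at a zero [s0] of [y] by its values closer to the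
    origin.

    Both monotone functions come from multiplying the equation by a first-order expression,
    [S y' + (n-2)/2 C y] in one case and [a v' - a' v / 2] in the other, and adding the zero-order
    terms that make the products [y y'] or [v v'] drop out; the terms in [y'^2] or [v'^2] cancel as
    well. In the first case the critical exponent also removes the nonlinearity and only [y^2] is
    left. In the second it is the linear part that disappears, and the sign of the nonlinear
    remainder requires [k <= 1], that is [lambda >= 3/4]: exactly where the first argument stops in
    dimension 3. *)

Section is_derive_pointwise.
Context {R : realType}.
Implicit Types (f g : R -> R) (x : R).

(** The rules are restated for functions of the shape [fun t => ...], in which all explicit formulas
    below are written. *)
#[local] Instance is_derive1_add f g x df dg : is_derive x 1 f df -> is_derive x 1 g dg ->
  is_derive x 1 (fun t => f t + g t) (df + dg).
Proof. by move=> Hf Hg; exact: is_deriveD. Qed.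

#[local] Instance is_derive1_opp f x df : is_derive x 1 f df ->
  is_derive x 1 (fun t => - f t) (- df).
Proof. by move=> Hf; exact: is_deriveN. Qed.

#[local] Instance is_derive1_mul f g x df dg : is_derive x 1 f df -> is_derive x 1 g dg ->
  is_derive x 1 (fun t => f t * g t) (df * g x + f x * dg).
Proof.
move=> Hf Hg; apply: (is_derive_eq (is_deriveM Hf Hg)).
by rewrite /GRing.scale/= addrC [g x * _]mulrC.
Qed.

#[local] Instance is_derive1_exp f n x df : is_derive x 1 f df ->
  is_derive x 1 (fun t => f t ^+ n) (n%:R * f x ^+ n.-1 * df).
Proof.
move=> Hf; rewrite (_ : (fun t => _) = f ^+ n); last by apply/funext => t; rewrite exprfctE.
exact: (is_derive_eq (is_deriveX n Hf)).
Qed.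

End is_derive_pointwise.
#[global] Existing Instances is_derive1_add is_derive1_opp is_derive1_mul is_derive1_exp.

(** [r] times the image measure agrees with Lebesgue measure on half-open intervals, which
    characterizes the latter. *)
Lemma lebesgue_measure_preimage_scale (R : realType) (r : R)
  (A : set (measurableTypeR R)) : 0 < r -> measurable A ->
  (lebesgue_measure ((fun x : R => (r * x)%R) @^-1` A) = r^-1%:E * lebesgue_measure A)%E.
Proof.
move=> r0 mA.
have mr : measurable_fun [set: measurableTypeR R] (fun x : R => r * x : measurableTypeR R).
  by apply: measurable_funM => //; exact: measurable_cst.
have -> : (lebesgue_measure A = r%:E * lebesgue_measure ((fun x : R => (r * x)%R) @^-1` A))%E.
  pose nu : {measure set (measurableTypeR R) -> \bar R} := mscale (NngNum (ltW r0))
    (measure_function_pushforward__canonical__measure_function_Measure lebesgue_measure mr).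
  rewrite (@lebesgue_measure_unique R nu)// => _ [[a b]] /= _ <-.
  rewrite /mscale /= /pushforward.
  rewrite (_ : _ @^-1` _ = `](r^-1 * a), (r^-1 * b)]%classic); last first.
    by apply/seteqP; split => x /=; rewrite !in_itv/= ltr_pdivrMl// ler_pdivlMl.
  rewrite !lebesgue_measure_itv/= !lte_fin ltr_pM2l ?invr_gt0//.
  case: ifPn => ab; last by rewrite mule0.
  by rewrite -!EFinB -EFinM -mulrBr mulrA divff ?mul1r// gt_eqF.
by rewrite muleA -EFinM mulVf ?mul1e// gt_eqF.
Qed.

Lemma row_cons_scale (R : realType) n (r : R) (p : measurableTypeR R * 'rV[R]_n) :
  r *: row_cons p = row_cons (r * p.1, r *: p.2).
Proof. by apply/rowP => i; rewrite !mxE; case: unliftP => [j _|_] //; rewrite mxE. Qed.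

Lemma measurable_row_scale (R : realType) n (r : R) :
  measurable_fun [set: 'rV[R]_n] (fun x : 'rV[R]_n => r *: x).
Proof.
apply: measurable_fun_row => i.
rewrite (_ : _ \o _ = fun x : 'rV[R]_n => r * x 0 i); last by apply/funext => x/=; rewrite mxE.
by apply: measurable_funM; [exact: measurable_cst|exact: measurable_coord].
Qed.

(** Slicing along the first coordinate: the induction hypothesis scales each slice by [r^-n], and
    the change of variable in the outer integral supplies the last factor [r^-1]. *)
Lemma lebesgue_row_preimage_scale (R : realType) n (r : R) (A : set 'rV[R]_n) :
  0 < r -> measurable A ->
  (lebesgue_row n ((fun x => r *: x) @^-1` A) = (r ^- n)%:E * lebesgue_row n A)%E.
Proof.
move=> r0; elim: n A => [|n IH] A mA.
  rewrite expr0 invr1 mul1e /= /dirac /= !indicE /=.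
  by rewrite (_ : _ @^-1` A = A)//; apply/seteqP; split => x /=;
    rewrite (_ : r *: x = x)//; apply/rowP => -[].
have mA' : measurable (@row_cons R n @^-1` A).
  by rewrite -[X in measurable X]setTI; exact: measurable_row_cons.
have mrA' : measurable (@row_cons R n @^-1` ((fun x => r *: x) @^-1` A)).
  rewrite -[X in measurable X]setTI; apply: measurable_row_cons => //.
  by rewrite -[X in measurable X]setTI; exact: measurable_row_scale.
rewrite /= /cons_measure /pushforward /product_measure1.
pose k (x : R) := lebesgue_row n (xsection (@row_cons R n @^-1` A) x).
have mk : measurable_fun setT k.
  exact: measurable_fun_xsection.
transitivity (\int[lebesgue_measure]_(x in setT) ((r ^- n)%:E * k (r * x)%R))%E.
  apply: eq_integral => x _ /=.
  rewrite /k -IH; last exact: measurable_xsection.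
  congr (lebesgue_row n _); apply/seteqP; split => y; rewrite /xsection /= !inE/=;
    by rewrite row_cons_scale.
have mr : measurable_fun [set: measurableTypeR R] (fun x : R => r * x : measurableTypeR R).
  by apply: measurable_funM => //; exact: measurable_cst.
rewrite ge0_integralZl//=; last 2 first.
  exact: measurableT_comp mr.
  by rewrite lee_fin invr_ge0 exprn_ge0// ltW.
have -> : (\int[lebesgue_measure]_x k (r * x)%R = r^-1%:E * \int[lebesgue_measure]_x k x)%E.
  pose f := HB.pack_for {mfun measurableTypeR R >-> measurableTypeR R}
    (fun x : R => r * x) (isMeasurableFun.Build _ _ _ _ _ mr).
  have r10 : 0 <= r^-1 by rewrite invr_ge0 ltW.
  transitivity (\int[pushforward lebesgue_measure f]_x k x)%E.
    by rewrite ge0_integral_pushforward.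
  transitivity (\int[mscale (NngNum r10) lebesgue_measure]_x k x)%E.
    apply: eq_measure_integral => B mB _.
    exact: lebesgue_measure_preimage_scale.
  by rewrite ge0_integral_mscale.
by rewrite muleA -EFinM exprSr invfM.
Qed.

Lemma lebesgue_row_gt0 (R : realType) n (r : R) : 0 < r ->
  (0 < lebesgue_row n [set x : 'rV[R]_n | forall i, (`|x 0 i| < r)%R])%E.
Proof.
move=> r0.
rewrite (_ : [set _ | _] = [set x : 'rV[R]_n | forall i, `]-r, r[%classic (x 0 i)]); last first.
  by apply/seteqP; split => x H i /=; have := H i; rewrite /= in_itv/= ltr_norml.
rewrite (@lebesgue_row_box _ _ (fun=> `]-r, r[%classic))//.
under eq_bigr do rewrite lebesgue_measure_itv/= lte_fin gtrN// -EFinB.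
rewrite (_ : (\prod_(i < n) _)%E = (\prod_(i < n) (r - - r))%:E); last first.
  by rewrite (big_morph EFin (id1 := 1%E) (op1 := *%E)).
by rewrite lte_fin prodr_gt0// => i _; lra.
Qed.

Lemma lebesgue_row_lty (R : realType) n (r : R) :
  (lebesgue_row n [set x : 'rV[R]_n | forall i, (`|x 0 i| <= r)%R] < +oo)%E.
Proof.
rewrite (_ : [set _ | _] = [set x : 'rV[R]_n | forall i, `[-r, r]%classic (x 0 i)]); last first.
  by apply/seteqP; split => x H i /=; have := H i; rewrite /= in_itv/= ler_norml.
rewrite (@lebesgue_row_box _ _ (fun=> `[-r, r]%classic))//.
under eq_bigr do rewrite lebesgue_measure_itv/= lte_fin.
rewrite (_ : (\prod_(i < n) _)%E = (\prod_(i < n) (if - r < r then r - - r else 0))%:E).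
  by rewrite ltry.
rewrite (big_morph EFin (id1 := 1%E) (op1 := *%E))//.
by apply: eq_bigr => i _; case: ifP.
Qed.

Section nsq.
Context {R : realType} {n : nat}.
Implicit Types (x : 'rV[R]_n) (r : R).

Definition nsq x := dotr x x.

Lemma nsqE x : nsq x = \sum_i x 0 i ^+ 2.
Proof. by apply: eq_bigr => i _; rewrite expr2. Qed.

Lemma nsq_ge0 x : 0 <= nsq x.
Proof. by rewrite nsqE sumr_ge0// => i _; rewrite sqr_ge0. Qed.

Lemma enorm_sqr x : enorm x ^+ 2 = nsq x.
Proof. by rewrite sqr_sqrtr// nsq_ge0. Qed.

Lemma enorm_ge0 x : 0 <= enorm x. Proof. exact: sqrtr_ge0. Qed.

Lemma hballE : hball = [set x | nsq x < 1].
Proof.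
by apply/seteqP; split => x /=; rewrite -enorm_sqr /hball/= expr_lt1// enorm_ge0.
Qed.

Lemma nsq_scale r x : nsq (r *: x) = r ^+ 2 * nsq x.
Proof. by rewrite !nsqE mulr_sumr; apply: eq_bigr => i _; rewrite mxE exprMn. Qed.

Lemma coord_nsq x i : x 0 i ^+ 2 <= nsq x.
Proof. by rewrite nsqE (bigD1 i)//= lerDl sumr_ge0// => j _; rewrite sqr_ge0. Qed.

Lemma coord_enorm x i : `|x 0 i| <= enorm x.
Proof.
by rewrite -(@ler_pXn2r _ 2)// ?nnegrE ?enorm_ge0// enorm_sqr real_normK ?num_real// coord_nsq.
Qed.

Lemma measurable_nsq : measurable_fun [set: 'rV[R]_n] (nsq : _ -> measurableTypeR R).
Proof.
rewrite (_ : nsq = fun x => \sum_(i <- enum 'I_n) x 0 i ^+ 2); last first.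
  by apply/funext => x; rewrite nsqE big_enum.
apply: measurable_sum => i; apply: measurable_funX; exact: measurable_coord.
Qed.

Lemma measurable_nsq_preimage (A : set (measurableTypeR R)) : measurable A ->
  measurable (nsq @^-1` A).
Proof. by move=> mA; rewrite -[X in measurable X]setTI; exact: measurable_nsq. Qed.

Definition ball_volume : R := fine (lebesgue_row n [set x | nsq x <= 1]).

Lemma lebesgue_row_ball_le1 : (lebesgue_row n [set x : 'rV[R]_n | (nsq x <= 1)%R] < +oo)%E.
Proof.
apply: (le_lt_trans _ (lebesgue_row_lty n (1 : R))); apply: le_measure; rewrite ?inE.
- rewrite (_ : [set _ | _] = nsq @^-1` `]-oo, 1]); first exact: measurable_nsq_preimage.
  by apply/seteqP; split => x /=; rewrite in_itv.
- rewrite (_ : [set _ | _] = \bigcap_(i in [set: 'I_n])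
    ((fun x : 'rV[R]_n => x 0 i : measurableTypeR R) @^-1` `[-1, 1])).
    apply: fin_bigcap_measurable => // i _.
    by rewrite -[X in measurable X]setTI; exact: measurable_coord.
  by apply/seteqP; split => [x H i _ /=|x H i]; [|have := H i Logic.I => /=];
    rewrite in_itv/= -ler_norml.
- move=> x /= x1 i; apply: le_trans (coord_enorm _ _) _.
  by rewrite -(@expr_le1 _ 2)// ?enorm_ge0// enorm_sqr.
Qed.

Lemma lebesgue_row_ball_gt0 r : 0 < r ->
  (0 < lebesgue_row n [set x : 'rV[R]_n | (nsq x < r)%R])%E.
Proof.
move=> r0.
(* The cube of half-side [e] satisfies [nsq x <= n e^2 < r]; dividing by [n + 1] rather than [n]
   also covers [n = 0]. *)
pose e := Num.sqrt (r / n.+1%:R).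
have e0 : 0 < e by rewrite sqrtr_gt0 divr_gt0.
apply: (lt_le_trans (lebesgue_row_gt0 n e0)); apply: le_measure; rewrite ?inE.
- rewrite (_ : [set _ | _] = \bigcap_(i in [set: 'I_n])
    ((fun x : 'rV[R]_n => x 0 i : measurableTypeR R) @^-1` `]-e, e[)).
    apply: fin_bigcap_measurable => // i _.
    by rewrite -[X in measurable X]setTI; exact: measurable_coord.
  by apply/seteqP; split => [x H i _ /=|x H i]; [|have := H i Logic.I => /=];
    rewrite in_itv/= -ltr_norml.
- rewrite (_ : [set _ | _] = nsq @^-1` `]-oo, r[); first exact: measurable_nsq_preimage.
  by apply/seteqP; split => x /=; rewrite in_itv.
- move=> x /= xe; rewrite nsqE.
  apply: (@le_lt_trans _ _ (\sum_(i < n) (r / n.+1%:R))).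
    apply: ler_sum => i _; rewrite -[X in _ <= X]sqr_sqrtr ?(divr_ge0 (ltW r0))//.
    by rewrite -(@real_normK _ (x 0 i)) ?num_real// ler_pXn2r ?nnegrE ?(ltW e0)// ltW.
  rewrite sumr_const card_ord -[X in X < _]mulr_natr -mulrA gtr_pMr// mulrC ltr_pdivrMr//.
  by rewrite mul1r ltr_nat.
Qed.

Lemma ball_volumeE : lebesgue_row n [set x : 'rV[R]_n | nsq x <= 1] = ball_volume%:E.
Proof.
rewrite /ball_volume fineK// ge0_fin_numE; first exact: lebesgue_row_ball_le1.
exact: measure_ge0.
Qed.

Lemma ball_volume_gt0 : 0 < ball_volume.
Proof.
rewrite -lte_fin -ball_volumeE.
apply: (lt_le_trans (lebesgue_row_ball_gt0 (@ltr01 R))); apply: le_measure; rewrite ?inE.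
- rewrite (_ : [set _ | _] = nsq @^-1` `]-oo, 1[); first exact: measurable_nsq_preimage.
  by apply/seteqP; split => x /=; rewrite in_itv.
- rewrite (_ : [set _ | _] = nsq @^-1` `]-oo, 1]); first exact: measurable_nsq_preimage.
  by apply/seteqP; split => x /=; rewrite in_itv.
- by move=> x /= /ltW.
Qed.

Lemma lebesgue_row_ball r : 0 < r ->
  lebesgue_row n [set x : 'rV[R]_n | nsq x <= r] = (ball_volume * Num.sqrt r ^+ n)%:E.
Proof.
move=> r0; have s0 : 0 < Num.sqrt r by rewrite sqrtr_gt0.
rewrite (_ : [set _ | _] =
  (fun x => (Num.sqrt r)^-1 *: x) @^-1` [set x | nsq x <= 1]); last first.
  apply/seteqP; split => x /=; rewrite nsq_scale exprVn sqr_sqrtr ?(ltW r0)//;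
    rewrite mulrC ler_pdivrMr// mul1r //.
rewrite lebesgue_row_preimage_scale ?invr_gt0//; last first.
  rewrite (_ : [set _ | _] = nsq @^-1` `]-oo, 1]); first exact: measurable_nsq_preimage.
  by apply/seteqP; split => x /=; rewrite in_itv.
by rewrite ball_volumeE -EFinM exprVn invrK mulrC.
Qed.


Lemma lebesgue_row_ball0 : (0 < n)%N ->
  lebesgue_row n [set x : 'rV[R]_n | nsq x <= 0] = 0%E.
Proof.
move=> n0.
apply/eqP; rewrite eq_le measure_ge0 andbT.
apply/lee_addgt0Pr => e e0; rewrite add0e.
have [d d0 de] : exists2 d, 0 < d & ball_volume * Num.sqrt d ^+ n <= e.
  (* The square root of this [d] is at most [1] and at most [e / ball_volume]; since [0 < n], its
     [n]-th power is then at most [e / ball_volume]. *)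
  exists ((Num.min 1 (e / ball_volume)) ^+ 2).
    by rewrite exprn_gt0// lt_min ltr01 divr_gt0// ball_volume_gt0.
  rewrite sqrtr_sqr ger0_norm; last first.
    by rewrite le_min ler01 divr_ge0// ltW// ball_volume_gt0.
  rewrite mulrC -ler_pdivlMr ?ball_volume_gt0//.
  case: (n) n0 => // m _; rewrite exprS.
  apply: (@le_trans _ _ (Num.min 1 (e / ball_volume))); last by rewrite ge_min lexx orbT.
  rewrite ger_pMr ?lt_min ?ltr01 ?divr_gt0 ?ball_volume_gt0//.
  by rewrite exprn_ile1 ?ge_min ?lexx// le_min ler01 divr_ge0// ltW// ball_volume_gt0.
apply: (@le_trans _ _ (lebesgue_row n [set x : 'rV[R]_n | nsq x <= d])).
  apply: le_measure; rewrite ?inE.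
  - rewrite (_ : [set _ | _] = nsq @^-1` `]-oo, 0]); first exact: measurable_nsq_preimage.
    by apply/seteqP; split => x /=; rewrite in_itv.
  - rewrite (_ : [set _ | _] = nsq @^-1` `]-oo, d]); first exact: measurable_nsq_preimage.
    by apply/seteqP; split => x /=; rewrite in_itv.
  - by move=> x /= /le_trans; apply; exact: ltW.
by rewrite lebesgue_row_ball// lee_fin.
Qed.

Lemma lebesgue_row_shell (a b : R) : 0 <= a -> a < b -> (0 < n)%N ->
  lebesgue_row n (nsq @^-1` `]a, b]) =
  (ball_volume * (Num.sqrt b ^+ n - Num.sqrt a ^+ n))%:E.
Proof.
move=> a0 ab n0; have b0 : 0 < b by exact: le_lt_trans ab.
have aE : lebesgue_row n [set x : 'rV[R]_n | nsq x <= a] =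
    (ball_volume * Num.sqrt a ^+ n)%:E.
  move: a0; rewrite le_eqVlt => /predU1P[<-|/lebesgue_row_ball//].
  by rewrite sqrtr0 expr0n/= gtn_eqF// mulr0 lebesgue_row_ball0.
have -> : nsq @^-1` `]a, b] =
    [set x : 'rV[R]_n | nsq x <= b] `\` [set x : 'rV[R]_n | nsq x <= a].
  apply/seteqP; split => x /=; rewrite in_itv/=.
    by move=> /andP[ax xb]; split=> //; apply/negP; rewrite -ltNge.
  by move=> [-> /negP]; rewrite -ltNge => ->.
rewrite measureD//=.
- rewrite setIidr; last by move=> x /= /le_trans; apply; exact: ltW.
  by rewrite aE lebesgue_row_ball// -EFinB mulrBr.
- rewrite (_ : [set _ | _] = nsq @^-1` `]-oo, b]); first exact: measurable_nsq_preimage.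
  by apply/seteqP; split => x /=; rewrite in_itv.
- rewrite (_ : [set _ | _] = nsq @^-1` `]-oo, a]); first exact: measurable_nsq_preimage.
  by apply/seteqP; split => x /=; rewrite in_itv.
- by rewrite lebesgue_row_ball// ltry.
Qed.

End nsq.

(** * Measures with a density, and the law of the squared norm *)

Section density.
Local Open Scope ereal_scope.
Context {R : realType}.
Notation leb := (@lebesgue_measure R).
Variables (m : {measure set (measurableTypeR R) -> \bar R}) (w : R -> R).
Hypothesis mw : measurable_fun [set: measurableTypeR R] (w : _ -> measurableTypeR R).
Hypothesis w0 : forall x, (0 <= w x)%R.
Hypothesis mE : forall A, measurable A -> m A = \int[leb]_(x in A) (w x)%:E.

Import HBNNSimple.

(** Monotone convergence reduces the claim to the simple functions approximating [f], and [mE]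
    settles each of their level sets. *)
Lemma ge0_integral_density (D : set (measurableTypeR R)) (f : R -> \bar R) : measurable D ->
  measurable_fun D f -> (forall x, 0 <= f x) ->
  \int[m]_(x in D) f x = \int[leb]_(x in D) (f x * (w x)%:E).
Proof.
move=> mD mf f0.
pose h := nnsfun_approx mD mf.
have hf x : D x -> (EFin \o h n) x @[n --> \oo] --> f x.
  by move=> Dx; exact: cvg_nnsfun_approx.
have -> : \int[m]_(x in D) f x = limn (fun n => \int[m]_(x in D) (EFin \o h n) x).
  rewrite -monotone_convergence//.
  - by apply: eq_integral => x /[!inE] Dx; apply/esym/cvg_lim => //; exact: hf.
  - by move=> n; apply/measurable_EFinP; apply: measurable_funTS.
  - by move=> n x Dx; rewrite lee_fin.
  - by move=> x Dx a b ab; rewrite lee_fin; exact/lefP/nd_nnsfun_approx.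
have -> : \int[leb]_(x in D) (f x * (w x)%:E) =
    limn (fun n => \int[leb]_(x in D) ((h n x)%:E * (w x)%:E)).
  rewrite -monotone_convergence//.
  - apply: eq_integral => x /[!inE] Dx; apply/esym/cvg_lim => //.
    by apply: cvgeMr => //; exact: hf.
  - move=> n; apply: emeasurable_funM; apply/measurable_EFinP; exact: measurable_funTS.
  - by move=> n x Dx; rewrite mule_ge0// lee_fin.
  - move=> x Dx a b ab; rewrite lee_wpmul2r ?lee_fin//.
    by exact/lefP/nd_nnsfun_approx.
congr (limn _); apply/funext => n /=.
transitivity (\sum_(k \in range (h n))
    \int[m]_(x in D) (k * \1_(h n @^-1` [set k]) x)%:E).
  under eq_integral do rewrite fimfunE -fsumEFin//.
  rewrite ge0_integral_fsum//.
  - by move=> y; exact/measurable_EFinP/measurable_funM.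
  - by move=> y x _; rewrite nnfun_muleindic_ge0.
transitivity (\sum_(k \in range (h n))
    \int[leb]_(x in D) ((k * \1_(h n @^-1` [set k]) x)%:E * (w x)%:E)); last first.
  rewrite -ge0_integral_fsum//.
  - apply: eq_integral => x _; rewrite fimfunE -fsumEFin// ge0_mule_fsuml// => r.
    by rewrite nnfun_muleindic_ge0.
  - move=> y; apply: emeasurable_funM; apply/measurable_EFinP; last exact: measurable_funTS.
    exact: measurable_funM.
  - by move=> y x _; rewrite mule_ge0 ?nnfun_muleindic_ge0// lee_fin.
apply: eq_fsbigr => r _.
rewrite integralZl_indic_nnsfun// integral_indic//.
have mI : measurable (h n @^-1` [set r] `&` D) by exact: measurableI.
rewrite mE//.
transitivity (\int[leb]_(x in D) (r%:E * ((\1_(h n @^-1` [set r]) x)%:E * (w x)%:E))); last first.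
  by apply: eq_integral => x _; rewrite EFinM muleA.
have [r0|r0] := ltP r 0%R.
  rewrite preimage_nnfun0// set0I integral_set0 mule0; apply/esym.
  by apply: integral0_eq => x _; rewrite indicE in_set0 mul0e mule0.
rewrite ge0_integralZl//.
- congr (_ * _); rewrite setIC integral_mkcondr; apply: eq_integral => x _.
  by rewrite patchE indicE; case: ifPn; rewrite ?mul1e ?mul0e.
- apply: emeasurable_funM; apply/measurable_EFinP; last exact: measurable_funTS.
  exact: measurable_indic.
- by move=> x _; rewrite mule_ge0// lee_fin.
Qed.

End density.

(** Differentiability is required only inside the segment: powers of [Num.sqrt] are integrated from
    [0], where the square root has no derivative. *)
Lemma FTC2_segment (R : realType) (F f : R -> R) (a b : R) : a <= b ->
  (forall x, a < x < b -> is_derive x 1 F (f x)) ->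
  (forall x, a <= x <= b -> {for x, continuous F}) ->
  (forall x, a <= x <= b -> {for x, continuous f}) ->
  (\int[lebesgue_measure]_(x in `[a, b]) (f x)%:E = (F b - F a)%:E)%E.
Proof.
rewrite le_eqVlt => /predU1P[->|ab] dF cF cf.
  by rewrite set_itv1 integral_set1 subrr.
rewrite (@continuous_FTC2 _ f F)//.
- apply: continuous_in_subspaceT => x; rewrite inE/= in_itv/= => /cf.
  exact.
- split.
  + by move=> x; rewrite in_itv/= => /dF [].
  + by apply: cvg_at_right_filter; apply: cF; rewrite lexx ltW.
  + by apply: cvg_at_left_filter; apply: cF; rewrite lexx ltW.
- by move=> x; rewrite in_itv/= => /dF dFx; rewrite derive1E derive_val.
Qed.

Section nsq_density.
Context {R : realType} {n : nat}.
Notation leb := (@lebesgue_measure R).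
Hypothesis n2 : (2 < n)%N.

(** Half the area of the unit sphere: with [V] the volume of the ball and [t = r^2], one has [n V
    r^(n-1) dr = (n V / 2) t^((n-2)/2) dt]. *)
Definition nsq_weight : R := ball_volume (R := R) (n := n) * n%:R / 2.
Definition nsq_density (t : R) : R := nsq_weight * Num.sqrt t ^+ (n - 2).

Lemma nsq_weight_gt0 : 0 < nsq_weight.
Proof.
by rewrite divr_gt0// mulr_gt0 ?ball_volume_gt0// ltr0n; apply: leq_trans n2.
Qed.

Lemma nsq_density_ge0 t : 0 <= nsq_density t.
Proof. by rewrite mulr_ge0 ?exprn_ge0 ?sqrtr_ge0//; exact/ltW/nsq_weight_gt0. Qed.

Lemma continuous_nsq_density : continuous nsq_density.
Proof.
move=> t; apply: (@continuousM _ R (cst nsq_weight) (fun t => Num.sqrt t ^+ (n - 2))).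
  exact: cst_continuous.
exact: (continuous_comp (@sqrt_continuous R t) (@exprn_continuous _ _ _)).
Qed.

Lemma measurable_nsq_density :
  measurable_fun [set: measurableTypeR R] (nsq_density : _ -> measurableTypeR R).
Proof. exact: continuous_measurable_fun continuous_nsq_density. Qed.

Lemma integral_nsq_density (a b : R) : 0 <= a -> a < b ->
  (\int[leb]_(t in `]a, b]) (nsq_density t)%:E =
   (ball_volume (n := n) * (Num.sqrt b ^+ n - Num.sqrt a ^+ n))%:E)%E.
Proof.
move=> a0 ab.
rewrite integral_itv_obnd_cbnd; last first.
  by apply/measurable_EFinP; apply: measurable_funTS; exact: measurable_nsq_density.
have dF x : a < x < b ->
    is_derive x 1 (fun t => ball_volume (n := n) * Num.sqrt t ^+ n) (nsq_density x).
  move=> /andP[ax xb]; have x0 : 0 < x by exact: le_lt_trans ax.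
  have s0 : 0 < Num.sqrt x by rewrite sqrtr_gt0.
  have ds := is_derive1_sqrt x0.
  apply: is_derive_eq.
  rewrite /nsq_density /nsq_weight.
  case: n n2 => [//|[//|k]] _; rewrite subSS subSS subn0 /=.
  rewrite !exprS /GRing.scale /=.
  by field; rewrite gt_eqF.
rewrite (FTC2_segment (ltW ab) dF).
- by rewrite mulrBr.
- move=> x _; apply: (@continuousM _ R (cst _) (fun t => Num.sqrt t ^+ n)).
    exact: cst_continuous.
  exact: (continuous_comp (@sqrt_continuous R x) (@exprn_continuous _ _ _)).
- by move=> x _; exact: continuous_nsq_density.
Qed.

End nsq_density.

Section density_measure.
Context {R : realType} (w : R -> R).
Notation leb := (@lebesgue_measure R).

(** The two properties of [w] are arguments, so that the measure structure can be inferred from the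
    term itself. *)
Definition density_measure of measurable_fun [set: measurableTypeR R] (w : _ -> measurableTypeR R)
    & (forall x, 0 <= w x) :=
  fun A : set (measurableTypeR R) => (\int[leb]_(x in A) (w x)%:E)%E.

Hypothesis mw : measurable_fun [set: measurableTypeR R] (w : _ -> measurableTypeR R).
Hypothesis w0 : forall x, 0 <= w x.

Let dm0 : density_measure mw w0 set0 = 0%E.
Proof. exact: integral_set0. Qed.

Let dm_ge0 A : (0 <= density_measure mw w0 A)%E.
Proof. by apply: integral_ge0 => x _; rewrite lee_fin. Qed.

Let dm_sigma_additive : semi_sigma_additive (density_measure mw w0).
Proof.
move=> F mF tF mUF; rewrite /density_measure ge0_integral_bigcup//=.
- apply: is_cvg_ereal_nneg_natsum_cond => n _ _.
  by apply: integral_ge0 => x _; rewrite lee_fin.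
- by apply/measurable_EFinP; exact: measurable_funTS.
- by move=> x _; rewrite lee_fin.
Qed.

HB.instance Definition _ := isMeasure.Build _ _ _ (density_measure mw w0)
  dm0 dm_ge0 dm_sigma_additive.

End density_measure.

Lemma measure_eq_ocitv (R : realType)
    (m1 m2 : {measure set (measurableTypeR R) -> \bar R}) :
  (forall a b : R, a < b -> m1 `]a, b]%classic = m2 `]a, b]%classic) ->
  (forall a b : R, a < b -> (m1 `]a, b]%classic < +oo)%E) ->
  forall A, measurable A -> m1 A = m2 A.
Proof.
move=> m12 m1oo.
apply: (@measure_unique _ R (measurableTypeR R) (@ocitv R)
  (fun k => `]- k.+1%:R, k.+1%:R]%classic)) => //.
- exact: ocitvI.
- by move=> k; exact: is_ocitv.
- apply/seteqP; split => // x _.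
  exists (Num.truncn `|x|) => //=; rewrite in_itv/=.
  have := truncnS_gt `|x|; rewrite ltr_norml => /andP[-> /ltW]//.
- by move=> A /ocitvP[->|[[a b] /= ab ->]]; [rewrite !measure0|exact: m12].
- by move=> k; apply: m1oo; rewrite gtrN.
Qed.

(** The images of measures under [nsq] and [Num.sqrt] are explicit on []a, b]] only when [0 <= a];
    an interval reaching into the negative axis is cut at [0]. *)
Lemma measure_eq_ocitv_pos (R : realType)
    (m1 m2 : {measure set (measurableTypeR R) -> \bar R}) :
  m1 `]-oo, 0]%classic = 0%E -> m2 `]-oo, 0]%classic = 0%E ->
  (forall a b : R, 0 <= a -> a < b -> m1 `]a, b]%classic = m2 `]a, b]%classic) ->
  (forall a b : R, 0 <= a -> a < b -> (m1 `]a, b]%classic < +oo)%E) ->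
  forall A, measurable A -> m1 A = m2 A.
Proof.
move=> m1N m2N m12 m1oo.
have zN (m : {measure set (measurableTypeR R) -> \bar R}) (a b : R) :
    m `]-oo, 0]%classic = 0%E -> b <= 0 -> m `]a, b]%classic = 0%E.
  move=> mb b0; apply/eqP; rewrite eq_le measure_ge0 andbT -mb.
  apply: le_measure; rewrite ?inE// => x /=; rewrite !in_itv/= => /andP[_ xb].
  exact: le_trans b0.
have key (a b : R) : a < b -> m1 `]a, b]%classic = m2 `]a, b]%classic /\
    (m1 `]a, b]%classic < +oo)%E.
  move=> ab.
  have [b0|b0] := leP b 0; first by rewrite !zN.
  have [a0|a0] := leP 0 a; first by rewrite m12// -m12// m1oo.
  have E : `]a, b]%classic = `]a, 0]%classic `|` `]0, b]%classic :> set R.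
    by rewrite -(@itv_bndbnd_setU _ _ _ (BRight 0))// bnd_simp// ltW.
  have z (m : {measure set (measurableTypeR R) -> \bar R}) :
      m `]-oo, 0]%classic = 0%E -> m `]a, b]%classic = m `]0, b]%classic.
    move=> mb; rewrite E measureU//=; last first.
      apply/seteqP; split => x //=; rewrite !in_itv/= => -[/andP[_ x0] /andP[]].
      by rewrite ltNge x0.
    by rewrite zN ?add0e.
  by rewrite !z// m12//; split=> //; rewrite -m12// m1oo.
by apply: measure_eq_ocitv => a b ab; case: (key a b ab).
Qed.

Section nsq_density.
Context {R : realType} {n : nat}.
Notation leb := (@lebesgue_measure R).
Hypothesis n2 : (2 < n)%N.

Lemma lebesgue_row_preimage_nsq (A : set (measurableTypeR R)) : measurable A ->
  (lebesgue_row n (nsq @^-1` A) = \int[leb]_(t in A) (nsq_density (n := n) t)%:E)%E.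
Proof.
have mn := @measurable_nsq R n.
pose m1 : {measure set (measurableTypeR R) -> \bar R} :=
  (measure_function_pushforward__canonical__measure_function_Measure (lebesgue_row n) mn).
pose m2 : {measure set (measurableTypeR R) -> \bar R} :=
  density_measure (@measurable_nsq_density R n) (@nsq_density_ge0 _ _ n2).
have n0 : (0 < n)%N by exact: leq_trans n2.
apply: (@measure_eq_ocitv_pos _ m1 m2) => [||a b a0 ab|a b a0 ab].
- rewrite [LHS](_ : _ = lebesgue_row n [set x : 'rV[R]_n | nsq x <= 0]).
    by rewrite lebesgue_row_ball0.
  by rewrite /m1/= /pushforward; congr (lebesgue_row n _); apply/seteqP; split => x /=;
    rewrite in_itv.
- apply: integral0_eq => x /=; rewrite in_itv/= => x0.
  by rewrite /nsq_density ler0_sqrtr// expr0n/= subn_eq0 leqNgt n2/= mulr0.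
- by rewrite [LHS](lebesgue_row_shell a0 ab n0) [RHS](integral_nsq_density n2 a0 ab).
- by rewrite [X in (X < _)%E](lebesgue_row_shell a0 ab n0) ltry.
Qed.

Lemma ge0_integral_nsq (f : R -> \bar R) (D : set (measurableTypeR R)) : measurable D ->
  measurable_fun D (f : measurableTypeR R -> _) -> (forall t, 0 <= f t)%E ->
  (\int[lebesgue_row n]_(x in nsq @^-1` D) f (nsq x) =
   \int[leb]_(t in D) (f t * (nsq_density (n := n) t)%:E))%E.
Proof.
move=> mD mf f0; have mn := @measurable_nsq R n.
pose m1 : {measure set (measurableTypeR R) -> \bar R} :=
  (measure_function_pushforward__canonical__measure_function_Measure (lebesgue_row n) mn).
rewrite -(@ge0_integral_density R m1 nsq_density)//.
- by rewrite [RHS]ge0_integral_pushforward// => y _; exact: f0.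
- exact: measurable_nsq_density.
- exact: nsq_density_ge0.
- exact: lebesgue_row_preimage_nsq.
Qed.

End nsq_density.

(** The image of Lebesgue measure on []c, +oo[] under [t |-> sqrt (t - c)] has density [2 s] on the
    half-line, so it does not charge null sets. This map gives the first coordinate of a point of
    squared norm [t] on a line parallel to the first axis at squared distance [c] from the
    origin. *)
Lemma null_preimage_sqrt (R : realType) (c : R) (S : set (measurableTypeR R)) :
  measurable S -> lebesgue_measure S = 0%E ->
  measurable [set t : measurableTypeR R | c < t /\ S (Num.sqrt (t - c))] /\
  (lebesgue_measure [set t : R | (c < t)%R /\ S (Num.sqrt (t - c))] = 0)%E.
Proof.
move=> mS S0.
pose phi (t : measurableTypeR R) : measurableTypeR R := Num.sqrt (t - c).
have cphi : continuous (phi : R -> R).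
  move=> t; apply: (continuous_comp (f := fun t : R => t - c)) (@sqrt_continuous R _).
  by apply: continuousB => //; exact: cst_continuous.
have mphi : measurable_fun [set: measurableTypeR R] phi.
  exact: (continuous_measurable_fun cphi).
have mD : measurable (`]c, +oo[%classic : set (measurableTypeR R)) by [].
pose m0 : {measure set (measurableTypeR R) -> \bar R} :=
  mrestr (@lebesgue_measure R) mD.
pose m1 : {measure set (measurableTypeR R) -> \bar R} :=
  (measure_function_pushforward__canonical__measure_function_Measure m0 mphi).
have cw : continuous (fun s : R => 2 * Num.max s 0).
  move=> s; apply: cvgM; first exact: cvg_cst.
  by apply: (@continuous_max _ _ id (cst 0)) => //; exact: cst_continuous.
have mw : measurable_fun [set: measurableTypeR R]
    ((fun s : R => 2 * Num.max s 0) : _ -> measurableTypeR R).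
  exact: continuous_measurable_fun cw.
have w0 (s : R) : 0 <= 2 * Num.max s 0 by rewrite mulr_ge0// le_max lexx orbT.
pose m2 : {measure set (measurableTypeR R) -> \bar R} := density_measure mw w0.
have m1E A : m1 A = lebesgue_measure [set t : R | c < t /\ A (Num.sqrt (t - c))].
  rewrite /m1 /= /pushforward /m0/= /mrestr; congr (lebesgue_measure _).
  by apply/seteqP; split => t /=; rewrite in_itv/= andbT => -[].
have E (a b : R) : 0 <= a -> a < b -> m1 `]a, b]%classic = (b ^+ 2 - a ^+ 2)%:E.
  move=> a0 ab; rewrite m1E.
  have b0 : 0 < b by exact: le_lt_trans ab.
  rewrite (_ : [set _ | _] = `]c + a ^+ 2, c + b ^+ 2]%classic); last first.
    apply/seteqP; split => t /=; rewrite !in_itv/=.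
      move=> [ct /andP[at_ tb]]; have tc0 : 0 <= t - c by rewrite subr_ge0 ltW.
      rewrite -ltrBrDl -lerBlDl -(sqr_sqrtr tc0) ltr_pXn2r ?nnegrE ?sqrtr_ge0// at_/=.
      by rewrite ler_pXn2r ?nnegrE ?sqrtr_ge0// ltW.
    move=> /andP[at_ tb].
    have ct : c < t by apply: le_lt_trans at_; rewrite lerDl sqr_ge0.
    have tc0 : 0 <= t - c by rewrite subr_ge0 ltW.
    move: at_ tb; rewrite -ltrBrDl -lerBlDl -(sqr_sqrtr tc0).
    rewrite ltr_pXn2r ?nnegrE ?sqrtr_ge0// ler_pXn2r ?nnegrE ?sqrtr_ge0 ?(ltW b0)//.
    by rewrite sqr_sqrtr// => -> ->.
  rewrite lebesgue_measure_itv/= lte_fin ltrD2l ltr_pXn2r ?nnegrE ?(ltW b0)// ab.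
  by rewrite -EFinB; congr (_%:E); ring.
have : m1 S = m2 S.
  apply: (@measure_eq_ocitv_pos _ m1 m2) => //.
  - rewrite m1E (_ : [set _ | _] = set0) ?measure0//; apply/seteqP; split => t //=.
    rewrite in_itv/= => -[ct]; apply/negP; rewrite -ltNge sqrtr_gt0 subr_gt0//.
  - apply: integral0_eq => x /=; rewrite in_itv/= => x0.
    by rewrite (_ : Num.max x 0 = 0) ?mulr0//; apply/max_idPr.
  - move=> a b a0 ab; rewrite E//= /density_measure integral_itv_obnd_cbnd; last first.
      by apply/measurable_EFinP; exact: measurable_funTS.
    have dF x : a < x < b -> is_derive x 1 (fun s : R => s ^+ 2) (2 * Num.max x 0).
      move=> /andP[ax _]; apply: is_derive_eq.
      rewrite (_ : Num.max x 0 = x) ?expr1 ?mulr1//; apply/max_idPl/ltW.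
      exact: le_lt_trans ax.
    rewrite (FTC2_segment (ltW ab) dF)// => x _; last exact: cw.
    exact: exprn_continuous.
  - by move=> a b a0 ab; rewrite E// ltry.
rewrite m1E => ->; split; last first.
  rewrite /m2/= /density_measure.
  by apply: null_set_integral => //; apply/measurable_EFinP; exact: measurable_funTS.
rewrite (_ : [set _ | _] = phi @^-1` S `&` `]c, +oo[%classic).
  by apply: measurableI => //; rewrite -[X in measurable X]setTI; exact: (mphi measurableT).
by apply/seteqP; split => t /=; rewrite in_itv/= andbT => -[].
Qed.

(** [cons_measure] integrates over the first coordinate last. Uniqueness of the product measure
    allows integrating over [y] last instead, and a nonnegative function of zero integral vanishes
    almost everywhere. *)
Lemma lebesgue_row_slice (R : realType) k (Z : set 'rV[R]_k.+1) : measurable Z ->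
  lebesgue_row k.+1 Z = 0%E ->
  {ae lebesgue_row k, forall y : 'rV[R]_k,
    lebesgue_measure [set a : R | Z (row_cons (a : measurableTypeR R, y))] = 0%E}.
Proof.
move=> mZ Z0.
have mZ' : measurable (@row_cons R k @^-1` Z).
  by rewrite -[X in measurable X]setTI; exact: measurable_row_cons.
have : (\int[lebesgue_row k]_y
   lebesgue_measure (ysection (@row_cons R k @^-1` Z) y) = 0)%E.
  rewrite -[LHS]/((lebesgue_measure \x^ lebesgue_row k)%E (@row_cons R k @^-1` Z)).
  rewrite -[RHS]Z0 /= /cons_measure /pushforward.
  apply/esym; apply: product_measure_unique => // A B mA mB.
  exact: (product_measure2E _ _ mA mB).
have my : measurable_fun [set: 'rV[R]_k]
    (fun y => lebesgue_measure (ysection (@row_cons R k @^-1` Z) y)).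
  exact: measurable_fun_ysection.
move=> I0.
have : (\int[lebesgue_row k]_y `|lebesgue_measure (ysection (@row_cons R k @^-1` Z) y)| = 0)%E.
  by rewrite -[RHS]I0; apply: eq_integral => y _; rewrite gee0_abs.
move/(ae_eq_integral_abs _ measurableT my) => /=.
apply: filterS => y /= /(_ Logic.I) <-.
by congr (lebesgue_measure _); apply/seteqP; split => a /=; rewrite /ysection/= inE.
Qed.

Lemma nsq_row_cons (R : realType) k (p : measurableTypeR R * 'rV[R]_k) :
  nsq (row_cons p) = p.1 ^+ 2 + nsq p.2.
Proof.
rewrite !nsqE big_ord_recl row_cons0; congr (_ + _).
by apply: eq_bigr => i _; rewrite mxE liftK.
Qed.

Lemma measurable_row_cons1 (R : realType) k (y : 'rV[R]_k) :
  measurable_fun [set: measurableTypeR R]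
    (fun a : measurableTypeR R => row_cons (a, y)).
Proof.
rewrite (_ : (fun a => _) = @row_cons R k \o (fun a => (a, y)))//.
apply: measurableT_comp; first exact: measurable_row_cons.
exact: measurable_fun_pair.
Qed.

Lemma measurable_hball (R : realType) n : measurable (hball : set 'rV[R]_n).
Proof.
rewrite hballE (_ : [set _ | _] = nsq @^-1` `]-oo, 1[%classic).
  exact: measurable_nsq_preimage.
by apply/seteqP; split => x /=; rewrite in_itv.
Qed.

(* The function provided by [radial] need not be measurable.  Almost every line parallel to the
   first axis determines it almost everywhere on the radii that the line meets, and measurably so;
   [F] is the upper limit of these readings along lines approaching the origin. *)
Lemma measurable_radial_profile (R : realType) (n : nat) (u : 'rV[R]_n -> R) :
  (2 < n)%N -> measurable_fun (hball : set 'rV[R]_n) (u : _ -> measurableTypeR R) ->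
  radial u ->
  exists2 F : R -> R,
    measurable_fun [set: measurableTypeR R] (F : _ -> measurableTypeR R) &
    {ae lebesgue_row n, forall x, hball x -> u x = F (nsq x)}.
Proof.
case: n u => // k u k1 mu [f [Z [mZ Z0 uf]]].
have mball := @measurable_hball R k.+1.
pose u' := u \_ hball.
have mu' : measurable_fun [set: 'rV[R]_k.+1] (u' : _ -> measurableTypeR R).
  by apply/(measurable_restrictT _ _).1.
have {}uf x : ~ Z x -> hball x -> u x = f (enorm x).
  by move=> Zx; apply: contrapT => ufx; apply/Zx/uf.
have [Y [mY Y0 Yok]] := lebesgue_row_slice mZ Z0.
have exy m : exists2 y : 'rV[R]_k, nsq y < m.+1%:R^-1 & ~ Y y.
  apply: contrapT => noy.
  have : (lebesgue_row k [set y : 'rV[R]_k | (nsq y < m.+1%:R^-1)%R] <= 0)%E.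
    rewrite -[X in (_ <= X)%E]Y0; apply: le_measure; rewrite ?inE//.
      rewrite (_ : [set _ | _] = nsq @^-1` `]-oo, m.+1%:R^-1[%classic).
        exact: measurable_nsq_preimage.
      by apply/seteqP; split => x /=; rewrite in_itv.
    by move=> y /= ym; apply: contrapT => yY; apply: noy; exists y.
  by apply/negP; rewrite -ltNge lebesgue_row_ball_gt0// invr_gt0.
pose y m := sval (cid2 (exy m)).
have ylt m : nsq (y m) < m.+1%:R^-1 by rewrite /y; case: cid2.
have yY m : ~ Y (y m) by rewrite /y; case: cid2.
pose S m : set (measurableTypeR R) := [set a | Z (row_cons (a, y m))].
have mS m : measurable (S m).
  by rewrite -[X in measurable X]setTI; exact: measurable_row_cons1.
have S0 m : lebesgue_measure (S m) = 0%E.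
  by apply: contrapT => Sm; apply: (yY m); apply: Yok.
pose T m : set (measurableTypeR R) :=
  [set t | nsq (y m) < t /\ S m (Num.sqrt (t - nsq (y m)))].
have [mT T0] : (forall m, measurable (T m)) /\ (forall m, lebesgue_measure (T m) = 0%E).
  by split=> m; have [] := null_preimage_sqrt (nsq (y m)) (mS m) (S0 m).
pose G m (t : measurableTypeR R) : measurableTypeR R :=
  u' (row_cons (Num.sqrt (t - nsq (y m)) : measurableTypeR R, y m)).
have mG m : measurable_fun [set: measurableTypeR R] (G m).
  apply: (measurableT_comp mu').
  apply: (measurableT_comp (measurable_row_cons1 (y m))).
  apply: continuous_measurable_fun => t.
  apply: (continuous_comp (f := fun t : R => t - nsq (y m))) (@sqrt_continuous R _).
  by apply: continuousB => //; exact: cst_continuous.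
have GE m t : nsq (y m) < t -> t < 1 -> ~ T m t -> G m t = f (Num.sqrt t).
  move=> yt t1 Tt.
  have nt : nsq (row_cons (Num.sqrt (t - nsq (y m)) : measurableTypeR R, y m)) = t.
    by rewrite nsq_row_cons/= sqr_sqrtr ?subrK// subr_ge0 ltW.
  rewrite /G /u' patchE mem_set; last by rewrite hballE/= nt.
  rewrite uf; [| |by rewrite hballE/= nt].
    by rewrite /enorm -/(nsq _) nt.
  by move=> ZZ; apply: Tt; split.
pose F (t : measurableTypeR R) : measurableTypeR R := fine (limn_esup (fun m => (G m t)%:E)).
have mF : measurable_fun [set: measurableTypeR R] F.
  apply: measurableT_comp => //.
  apply: (measurable_fun_limn_esup (f := fun m t => (G m t)%:E)) => m.
  by apply/measurable_EFinP; exact: mG.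
exists F => //.
have FE t : 0 < t -> t < 1 -> (forall m, ~ T m t) -> F t = f (Num.sqrt t).
  move=> t0 t1 Tt; rewrite /F.
  rewrite (_ : limn_esup _ = (f (Num.sqrt t))%:E)//.
  suff H : (fun m => (G m t)%:E) @ \oo --> (f (Num.sqrt t))%:E.
    rewrite is_cvg_limn_esupE; first exact: cvg_lim.
    by apply/cvg_ex; exists (f (Num.sqrt t))%:E.
  (* As soon as [nsq (y m) < t], the line through [y m] meets the sphere of squared radius [t] and
     reads the value of [f] there: the sequence is eventually constant. *)
  apply: cvg_near_cst; near=> m.
  congr (_%:E); apply: GE => //.
  apply: lt_trans (ylt m) _.
  by near: m; exact: near_infty_natSinv_lt (PosNum t0).
(* [t = 0] is discarded because no line satisfies [nsq (y m) < 0]. *)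
pose TT : set (measurableTypeR R) := [set 0] `|` \bigcup_m T m.
have mTT : measurable TT by apply: measurableU => //; exact: bigcupT_measurable.
have TT0 : lebesgue_measure TT = 0%E.
  rewrite null_set_setU//; [exact: bigcupT_measurable|exact: lebesgue_measure_set1|].
  apply/negligibleP; first exact: bigcupT_measurable.
  apply: negligible_bigcup => m; apply/negligibleP; [exact: mT|exact: T0].
exists (Z `|` nsq @^-1` TT); split.
- by apply: measurableU => //; exact: measurable_nsq_preimage.
- rewrite null_set_setU//; first exact: measurable_nsq_preimage.
  rewrite [LHS](lebesgue_row_preimage_nsq k1 mTT); apply: null_set_integral => //.
  by apply/measurable_EFinP; apply: measurable_funTS; exact: measurable_nsq_density.
- move=> x /= ux; apply: contrapT => /not_orP[Zx Tx]; apply: ux => hx.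
  rewrite uf//; rewrite FE//.
  + rewrite lt_neqAle nsq_ge0 andbT; apply/eqP => x0; apply: Tx; left.
    exact/esym.
  + by move: hx; rewrite hballE.
  + by move=> m Tm; apply: Tx; right; exists m.
Unshelve. all: by end_near. Qed.

(** * Radial test functions *)

(** It serves at the origin for [flat P] and for [power_prim], where no differentiation rule
    applies. *)
Lemma is_derive0_quadratic (R : realType) (f : R -> R) (C : R) :
  (forall t, `|f t| <= C * t ^+ 2) -> is_derive (0 : R) 1 f 0.
Proof.
move=> fC.
have f0 : f 0 = 0 by apply/normr0_eq0/le_anti; rewrite normr_ge0 (le_trans (fC 0))// expr0n mulr0.
have C0 : 0 <= C by have := fC 1; rewrite expr1n mulr1; exact: le_trans.
have C1 : 0 < C + 1 by rewrite ltr_wpDl.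
have L : h^-1 *: (f (h *: 1 + 0) - f 0) @[h --> 0^'] --> (0 : R).
  apply/cvgrPdist_le => e e0; near=> h.
  rewrite f0 subr0 addr0 /GRing.scale/= mulr1 sub0r normrN normrM normfV.
  have h0 : h != 0 by near: h; exact: nbhs_dnbhs_neq.
  rewrite ler_pdivrMl ?normr_gt0//.
  apply: le_trans (fC h) _.
  rewrite -(@real_normK _ h) ?num_real// expr2 mulrCA ler_wpM2l//.
  apply: (@le_trans _ _ ((C + 1) * `|h|)); first by rewrite ler_wpM2r// lerDl.
  rewrite -ler_pdivlMl// mulrC.
  near: h; apply: dnbhs0_le; exact: (divr_gt0 e0 C1).
by split; [apply/cvg_ex; exists 0|exact: cvg_lim].
Unshelve. all: by end_near. Qed.

(** * Smooth functions of one variable *)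

Section Cn.
Context {R : realType}.
Implicit Types (D : set R) (f g : R -> R).

(** The derivative is an existential witness, so that closure under algebraic operations is a plain
    induction on [n]. The domain [D] is there for [Num.sqrt] and inverses, which are smooth only on
    part of the line. *)
Fixpoint Cn D n f : Prop :=
  if n is m.+1 then
    exists g, (forall t, D t -> is_derive t 1 f (g t)) /\ Cn D m g
  else True.

Lemma CnW D n f : Cn D n.+1 f -> Cn D n f.
Proof.
elim: n f => [//|n IH] f [g [fg /IH gn]].
by exists g.
Qed.

Lemma CnS D D' n f : D' `<=` D -> Cn D n f -> Cn D' n f.
Proof.
move=> DD; elim: n f => [//|n IH] f [g [fg /IH gn]].
by exists g; split => // t /DD /fg.
Qed.

Lemma Cn_cst D n c : Cn D n (fun=> c).
Proof.
elim: n c => [//|n IH] c; exists (fun=> 0); split => // t _.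
exact: is_derive_cst.
Qed.

Lemma Cn_id D n : Cn D n id.
Proof.
case: n => [//|n]; exists (fun=> 1); split; last exact: Cn_cst.
by move=> t _; exact: is_derive_id.
Qed.

Lemma CnD D n f g : Cn D n f -> Cn D n g -> Cn D n (fun t => f t + g t).
Proof.
elim: n f g => [//|n IH] f g [f' [ff fn]] [g' [gg gn]].
exists (fun t => f' t + g' t); split; last exact: IH.
by move=> t Dt; have := ff _ Dt; have := gg _ Dt => ? ?; exact: is_derive1_add.
Qed.

Lemma CnM D n f g : Cn D n f -> Cn D n g -> Cn D n (fun t => f t * g t).
Proof.
elim: n f g => [//|n IH] f g fS gS.
have [f' [ff fn]] := fS; have [g' [gg gn]] := gS.
exists (fun t => f' t * g t + f t * g' t); split.
  by move=> t Dt; have := ff _ Dt; have := gg _ Dt => ? ?; exact: is_derive1_mul.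
by apply: CnD; apply: IH => //; exact: CnW.
Qed.

Lemma CnN D n f : Cn D n f -> Cn D n (fun t => - f t).
Proof.
move=> fn; rewrite (_ : (fun t => _) = fun t => -1 * f t).
  by apply: CnM => //; exact: Cn_cst.
by apply/funext => t; rewrite mulN1r.
Qed.

Lemma CnB D n f g : Cn D n f -> Cn D n g -> Cn D n (fun t => f t - g t).
Proof. by move=> fn gn; apply: CnD => //; exact: CnN. Qed.

Lemma CnX D n f k : Cn D n f -> Cn D n (fun t => f t ^+ k).
Proof.
move=> fn; elim: k => [|k IH].
  rewrite (_ : (fun t => _) = fun=> 1); first exact: Cn_cst.
  by apply/funext => t; rewrite expr0.
rewrite (_ : (fun t => _) = fun t => f t * f t ^+ k); first exact: CnM.
by apply/funext => t; rewrite exprS.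
Qed.

Lemma CnV D n f : (forall t, D t -> f t != 0) -> Cn D n f -> Cn D n (fun t => (f t)^-1).
Proof.
move=> f0; elim: n f f0 => [//|n IH] f f0 fS; have [f' [ff fn]] := fS.
exists (fun t => - (f t)^-1 ^+ 2 * f' t); split.
  move=> t Dt; have H := ff _ Dt.
  by apply: (is_derive_eq (is_deriveV (f0 _ Dt) H)); rewrite exprVn.
apply: CnM => //; apply: CnN; apply: CnX; apply: IH => //; exact: CnW.
Qed.

Lemma Cn_sqrt n : Cn [set t | 0 < t] n Num.sqrt.
Proof.
elim: n => [//|n IH]; exists (fun t => (2 * Num.sqrt t)^-1); split.
  by move=> t t0; exact: is_derive1_sqrt.
apply: CnV; last by apply: CnM => //; exact: Cn_cst.
by move=> t /= t0; rewrite mulf_neq0// gt_eqF// sqrtr_gt0.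
Qed.

Lemma Cn_affine n f (k a : R) : Cn setT n f -> Cn setT n (fun t => f (k * (t - a))).
Proof.
elim: n f => [//|n IH] f [f' [ff fn]].
exists (fun t => f' (k * (t - a)) * k); split.
  move=> t _; have H := ff (k * (t - a)) Logic.I.
  have H2 : is_derive t 1 (fun t => k * (t - a)) k.
    have E := is_derive1_mul (is_derive_cst k t 1)
      (is_derive1_add (is_derive_id t 1) (is_derive_cst (- a) t 1)).
    by apply: (is_derive_eq E); rewrite mul0r add0r addr0 mulr1.
  exact: (@is_derive1_comp _ f (fun t => k * (t - a)) t _ _ H H2).
by apply: CnM; [exact: IH|exact: Cn_cst].
Qed.

Lemma Cn_congr D n f g : open D -> (forall t, D t -> f t = g t) -> Cn D n f -> Cn D n g.
Proof.
move=> oD fg; case: n => [//|n] [f' [ff fn]]; exists f'; split => // t Dt.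
apply: (near_eq_is_derive _ (ff _ Dt)).
by near=> s; apply: fg; near: s; exact: open_nbhs_nbhs.
Unshelve. all: by end_near. Qed.

(** On an open set the witness may be replaced by the canonical [derive1 f]. This makes gluing
    possible in [CnU]: both domains then speak of the same derivative. *)
Lemma CnSP D n f : open D ->
  Cn D n.+1 f <-> (forall t, D t -> derivable f t 1) /\ Cn D n (derive1 f).
Proof.
move=> oD; split.
  move=> [g [fg gn]]; split.
    by move=> t /fg [].
  apply: Cn_congr gn => // t Dt.
  by have H := fg _ Dt; rewrite derive1E derive_val.
move=> [df fn]; exists (derive1 f); split => // t Dt.
by rewrite derive1E; apply: derivableP; exact: df.
Qed.

Lemma CnU D D' n f : open D -> open D' -> Cn D n f -> Cn D' n f -> Cn (D `|` D') n f.
Proof.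
move=> oD oD'; elim: n f => [//|n IH] f.
rewrite !CnSP//; last exact: openU.
move=> [df fn] [df' fn']; split; last exact: IH.
by move=> t [/df|/df'].
Qed.

(** Its use is for products with powers of [1 / sqrt t] and for primitives: vanishing below some
    [a > 0] hides what happens at [0]. *)
Lemma Cn_extend0 n f a : 0 < a -> (forall t, t < a -> f t = 0) ->
  Cn [set t | 0 < t] n f -> Cn setT n f.
Proof.
move=> a0 f0 fn.
have -> : setT = [set t | 0 < t] `|` [set t | t < a].
  apply/esym/seteqP; split => // t _ /=.
  by have [?|t0] := ltP 0 t; [left|right; exact: le_lt_trans a0].
apply: CnU => //.
apply: (@Cn_congr _ _ (fun=> 0)) => //; last exact: Cn_cst.
by move=> t /= /f0 ->.
Qed.

Definition smooth1 f := forall n, Cn setT n f.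

Lemma smooth1_derive1 f : smooth1 f -> smooth1 (derive1 f).
Proof. by move=> sf n; have := sf n.+1; rewrite CnSP; [case|exact: openT]. Qed.

Lemma smooth1_derive1n f k : smooth1 f -> smooth1 (derive1n k f).
Proof.
by elim: k => [//|k IH] sf; rewrite derive1nS; apply: smooth1_derive1; exact: IH.
Qed.

Lemma smooth1_derivable f (t : R) : smooth1 f -> derivable f t 1.
Proof. by move=> /(_ 1%N) [g [fg _]]; have [] := fg t Logic.I. Qed.

Lemma smooth1_is_derive f (t : R) : smooth1 f -> is_derive t 1 f ((derive1 f) t).
Proof. by move=> sf; rewrite derive1E; apply: derivableP; exact: smooth1_derivable. Qed.

Lemma smooth1_continuous f : smooth1 f -> continuous f.
Proof.
move=> sf t; apply/differentiable_continuous/derivable1_diffP.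
exact: smooth1_derivable.
Qed.

End Cn.

Section flat.
Context {R : realType}.
Implicit Types (P : {poly R}).

(* Stable under derivation: this is what makes [exp (-1/t)] smooth at [0]. *)
Definition flat P (t : R) : R := if 0 < t then P.[t^-1] * expR (- t^-1) else 0.

Lemma powV_expRN (y : R) k : 0 <= y -> y ^+ k * expR (- y) <= k`!%:R.
Proof.
move=> y0; rewrite expRN ler_pdivrMr ?expR_gt0//.
case: k => [|k]; first by rewrite expr0 fact0 mul1r -expR0 ler_expR.
rewrite -ler_pdivrMl ?ltr0n ?fact_gt0// mulrC.
by apply: le_trans (expR_ge1Dxn k y0); rewrite lerDr.
Qed.

(** With [y = 1/t], division by [t^2] raises each monomial by two powers, and
    [y^k exp(-y) <= k!]. *)
Lemma flat_quadratic P : exists C, forall t, `|flat P t| <= C * t ^+ 2.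
Proof.
pose C := \sum_(i < size P) `|P`_i| * (i.+2)`!%:R.
have C0 : 0 <= C by apply: sumr_ge0 => i _; rewrite mulr_ge0.
exists C => t; rewrite /flat; case: ifPn => t0; last by rewrite normr0 mulr_ge0// sqr_ge0.
have y0 : 0 < t^-1 by rewrite invr_gt0.
rewrite -[t in _ <= _ * t ^+ 2]invrK exprVn ler_pdivlMr ?exprn_gt0//.
set y := t^-1 in y0 *.
rewrite horner_coef normrM (ger0_norm (expR_ge0 _)) mulrAC.
apply: (@le_trans _ _ (\sum_(i < size P) `|P`_i| * (y ^+ i.+2 * expR (- y)))).
  rewrite -mulrA (_ : y ^+ 2 * _ = y ^+ 2 * expR (- y))//.
  apply: (@le_trans _ _ ((\sum_(i < size P) `|P`_i * y ^+ i|) * (y ^+ 2 * expR (- y)))).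
    by rewrite ler_wpM2r ?ler_norm_sum// mulr_ge0 ?expR_ge0// exprn_ge0// ltW.
  rewrite mulr_suml ler_sum// => i _.
  rewrite normrM (ger0_norm (exprn_ge0 _ (ltW y0))) -mulrA ler_wpM2l//.
  by rewrite mulrA -exprD addn2.
by rewrite ler_sum// => i _; rewrite ler_wpM2l// powV_expRN// ltW.
Qed.

Lemma is_derive_flat P (t : R) : is_derive t 1 (flat P) (flat ('X^2 * (P - P^`())) t).
Proof.
have [t0|t0|->] := ltgtP t 0.
- rewrite {2}/flat ltNge (ltW t0)/=.
  apply: (near_eq_is_derive _ (is_derive_cst (0 : R) t 1)).
  by near=> s; rewrite /flat ltNge ltW//; near: s; exact: lt_nbhsl.
- rewrite {2}/flat t0.
  have d1 : is_derive t 1 (fun s : R => s^-1) (- t ^- 2).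
    by apply: (is_derive_eq (is_deriveV (f := id) _ _)) => //; rewrite ?gt_eqF// /GRing.scale/= mulr1.
  have d2 : is_derive t 1 (fun s : R => P.[s^-1]) (P^`().[t^-1] * - t ^- 2).
    exact: (is_derive1_comp (is_derive_poly P t^-1) d1).
  have d3 : is_derive t 1 (fun s : R => expR (- s^-1)) (expR (- t^-1) * - - t ^- 2).
    exact: (is_derive1_comp (is_derive_expR _) (is_derive1_opp d1)).
  have d4 := is_derive1_mul d2 d3.
  have d5 : is_derive t 1 (fun s : R => P.[s^-1] * expR (- s^-1))
      (('X^2 * (P - P^`())).[t^-1] * expR (- t^-1)).
    have E (p q e v : R) : q * - v * e + p * (e * - - v) = v * (p - q) * e by ring.
    by apply: (is_derive_eq d4); rewrite E !hornerE exprVn.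
  apply: (near_eq_is_derive _ d5).
  by near=> s; rewrite /flat (_ : 0 < s)//; near: s; exact: lt_nbhsr.
- rewrite {2}/flat ltxx.
  have [C HC] := flat_quadratic P.
  exact: is_derive0_quadratic HC.
Unshelve. all: by end_near. Qed.

Lemma smooth1_flat P : smooth1 (flat P).
Proof.
move=> n; elim: n P => [//|n IH] P.
by exists (flat ('X^2 * (P - P^`()))); split => // t _; exact: is_derive_flat.
Qed.

Definition step (t : R) : R := flat 1 t / (flat 1 t + flat 1 (1 - t)).

Lemma flat1_ge0 t : 0 <= flat 1 t.
Proof. by rewrite /flat; case: ifP => // _; rewrite hornerE mul1r expR_ge0. Qed.

Lemma flat1_gt0 t : 0 < t -> 0 < flat 1 t.
Proof. by rewrite /flat => ->; rewrite hornerE mul1r expR_gt0. Qed.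

Lemma flat1_eq0 t : t <= 0 -> flat 1 t = 0.
Proof. by move=> t0; rewrite /flat ltNge t0. Qed.

Lemma step_den_gt0 t : 0 < flat 1 t + flat 1 (1 - t).
Proof.
have [t0|t0] := ltP 0 t; first by rewrite ltr_pwDl ?flat1_gt0 ?flat1_ge0.
by rewrite ltr_wpDl ?flat1_ge0// flat1_gt0// subr_gt0 (le_lt_trans t0).
Qed.

Lemma smooth1_step : smooth1 step.
Proof.
move=> n; apply: CnM; first exact: smooth1_flat.
apply: CnV; first by move=> t _; rewrite gt_eqF// step_den_gt0.
apply: CnD; first exact: smooth1_flat.
rewrite (_ : (fun t => _) = fun t => flat 1 (-1 * (t - 1))).
  by apply: Cn_affine; exact: smooth1_flat.
by apply/funext => t; congr (flat 1 _); ring.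
Qed.

Lemma step_le0 t : t <= 0 -> step t = 0.
Proof. by move=> t0; rewrite /step flat1_eq0// mul0r. Qed.

Lemma step_ge1 t : 1 <= t -> step t = 1.
Proof.
move=> t1; rewrite /step (flat1_eq0 (t := 1 - t)) ?subr_le0// addr0 divff//.
by rewrite gt_eqF// flat1_gt0// (lt_le_trans _ t1).
Qed.

Lemma step_ge0 t : 0 <= step t.
Proof. by rewrite divr_ge0 ?flat1_ge0// ltW// step_den_gt0. Qed.

Lemma step_le1 t : step t <= 1.
Proof. by rewrite ler_pdivrMr ?step_den_gt0// mul1r lerDl flat1_ge0. Qed.

Lemma derive1_step_out t : ~ (0 <= t <= 1) -> derive1 step t = 0.
Proof.
move=> /negP; rewrite negb_and -!ltNge => /orP[t0|t1]; rewrite derive1E.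
  have : is_derive t 1 step 0.
    apply: (near_eq_is_derive _ (is_derive_cst (0 : R) t 1)).
    by near=> s; rewrite step_le0// ltW//; near: s; exact: lt_nbhsl.
  by move=> ?; rewrite derive_val.
have : is_derive t 1 step 0.
  apply: (near_eq_is_derive _ (is_derive_cst (1 : R) t 1)).
  by near=> s; rewrite step_ge1// ltW//; near: s; exact: lt_nbhsr.
by move=> ?; rewrite derive_val.
Unshelve. all: by end_near. Qed.

Lemma derive1_step_bounded : exists C : R, forall t, `|derive1 step t| <= C.
Proof.
have [c _ H] : exists2 c : R, c \in `[0, 1]%R & forall t, t \in `[0, 1]%R ->
    `|derive1 step t| <= `|derive1 step c|.
  apply: (@EVT_max _ (fun t => `|derive1 step t|)) => //.
  apply: continuous_subspaceT => t.
  apply: continuous_comp; last exact: norm_continuous.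
  exact: smooth1_continuous (smooth1_derive1 smooth1_step) t.
exists `|derive1 step c| => t.
have [t01|t01] := boolP (0 <= t <= 1); first by apply: H; rewrite in_itv.
by rewrite derive1_step_out ?normr0//; exact/negP.
Qed.

End flat.

(** * Test functions on the ball *)

Section test_functions.
Context {R : realType} {n : nat}.
Implicit Types (x : 'rV[R]_n) (psi : R -> R).

Lemma differentiable_coord_row i x : differentiable (fun x : 'rV[R]_n => x 0 i) x.
Proof. exact: differentiable_coord. Qed.

Lemma is_derive_coord (i j : 'I_n) x :
  is_derive x (basis_vec i) (fun x : 'rV[R]_n => x 0 j) ((i == j)%:R : R).
Proof.
apply: DeriveDef; first exact/diff_derivable/differentiable_coord_row.
apply: cvg_lim => //; apply: cvg_near_cst; near=> h.
rewrite /= !mxE eqxx/= addrK /GRing.scale/= mulrA mulVf ?mul1r; first by rewrite eq_sym.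
by near: h; exact: nbhs_dnbhs_neq.
Unshelve. all: by end_near. Qed.

Lemma nsq_sumE : nsq = \sum_i ((fun x : 'rV[R]_n => x 0 i) * (fun x : 'rV[R]_n => x 0 i)) :> ('rV[R]_n -> R).
Proof. by apply/funext => y; rewrite fct_sumE. Qed.

Lemma differentiable_nsq x : differentiable (nsq : 'rV[R]_n -> R) x.
Proof.
rewrite nsq_sumE.
by apply: differentiable_sum => i; apply: differentiableM; exact: differentiable_coord_row.
Qed.

Lemma continuous_nsq : continuous (nsq : 'rV[R]_n -> R).
Proof. by move=> x; apply: differentiable_continuous; exact: differentiable_nsq. Qed.

Lemma is_derive_nsq (i : 'I_n) x :
  is_derive x (basis_vec i) (nsq : 'rV[R]_n -> R) (2 * x 0 i).
Proof.
rewrite nsq_sumE.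
have H (j : 'I_n) := is_deriveM (is_derive_coord i j x) (is_derive_coord i j x).
apply: (is_derive_eq (is_derive_sum H)).
rewrite (bigD1 i)//= eqxx big1 ?addr0.
  by rewrite /GRing.scale/= !mulr1 mulr_natl.
by move=> j ji; rewrite eq_sym (negbTE ji) !scaler0 addr0.
Qed.

Lemma differentiable_comp_nsq psi x : smooth1 psi ->
  differentiable (fun x => psi (nsq x)) x.
Proof.
move=> spsi; apply: differentiable_comp; first exact: differentiable_nsq.
exact/derivable1_diffP/smooth1_derivable.
Qed.

Lemma is_derive_comp_nsq psi (i : 'I_n) x : smooth1 psi ->
  is_derive x (basis_vec i) (fun x => psi (nsq x)) (derive1 psi (nsq x) * (2 * x 0 i)).
Proof.
move=> spsi; apply: DeriveDef; first exact/diff_derivable/differentiable_comp_nsq.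
have D := smooth1_derivable spsi (t := nsq x).
rewrite deriveE; last exact: differentiable_comp_nsq.
rewrite (@diff_comp _ _ _ _ nsq psi); [|exact: differentiable_nsq|exact/derivable1_diffP].
rewrite deriv1E//= -deriveE; last exact: differentiable_nsq.
by have := is_derive_nsq i x => H; rewrite derive_val /GRing.scale/= mulrC.
Qed.

(** The algebra generated by the coordinates and by all [psi^(k)(|x|^2)]. It is stable under partial
    derivatives, hence its members are smooth in the sense of iterated partial derivatives. *)
Inductive radial_poly psi : ('rV[R]_n -> R) -> Prop :=
| radial_poly_comp k : radial_poly psi (fun x => derive1n k psi (nsq x))
| radial_poly_coord i : radial_poly psi (fun x => x 0 i)
| radial_poly_cst c : radial_poly psi (cst c)
| radial_polyD f g : radial_poly psi f -> radial_poly psi g -> radial_poly psi (f + g)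
| radial_polyM f g : radial_poly psi f -> radial_poly psi g -> radial_poly psi (f * g).

Lemma radial_poly_derive psi f : smooth1 psi -> radial_poly psi f ->
  (forall x, differentiable f x) /\
  (forall i, radial_poly psi ('D_(basis_vec i) f)).
Proof.
move=> spsi; elim=> [k|j|c|{}f g _ [df pf] _ [dg pg]|{}f g rf [df pf] rg [dg pg]].
- have sk : smooth1 (derive1n k psi) by exact: smooth1_derive1n.
  split=> [x|i]; first exact: differentiable_comp_nsq.
  rewrite (_ : 'D_ _ _ = (fun x => derive1n k.+1 psi (nsq x)) * (cst 2 * (fun x : 'rV[R]_n => x 0 i))).
    apply: radial_polyM; first exact: radial_poly_comp.
    by apply: radial_polyM; [exact: radial_poly_cst|exact: radial_poly_coord].
  apply/funext => x; have H := is_derive_comp_nsq i x sk.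
  by rewrite derive_val derive1nS.
- split=> [x|i]; first exact: differentiable_coord_row.
  rewrite (_ : 'D_ _ _ = cst ((i == j)%:R : R)); first exact: radial_poly_cst.
  by apply/funext => x; have H := is_derive_coord i j x; rewrite derive_val.
- split=> [x|i]; first exact: differentiable_cst.
  rewrite (_ : 'D_ _ _ = cst (0 : R)); first exact: radial_poly_cst.
  by apply/funext => x; rewrite derive_cst.
- split=> [x|i]; first exact: differentiableD.
  rewrite (_ : 'D_ _ _ = 'D_(basis_vec i) f + 'D_(basis_vec i) g).
    by apply: radial_polyD; [exact: pf|exact: pg].
  by apply/funext => x; rewrite deriveD//; exact: diff_derivable.
- split=> [x|i]; first exact: differentiableM.
  rewrite (_ : 'D_ _ _ = f * 'D_(basis_vec i) g + g * 'D_(basis_vec i) f).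
    by apply: radial_polyD; apply: radial_polyM.
  by apply/funext => x; rewrite deriveM//; exact: diff_derivable.
Qed.

Lemma smooth_radial_poly psi f : smooth1 psi -> radial_poly psi f -> smooth f.
Proof.
move=> spsi rf s x; apply: (radial_poly_derive spsi _).1.
elim: s => [//|i s IH] /=; exact: (radial_poly_derive spsi IH).2.
Qed.

Lemma closed_nsq_le b : closed [set x : 'rV[R]_n | nsq x <= b].
Proof.
rewrite (_ : [set _ | _] = nsq @^-1` [set t | t <= b])//.
by apply: closed_comp => [x _|]; [exact: continuous_nsq|exact: closed_le].
Qed.

Lemma bounded_nsq_le b : bounded_set [set x : 'rV[R]_n | nsq x <= b].
Proof.
exists (Num.sqrt b); split; first exact: num_real.
move=> M bM x /= xb.
rewrite /Num.norm/= mx_normrE; apply: bigmax_le => [|[i j] _ /=].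
  exact: le_trans (sqrtr_ge0 _) (ltW bM).
rewrite ord1; apply: le_trans (coord_enorm _ _) _; apply: le_trans (ltW bM).
by rewrite ler_wsqrtr.
Qed.

Lemma compact_nsq_le b : compact [set x : 'rV[R]_n | nsq x <= b].
Proof.
by apply: bounded_closed_compact; [exact: bounded_nsq_le|exact: closed_nsq_le].
Qed.

Lemma test_function_supp psi f (b : R) : smooth1 psi -> radial_poly psi f ->
  b < 1 -> (forall x, b < nsq x -> f x = 0) -> test_function f.
Proof.
move=> spsi rf b1 f0.
have S : closure [set x | f x != 0] `<=` [set x : 'rV[R]_n | nsq x <= b].
  rewrite [X in _ `<=` X](closure_id _).1; last exact: closed_nsq_le.
  by apply: closureS => x /=; apply: contraNle => /f0 ->.
split; first exact: smooth_radial_poly rf.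
- by apply: (subclosed_compact _ (@compact_nsq_le b)) => //; exact: closed_closure.
- by move=> x /S /= xb; rewrite hballE/= (le_lt_trans xb).
Qed.

Lemma test_function_comp psi (b : R) : smooth1 psi -> b < 1 ->
  (forall t, b < t -> psi t = 0) -> test_function (fun x : 'rV[R]_n => psi (nsq x)).
Proof.
move=> spsi b1 psi0; apply: (test_function_supp spsi _ b1) => [|x /psi0//].
exact: (radial_poly_comp psi 0).
Qed.

Lemma test_function_coord_comp psi (b : R) i : smooth1 psi -> b < 1 ->
  (forall t, b < t -> psi t = 0) ->
  test_function (fun x : 'rV[R]_n => x 0 i * psi (nsq x)).
Proof.
move=> spsi b1 psi0; apply: (test_function_supp spsi _ b1) => [|x /psi0 ->]; last by rewrite mulr0.
by apply: radial_polyM; [exact: radial_poly_coord|exact: (radial_poly_comp psi 0)].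
Qed.

End test_functions.

(** * Radial integrals and the flux of the gradient *)

Section Rintegral_tools.
Context d (T : measurableType d) (R : realType) (mu : {measure set T -> \bar R}).
Implicit Types (A B D : set T) (f g : T -> R).

Lemma Rintegral_supp A B f : A `<=` B -> (forall x, B x -> ~ A x -> f x = 0) ->
  \int[mu]_(x in B) f x = \int[mu]_(x in A) f x.
Proof.
move=> AB f0; rewrite Rintegral_mkcond [RHS]Rintegral_mkcond; congr Rintegral.
apply/funext => x; rewrite !patchE.
have [xA|xA] := boolP (x \in A); first by rewrite mem_set//; apply: AB; exact: set_mem.
case: ifPn => // /set_mem Bx; apply: f0 => // Ax.
by rewrite mem_set in xA.
Qed.

Lemma integrable_supp A B f : measurable A -> measurable B -> A `<=` B ->
  (forall x, B x -> ~ A x -> f x = 0) ->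
  mu.-integrable A (EFin \o f) -> mu.-integrable B (EFin \o f).
Proof.
move=> mA mB AB f0 /(integrable_mkcond _ mA) iA; apply/(integrable_mkcond _ mB).
rewrite (_ : _ \_ B = (EFin \o f) \_ A)//.
apply/funext => x; rewrite !patchE.
have [xA|xA] := boolP (x \in A); first by rewrite mem_set//; apply: AB; exact: set_mem.
case: ifPn => // /set_mem Bx; rewrite /= f0// => Ax.
by rewrite mem_set in xA.
Qed.

Lemma ae_eq_Rintegral D f g : measurable D -> measurable_fun D f -> measurable_fun D g ->
  {ae mu, forall x, D x -> f x = g x} ->
  \int[mu]_(x in D) f x = \int[mu]_(x in D) g x.
Proof.
move=> mD mf mg fg; congr fine; apply: ae_eq_integral => //.
- exact/measurable_EFinP.
- exact/measurable_EFinP.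
- by apply: filterS fg => x fgx /fgx ->.
Qed.

Lemma integrable_mul_bounded D f g (C : R) : measurable D ->
  mu.-integrable D (EFin \o f) -> measurable_fun D g ->
  (forall x, D x -> `|g x| <= C) -> mu.-integrable D (EFin \o (fun x => f x * g x)).
Proof.
move=> mD fi mg gC.
have mf : measurable_fun D f by apply/measurable_EFinP; exact: measurable_int fi.
apply: (@le_integrable _ _ _ _ _ mD _ (fun x => (C%:E * (f x)%:E)%E)).
- by apply/measurable_EFinP; exact: measurable_funM.
- move=> x Dx /=; rewrite lee_fin !normrM mulrC ler_wpM2r//.
  exact: le_trans (gC _ Dx) (ler_norm _).
- exact: integrableZl.
Qed.

Lemma cvg_Rintegral_bounded D f (v_ : nat -> T -> R) (v : T -> R) (C : R) : measurable D ->
  mu.-integrable D (EFin \o f) ->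
  (forall k, measurable_fun D (v_ k)) ->
  (forall k x, D x -> `|v_ k x| <= C) ->
  (forall x, D x -> v_ ^~ x @ \oo --> v x) ->
  \int[mu]_(x in D) (f x * v_ k x) @[k --> \oo] --> \int[mu]_(x in D) (f x * v x).
Proof.
move=> mD fi mv vC vv.
have mf : measurable_fun D f by apply/measurable_EFinP; exact: measurable_int fi.
have mvv : measurable_fun D v by exact: measurable_fun_cvg mv vv.
have C0 x : D x -> 0 <= C by move=> Dx; apply: le_trans (vC 0%N x Dx).
have [] := @dominated_convergence _ _ _ mu D mD
  (fun k x => (f x * v_ k x)%:E) (fun x => (f x * v x)%:E) (fun x => (C * `|f x|)%:E).
- by move=> k; apply/measurable_EFinP; exact: measurable_funM.
- by apply/measurable_EFinP; exact: measurable_funM.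
- apply: aeW => x Dx; apply: cvg_EFin.
    by near=> k.
  by apply: cvgM; [exact: cvg_cst|exact: vv].
- rewrite (_ : (fun x => _) = (fun x => C%:E * (EFin \o (fun x => `|f x|)%R) x)%E)//.
  by apply: integrableZl => //; exact: integrable_norm.
- apply: aeW => x k Dx; rewrite /= lee_fin normrM mulrC.
  by rewrite ler_wpM2r// vC.
move=> /(integrable_fin_num mD) fi2 _ H; apply: fine_cvg.
by rewrite fineK.
Unshelve. all: by end_near. Qed.

Lemma Rintegral_sum (I : Type) (s : seq I) D (f : I -> T -> R) : measurable D ->
  (forall i, mu.-integrable D (EFin \o f i)) ->
  \int[mu]_(x in D) (\sum_(i <- s) f i x) = \sum_(i <- s) \int[mu]_(x in D) f i x.
Proof.
move=> mD fi; elim: s => [|i s IH].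
  rewrite big_nil; under eq_Rintegral do rewrite big_nil.
  by rewrite /Rintegral integral0.
rewrite big_cons -IH; under eq_Rintegral do rewrite big_cons.
rewrite RintegralD//.
rewrite (_ : _ \o _ = fun x => (\sum_(j <- s) (f j x)%:E)%E).
  by apply: (integrable_sum mD s (P := xpredT)) => i0 _; exact: fi.
by apply/funext => x; rewrite /= sumEFin.
Qed.

End Rintegral_tools.

Section nsq_transfer.
Context {R : realType} {n : nat}.
Notation leb := (@lebesgue_measure R).
Notation lebn := (@lebesgue_row R n).
Hypothesis n2 : (2 < n)%N.

Lemma negligible_preimage_nsq (P : R -> Prop) : {ae leb, forall t, P t} ->
  {ae lebn, forall x, P (nsq x)}.
Proof.
move=> [A [mA A0 PA]]; exists (nsq @^-1` A); split.
- exact: measurable_nsq_preimage.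
- rewrite [LHS](lebesgue_row_preimage_nsq n2 mA); apply: null_set_integral => //.
  by apply/measurable_EFinP; apply: measurable_funTS; exact: measurable_nsq_density.
- by move=> x /= Px; apply: PA.
Qed.

Lemma Rintegral_nsq (k : R -> R) (D : set (measurableTypeR R)) : measurable D ->
  measurable_fun D (k : measurableTypeR R -> measurableTypeR R) ->
  \int[lebn]_(x in nsq @^-1` D) k (nsq x) = \int[leb]_(t in D) (k t * nsq_density (n := n) t).
Proof.
move=> mD mk; rewrite /Rintegral integralE [in RHS]integralE; congr (fine (_ - _)%E).
- transitivity (\int[lebn]_(x in nsq @^-1` D) ((EFin \o k)^\+) (nsq x))%E.
    by apply: eq_integral => x _; rewrite !funeposE.
  rewrite ge0_integral_nsq//.
  + apply: eq_integral => t _; rewrite !funeposE/= -EFin_max -EFinM -EFin_max; congr (_%:E).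
    by rewrite maxr_pMl ?nsq_density_ge0// mul0r.
  + by apply: measurable_funepos; exact/measurable_EFinP.
- transitivity (\int[lebn]_(x in nsq @^-1` D) ((EFin \o k)^\-) (nsq x))%E.
    by apply: eq_integral => x _; rewrite !funenegE.
  rewrite ge0_integral_nsq//.
  + apply: eq_integral => t _; rewrite !funenegE/= -EFin_max -EFinM -EFin_max; congr (_%:E).
    by rewrite maxr_pMl ?nsq_density_ge0// mul0r mulNr.
  + by apply: measurable_funeneg; exact/measurable_EFinP.
Qed.

Lemma integrable_nsq (k : R -> R) (D : set (measurableTypeR R)) : measurable D ->
  measurable_fun D (k : measurableTypeR R -> measurableTypeR R) ->
  lebn.-integrable (nsq @^-1` D) (fun x => (k (nsq x))%:E) ->
  leb.-integrable D (fun t => (k t * nsq_density (n := n) t)%:E).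
Proof.
move=> mD mk /integrableP[_ koo]; apply/integrableP; split.
  apply/measurable_EFinP; apply: measurable_funM => //; apply: measurable_funTS.
  exact: measurable_nsq_density.
move: koo; rewrite (ge0_integral_nsq n2 (f := fun t => `|(k t)%:E|%E))//.
  rewrite [X in (X < _)%E -> _](_ : _ =
    \int[leb]_(t in D) `|(k t * nsq_density (n := n) t)%:E|)%E//.
  by apply: eq_integral => t _ /=; rewrite normrM (ger0_norm (nsq_density_ge0 n2 t)).
by apply: measurableT_comp => //; exact/measurable_EFinP.
Qed.

End nsq_transfer.

Section weak.
Context {R : realType} {n : nat}.
Notation leb := (@lebesgue_measure R).
Notation lebn := (@lebesgue_row R n).
Hypothesis n2 : (2 < n)%N.
Implicit Types (u : 'rV[R]_n -> R) (g : 'rV[R]_n -> 'rV[R]_n) (a b : R).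

Definition shell a b : set 'rV[R]_n := nsq @^-1` `[a, b]%classic.

Lemma measurable_shell a b : measurable (shell a b).
Proof. exact: measurable_nsq_preimage. Qed.

Lemma shell_hball a b : b < 1 -> shell a b `<=` hball.
Proof.
by move=> b1 x; rewrite /shell/= in_itv/= hballE/= => /andP[_ xb]; exact: le_lt_trans b1.
Qed.

Lemma integrable_nsq_le u b : locally_integrable_ball u -> b < 1 ->
  lebn.-integrable (nsq @^-1` `]-oo, b]%classic) (EFin \o u).
Proof.
move=> [mu ui] b1; apply/integrableP.
have sb : nsq @^-1` `]-oo, b]%classic `<=` (hball : set 'rV[R]_n).
  by move=> x; rewrite /= in_itv/= hballE/= => xb; exact: le_lt_trans b1.
split.
  apply/measurable_EFinP; apply: measurable_funS mu => //; exact: measurable_hball.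
apply: ui => //; rewrite (_ : _ @^-1` _ = [set x | nsq x <= b]).
  exact: compact_nsq_le.
by apply/seteqP; split => x /=; rewrite in_itv.
Qed.

Lemma integrable_shell u a b : locally_integrable_ball u -> b < 1 ->
  lebn.-integrable (shell a b) (EFin \o u).
Proof.
move=> ui b1; apply: (integrableS _ _ _ (integrable_nsq_le ui b1)).
- exact: measurable_nsq_preimage.
- exact: measurable_shell.
- by move=> x; rewrite /shell/= !in_itv/= => /andP[].
Qed.

Lemma measurable_hball_shell u a b : b < 1 ->
  measurable_fun (hball : set 'rV[R]_n) u -> measurable_fun (shell a b) u.
Proof.
move=> b1; apply: measurable_funS; first exact: measurable_hball.
exact: shell_hball.
Qed.

Lemma continuous_fun_nsq (v : R -> R) (D : set 'rV[R]_n) : continuous v ->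
  measurable_fun D (fun x => v (nsq x)).
Proof.
move=> cv; apply: measurable_funTS; apply: (measurableT_comp (f := v)).
  exact: continuous_measurable_fun.
exact: measurable_nsq.
Qed.

Lemma Rintegral_hball_profile u (F Phi v : R -> R) a b :
  measurable_fun (hball : set 'rV[R]_n) (u : _ -> measurableTypeR R) ->
  measurable_fun [set: measurableTypeR R] (F : _ -> measurableTypeR R) ->
  measurable_fun [set: measurableTypeR R] (Phi : _ -> measurableTypeR R) ->
  {ae lebn, forall x, hball x -> u x = F (nsq x)} ->
  measurable_fun [set: measurableTypeR R] (v : measurableTypeR R -> measurableTypeR R) ->
  (forall t, ~ (a <= t <= b) -> v t = 0) -> b < 1 ->
  \int[lebn]_(x in hball) (Phi (u x) * v (nsq x)) =
  \int[leb]_(t in `[a, b]) (Phi (F t) * v t * nsq_density (n := n) t).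
Proof.
move=> mu mF mPhi uF mv v0 b1.
rewrite (@Rintegral_supp _ _ _ _ (shell a b)); last 2 first.
- exact: shell_hball.
- by move=> x _; rewrite /shell/= in_itv/= => /v0 ->; rewrite mulr0.
have mvn : measurable_fun (shell a b) (fun x => v (nsq x)).
  apply: measurable_funTS; apply: (measurableT_comp (f := v)) => //.
  exact: measurable_nsq.
rewrite (@ae_eq_Rintegral _ _ _ _ (shell a b) _ (fun x => Phi (F (nsq x)) * v (nsq x))).
- rewrite (Rintegral_nsq n2 (k := fun t => Phi (F t) * v t))//.
  apply: measurable_funM; apply: measurable_funTS => //.
  exact: (measurableT_comp mPhi).
- exact: measurable_shell.
- apply: measurable_funM => //.
  apply: (measurableT_comp mPhi); exact: measurable_hball_shell.
- apply: measurable_funM => //.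
  apply: (measurableT_comp mPhi); apply: (measurableT_comp mF).
  by apply: measurable_funTS; exact: measurable_nsq.
- by apply: filterS uF => x ux /(shell_hball b1)/ux ->.
Qed.

(** If [u] is regular then [g x = 2 F'(|x|^2) x], and this is [2 F' |x|^(2-n)]. The power of [|x|]
    cancels the one in [nsq_density], so that the integral over a shell is [2 * nsq_weight] times an
    increment of [F]. *)
Definition radial_flux g (x : 'rV[R]_n) : R := dotr x (g x) * (Num.sqrt (nsq x))^-1 ^+ n.

Lemma integrable_dotr g b : (forall i, locally_integrable_ball (fun x => g x 0 i)) -> b < 1 ->
  lebn.-integrable (nsq @^-1` `]-oo, b]%classic) (fun x => (dotr x (g x))%:E).
Proof.
move=> gi b1.
rewrite (_ : (fun x => _) = fun x : 'rV[R]_n => (\sum_i ((x 0 i * g x 0 i)%R)%:E)%E); last first.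
  by apply/funext => x; rewrite sumEFin.
have mD : measurable (nsq @^-1` `]-oo, b]%classic : set 'rV[R]_n).
  exact: measurable_nsq_preimage.
apply: (integrable_sum mD _ (P := xpredT)) => i _.
rewrite (_ : (fun x => _) = EFin \o (fun x => g x 0 i * x 0 i)); last first.
  by apply/funext => x /=; rewrite mulrC.
apply: (@integrable_mul_bounded _ _ _ _ _ _ _ 1) => //.
- exact: integrable_nsq_le.
- apply: measurable_funTS; exact: measurable_coord.
- move=> x /=; rewrite in_itv/= => xb; apply: le_trans (coord_enorm _ _) _.
  rewrite -(@expr_le1 _ 2)// ?enorm_ge0// enorm_sqr.
  exact: le_trans xb (ltW b1).
Qed.

Lemma integrable_radial_flux g a b : (forall i, locally_integrable_ball (fun x => g x 0 i)) ->
  0 < a -> b < 1 -> lebn.-integrable (shell a b) (EFin \o radial_flux g).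
Proof.
move=> gi a0 b1.
apply: (@integrable_mul_bounded _ _ _ _ _ _ _ ((Num.sqrt a)^-1 ^+ n)).
- exact: measurable_shell.
- apply: (integrableS _ _ _ (integrable_dotr gi b1)).
  + exact: measurable_nsq_preimage.
  + exact: measurable_shell.
  + by move=> x; rewrite /shell/= !in_itv/= => /andP[].
- apply: measurable_funX; apply: measurable_funTS.
  rewrite (_ : (fun x => _) = fun x => (Num.sqrt (nsq x)) `^ (-1)); last first.
    by apply/funext => x; rewrite powR_inv1 ?sqrtr_ge0.
  apply: (measurableT_comp (f := fun t : R => t `^ (-1))); first exact: measurable_powR.
  by apply: continuous_fun_nsq; exact: sqrt_continuous.
- move=> x; rewrite /shell/= in_itv/= => /andP[ax xb].
  have x0 : 0 < nsq x by exact: lt_le_trans ax.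
  rewrite ger0_norm; last by rewrite exprn_ge0// invr_ge0 sqrtr_ge0.
  rewrite ler_pXn2r ?nnegrE ?invr_ge0 ?sqrtr_ge0//; last by apply: leq_trans n2.
  by rewrite lef_pV2 ?posrE ?sqrtr_gt0// ler_wsqrtr.
Qed.

Lemma bounded_continuous_segment (v : R -> R) a b : a <= b -> continuous v ->
  exists C : R, forall t, a <= t <= b -> `|v t| <= C.
Proof.
move=> ab cv.
have [c _ H] : exists2 c : R, c \in `[a, b]%R & forall t, t \in `[a, b]%R -> `|v t| <= `|v c|.
  apply: (@EVT_max _ (fun t => `|v t|)) => //.
  apply: continuous_subspaceT => t; apply: continuous_comp; first exact: cv.
  exact: norm_continuous.
by exists `|v c| => t tab; apply: H; rewrite in_itv.
Qed.

(** Sum over [i] of the identities for [x_i chi(|x|^2)]: the factor of [u] is the divergence of the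
    field [x chi(|x|^2)]. The support in [|x|^2 <= b] with [b < 1] makes every summand integrable,
    so that sum and integral commute. *)
Lemma weak_gradient_radial u g (chi : R -> R) b : weak_gradient u g -> smooth1 chi ->
  b < 1 -> (forall t, b < t -> chi t = 0) ->
  \int[lebn]_(x in hball) (u x * (n%:R * chi (nsq x) + 2 * nsq x * derive1 chi (nsq x))) =
  - \int[lebn]_(x in hball) (dotr x (g x) * chi (nsq x)).
Proof.
move=> [ui gi wg] schi b1 chi0.
have dchi0 t : b < t -> derive1 chi t = 0.
  move=> bt; rewrite derive1E.
  have : is_derive t 1 chi 0.
    apply: (near_eq_is_derive _ (is_derive_cst (0 : R) t 1)).
    by near=> s; rewrite chi0//; near: s; exact: lt_nbhsr.
  by move=> ?; rewrite derive_val.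
have cchi := smooth1_continuous schi.
have cdchi := smooth1_continuous (smooth1_derive1 schi).
have [C1 HC1] := bounded_continuous_segment (@ler01 R) cchi.
have [C2 HC2] := bounded_continuous_segment (@ler01 R) cdchi.
have mball := @measurable_hball R n.
have mDb : measurable (nsq @^-1` `]-oo, b]%classic : set 'rV[R]_n) by exact: measurable_nsq_preimage.
have sb : nsq @^-1` `]-oo, b]%classic `<=` (hball : set 'rV[R]_n).
  by move=> x; rewrite /= in_itv/= hballE/= => xb; exact: le_lt_trans b1.
have coord1 (x : 'rV[R]_n) i : nsq x <= b -> `|x 0 i| <= 1.
  move=> xb; apply: le_trans (coord_enorm _ _) _.
  rewrite -(@expr_le1 _ 2)// ?enorm_ge0// enorm_sqr; exact: le_trans xb (ltW b1).
have nb01 (x : 'rV[R]_n) : nsq x <= b -> 0 <= nsq x <= 1.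
  by move=> xb; rewrite nsq_ge0 (le_trans xb (ltW b1)).
pose phi i (x : 'rV[R]_n) := x 0 i * chi (nsq x).
have dphi i x : 'D_(basis_vec i) (phi i) x =
    chi (nsq x) + 2 * (x 0 i * x 0 i) * derive1 chi (nsq x).
  have H1 := is_derive_coord i i x; have H2 := is_derive_comp_nsq i x schi.
  have H := is_deriveM H1 H2.
  rewrite (_ : phi i = (fun x : 'rV[R]_n => x 0 i) * (fun x => chi (nsq x)))//.
  rewrite derive_val eqxx /GRing.scale/=; ring.
have E i := wg _ (test_function_coord_comp i schi b1 chi0) i.
have Iu i : lebn.-integrable hball (EFin \o (fun x => u x * 'D_(basis_vec i) (phi i) x)).
  apply: (@integrable_supp _ _ _ _ (nsq @^-1` `]-oo, b]%classic)) => //.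
    move=> x _; rewrite /= in_itv/= => /negP; rewrite -ltNge => bx.
    by rewrite dphi chi0// dchi0// mulr0 addr0 mulr0.
  apply: (@integrable_mul_bounded _ _ _ _ _ _ _ (C1 + 2 * C2)) => //.
  - exact: integrable_nsq_le.
  - rewrite (_ : 'D_ _ _ = fun x => chi (nsq x) + 2 * (x 0 i * x 0 i) * derive1 chi (nsq x)).
      apply: measurable_funD; first exact: continuous_fun_nsq.
      apply: measurable_funM; last exact: continuous_fun_nsq.
      apply: measurable_funM; first exact: measurable_cst.
      by apply: measurable_funM; apply: measurable_funTS; exact: measurable_coord.
    by apply/funext => x; rewrite dphi.
  - move=> x; rewrite /= in_itv/= => xb; rewrite dphi.
    apply: le_trans (ler_normD _ _) _; apply: lerD; first exact/HC1/nb01.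
    rewrite !normrM (@ger0_norm _ 2)// -mulrA ler_wpM2l//.
    rewrite -[X in _ <= X]mul1r; apply: ler_pM => //; last exact/HC2/nb01.
    by rewrite -[X in _ <= X]mul1r; apply: ler_pM => //; exact: coord1.
have Ig i : lebn.-integrable hball (EFin \o (fun x => g x 0 i * phi i x)).
  apply: (@integrable_supp _ _ _ _ (nsq @^-1` `]-oo, b]%classic)) => //.
    move=> x _; rewrite /= in_itv/= => /negP; rewrite -ltNge => bx.
    by rewrite /phi chi0// !mulr0.
  apply: (@integrable_mul_bounded _ _ _ _ _ _ _ C1) => //.
  - exact: integrable_nsq_le.
  - apply: measurable_funM; last exact: continuous_fun_nsq.
    by apply: measurable_funTS; exact: measurable_coord.
  - move=> x; rewrite /= in_itv/= => xb; rewrite normrM -[X in _ <= X]mul1r.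
    by apply: ler_pM => //; [exact: coord1|exact/HC1/nb01].
transitivity (\sum_i \int[lebn]_(x in hball) (u x * 'D_(basis_vec i) (phi i) x)).
  rewrite -Rintegral_sum//; apply: eq_Rintegral => x _.
  rewrite -mulr_sumr; congr (_ * _).
  under eq_bigr do rewrite dphi.
  rewrite big_split/= sumr_const card_ord mulr_natl; congr (_ + _).
  by rewrite -mulr_suml -mulr_sumr.
under eq_bigr do rewrite E.
rewrite sumrN -Rintegral_sum//; congr (- _); apply: eq_Rintegral => x _.
rewrite /dotr mulr_suml; apply: eq_bigr => i _.
by rewrite /phi mulrA [g x 0 i * _]mulrC.
Unshelve. all: by end_near. Qed.

End weak.

(** * Smooth steps and Lebesgue points *)

Section steps.
Context {R : realType}.
Notation leb := (@lebesgue_measure R).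
Implicit Types (a b p q t : R) (k : nat).

Lemma derive1_supp (f : R -> R) a b : (forall t, ~ (a <= t <= b) -> f t = 0) ->
  forall t, ~ (a <= t <= b) -> derive1 f t = 0.
Proof.
move=> f0 t /negP; rewrite negb_and -!ltNge => tab; rewrite derive1E.
have : is_derive t 1 f 0.
  apply: (near_eq_is_derive _ (is_derive_cst (0 : R) t 1)).
  case/orP: tab => tab; near=> s; rewrite f0//; apply/negP; rewrite negb_and -!ltNge; apply/orP.
    by left; near: s; exact: lt_nbhsl.
  by right; near: s; exact: lt_nbhsr.
by move=> ?; rewrite derive_val.
Unshelve. all: by end_near. Qed.

(** A smooth step rising on [[p, p + 1/(k+1)]]. The difference of two steps tends to the indicator
    of []p, q]], and its derivative to a difference of two point evaluations. *)
Definition stepk k p t : R := step (k.+1%:R * (t - p)).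

Lemma smooth1_stepk k p : smooth1 (stepk k p).
Proof. by move=> n; apply: Cn_affine; exact: smooth1_step. Qed.

Lemma stepk_le k p t : t <= p -> stepk k p t = 0.
Proof. by move=> tp; rewrite /stepk step_le0// mulr_ge0_le0// subr_le0. Qed.

Lemma stepk_ge k p t : p + k.+1%:R^-1 <= t -> stepk k p t = 1.
Proof.
by move=> pt; rewrite /stepk step_ge1// -ler_pdivrMl// mulr1 lerBrDl.
Qed.

Lemma cvg_stepk p t : stepk k p t @[k --> \oo] --> ((p < t)%R%:R : R).
Proof.
have [pt|tp] := ltP p t; last first.
  by apply: cvg_near_cst; near=> k; rewrite stepk_le.
have tp0 : 0 < t - p by rewrite subr_gt0.
apply: cvg_near_cst; near=> k; rewrite stepk_ge// -lerBrDl ltW//.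
by near: k; exact: near_infty_natSinv_lt (PosNum tp0).
Unshelve. all: by end_near. Qed.

Lemma cvg_Rintegral_stepk d (T : measurableType d) (mu : {measure set T -> \bar R}) (B : set T)
    (f h : T -> R) p q : measurable B -> mu.-integrable B (EFin \o f) ->
  measurable_fun B (h : T -> measurableTypeR R) -> p <= q -> h @^-1` `]p, q]%classic `<=` B ->
  \int[mu]_(x in B) (f x * (stepk k p (h x) - stepk k q (h x))) @[k --> \oo] -->
  \int[mu]_(x in h @^-1` `]p, q]) f x.
Proof.
move=> mB fi mh pq hB.
have -> : \int[mu]_(x in h @^-1` `]p, q]) f x =
   \int[mu]_(x in B) (f x * ((p < h x)%R%:R - (q < h x)%R%:R)).
  rewrite [RHS](@Rintegral_supp _ _ _ mu (h @^-1` `]p, q]%classic))//.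
  - apply: eq_Rintegral => x; rewrite inE/= in_itv/= => /andP[-> xq].
    by rewrite ltNge xq subr0 mulr1.
  - move=> x _; rewrite /= in_itv/= => /negP; rewrite negb_and -leNgt -ltNge.
    case/orP => [xp|qx]; first by rewrite !ltNge xp (le_trans xp pq) subrr mulr0.
    by rewrite qx (le_lt_trans pq qx) subrr mulr0.
have mS k r : measurable_fun B (fun x => stepk k r (h x) : measurableTypeR R).
  apply: (measurableT_comp (f := stepk k r)) => //.
  exact: continuous_measurable_fun (smooth1_continuous (@smooth1_stepk k r)).
apply: (@cvg_Rintegral_bounded _ _ _ _ _ _ _ _ 2) => //.
- by move=> k; apply: measurable_funB; exact: mS.
- move=> k x _; apply: le_trans (ler_normB _ _) _.
  by rewrite !ger0_norm ?step_ge0// [leRHS](_ : 2 = 1 + 1)// lerD ?step_le1.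
- by move=> x _; apply: cvgB; exact: cvg_stepk.
Qed.

Lemma is_derive_stepk k p t : is_derive t 1 (stepk k p) (derive1 (stepk k p) t).
Proof. exact: smooth1_is_derive (smooth1_stepk k p). Qed.

Lemma derive1_stepk k p t :
  derive1 (stepk k p) t = k.+1%:R * derive1 step (k.+1%:R * (t - p)).
Proof.
have H := smooth1_is_derive (k.+1%:R * (t - p)) (@smooth1_step R).
have E := is_derive1_mul (is_derive_cst (k.+1%:R : R) t 1)
      (is_derive1_add (is_derive_id t 1) (is_derive_cst (- p) t 1)).
have := @is_derive1_comp _ step (fun t => k.+1%:R * (t - p)) t _ _ H E.
rewrite mul0r add0r addr0 mulr1 => D.
by rewrite derive1E (_ : stepk k p = step \o (fun t => k.+1%:R * (t - p)))// derive_val mulrC.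
Qed.

(** The kernel has integral [1], is supported in [[p, p + 1/(k+1)]] and bounded by [C (k+1)]. The
    error is therefore at most a constant times the mean of [|f - f p|] over a comparable ball,
    which tends to [0] at a Lebesgue point. *)
Lemma cvg_integral_derive1_stepk (f : R -> R) a b p :
  leb.-integrable `[a, b] (EFin \o f) -> a < p < b ->
  lebesgue_pt (f \_ `[a, b]) p ->
  \int[leb]_(t in `[a, b]) (f t * derive1 (stepk k p) t) @[k --> \oo] --> f p.
Proof.
move=> fi /andP[ap pb] fp.
have mf : measurable_fun (`[a, b]%classic : set (measurableTypeR R)) f.
  by apply/measurable_EFinP; exact: measurable_int fi.
have [C HC] := @derive1_step_bounded R.
have C0 : 0 <= C by exact: le_trans (HC 0).
apply/cvgrPdist_le => e e0.
(* The kernel is at most [(k+1) C] and the ball of radius [2/(k+1)] has length [4/(k+1)], so the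
   mean gets multiplied by [4 C]; the added [1] keeps the denominator positive. *)
have e1 : 0 < e / (4 * C + 1) by rewrite divr_gt0// ltr_wpDl// mulr_ge0.
have [r r0 Hr] : exists2 r : R, 0 < r & forall s, 0 < s -> s < r ->
    (\int[leb]_(y in ball p s) `|(f \_ `[a, b]) y - (f \_ `[a, b]) p|%:E <= (2 * s * (e / (4 * C + 1)))%:E)%E.
  have /fine_cvgP[[r1 /= r10 fin1]] := fp.
  move=> /cvgrPdist_le /(_ _ e1) [r2 /= r20 H2].
  exists (Num.min r1 r2); first by rewrite lt_min r10.
  move=> s s0; rewrite lt_min => /andP[s1 s2].
  have bs : ball 0 r1 s by rewrite /ball/= sub0r normrN gtr0_norm.
  have bs2 : ball 0 r2 s by rewrite /ball/= sub0r normrN gtr0_norm.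
  have := fin1 s bs s0; have := H2 s bs2 s0.
  rewrite /= sub0r normrN => D1 D2.
  have : (davg (f \_ `[a, b]) p s <= (e / (4 * C + 1))%:E)%E.
    by rewrite -(fineK D2) lee_fin; apply: le_trans D1; exact: ler_norm.
  rewrite /davg /iavg lebesgue_measure_ball ?(ltW s0)//.
  rewrite inver mulrn_eq0/= gt_eqF//.
  by rewrite lee_pdivrMl ?mulrn_wgt0// -EFinM -(mulr_natl s 2).
have phiS k : \int[leb]_(t in `[a, b]) derive1 (stepk k p) t = stepk k p b - stepk k p a.
  have dF x : a < x < b -> is_derive x 1 (stepk k p) (derive1 (stepk k p) x).
    by move=> _; exact: is_derive_stepk.
  rewrite /Rintegral (FTC2_segment (ltW (lt_trans ap pb)) dF)// => x _.
    exact: smooth1_continuous (smooth1_stepk k p) x.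
  exact: smooth1_continuous (smooth1_derive1 (smooth1_stepk k p)) x.
have pb0 : 0 < b - p by rewrite subr_gt0.
have pa0 : 0 < p - a by rewrite subr_gt0.
near=> k.
(* Twice the width of the step, so that the closed support of the kernel lies in the open ball. *)
set s : R := 2 * k.+1%:R^-1.
have s0 : 0 < s by rewrite mulr_gt0// invr_gt0.
have ks : k.+1%:R^-1 < s by rewrite /s ltr_pMl ?ltr1n// invr_gt0.
have small (d : R) : 0 < d -> k.+1%:R^-1 < d / 2 -> s < d.
  by move=> d0; rewrite ltr_pdivlMr// mulrC.
have sr : s < r.
  by apply: small => //; near: k; exact: near_infty_natSinv_lt (PosNum (divr_gt0 r0 (ltr0n _ 2))).
have sb : s < b - p.
  by apply: small => //; near: k; exact: near_infty_natSinv_lt (PosNum (divr_gt0 pb0 (ltr0n _ 2))).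
have sa : s < p - a.
  by apply: small => //; near: k; exact: near_infty_natSinv_lt (PosNum (divr_gt0 pa0 (ltr0n _ 2))).
have bab : ball p s `<=` `[a, b]%classic.
  move=> t; rewrite /ball/= ltr_distlC in_itv/= => /andP[t1 t2]; apply/andP; split; lra.
have I1 : \int[leb]_(t in `[a, b]) derive1 (stepk k p) t = 1.
  rewrite phiS stepk_ge; last by rewrite -lerBrDl ltW// (lt_trans ks sb).
  by rewrite stepk_le ?subr0// ltW.
set phi := derive1 (stepk k p).
have cphi : continuous phi := smooth1_continuous (smooth1_derive1 (smooth1_stepk k p)).
have mphi D : measurable_fun (D : set (measurableTypeR R)) phi.
  by apply: measurable_funTS; exact: continuous_measurable_fun.
have phib t : `|phi t| <= k.+1%:R * C.
  by rewrite /phi derive1_stepk normrM ger0_norm// ler_wpM2l.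
have iab : leb.-integrable `[a, b] (EFin \o (cst 1 : R -> R)).
  apply: continuous_compact_integrable; first exact: segment_compact.
  by apply: continuous_subspaceT => t; exact: cvg_cst.
have iphi : leb.-integrable `[a, b] (EFin \o phi).
  apply: continuous_compact_integrable; first exact: segment_compact.
  exact: continuous_subspaceT.
have ifphi : leb.-integrable `[a, b] (EFin \o (fun t => f t * phi t)).
  exact: (@integrable_mul_bounded _ _ _ _ _ _ _ (k.+1%:R * C)).
have phi0 t : ~ ball p s t -> phi t = 0.
  move=> nb; rewrite /phi derive1_stepk derive1_step_out ?mulr0//.
  move=> /andP[t0 t1]; apply: nb; rewrite /ball/= ltr_distlC.
  move: t0 t1; rewrite pmulr_rge0// subr_ge0 => pt.
  rewrite -ler_pdivlMl// mulr1 lerBlDl => tp; apply/andP; split; first lra.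
  by apply: le_lt_trans tp _; rewrite ltrD2l.
have mU : measurable (ball p s) by exact: measurable_ball.
have -> : f p - \int[leb]_(t in `[a, b]) (f t * phi t) =
    - \int[leb]_(t in ball p s) ((f t - f p) * phi t).
  rewrite -(@Rintegral_supp _ _ _ leb (ball p s) `[a, b]%classic)//; last first.
    by move=> t _ nb; rewrite phi0// mulr0.
  under [X in _ = - X]eq_Rintegral do rewrite mulrBl.
  rewrite RintegralB//; last first.
    rewrite (_ : _ \o _ = fun x => ((f p)%:E * (EFin \o phi) x)%E)//.
    exact: integrableZl.
  by rewrite RintegralZl// I1 mulr1 opprB.
have frE t : ball p s t -> (f \_ `[a, b]) t = f t by move=> /bab t_; rewrite patchE mem_set.
have mh : measurable_fun (ball p s : set (measurableTypeR R)) (fun t => f t - f p).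
  apply: measurable_funB; last exact: measurable_cst.
  exact: measurable_funS mf.
rewrite normrN -lee_fin.
have ih : leb.-integrable (ball p s) (EFin \o (fun t => (f t - f p) * phi t)).
  have : leb.-integrable `[a, b] (EFin \o (fun t => (f t - f p) * phi t)).
    apply: (@integrable_mul_bounded _ _ _ _ _ _ _ (k.+1%:R * C)) => //.
    rewrite (_ : _ \o _ = (EFin \o f) \- (fun t => ((f p)%:E * (EFin \o (cst 1%R : R -> R)) t)))%E; last first.
      by apply/funext => t /=; rewrite mulr1.
    by apply: integrableB => //; exact: integrableZl.
  exact: integrableS.
rewrite EFin_normr_Rintegral//.
apply: le_trans (le_abse_integral _ _ _) _ => //; first by case/integrableP: ih.
apply: (@le_trans _ _ (\int[leb]_(t in ball p s)
    ((k.+1%:R * C)%:E * `|(f \_ `[a, b]) t - (f \_ `[a, b]) p|%:E))%E).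
  apply: ge0_le_integral => //.
  - by apply: measurableT_comp => //; case/integrableP: ih.
  - apply: measurable_funeM; apply/measurable_EFinP; apply: measurableT_comp => //.
    apply: (eq_measurable_fun (fun t => f t - f p)) => // t /set_mem tU.
    by rewrite frE// frE//; exact: ballxx.
  - move=> t tU; rewrite -EFinM !lee_fin frE// frE; last exact: ballxx.
    by rewrite normrM mulrC ler_wpM2r.
rewrite ge0_integralZl//; last 2 first.
- apply/measurable_EFinP; apply: measurableT_comp => //.
  apply: (eq_measurable_fun (fun t => f t - f p)) => // t /set_mem tU.
  by rewrite frE// frE//; exact: ballxx.
- by rewrite lee_fin mulr_ge0.
apply: (@le_trans _ _ ((k.+1%:R * C)%:E * (2 * s * (e / (4 * C + 1)))%:E)%E).
  by apply: lee_wpmul2l; [rewrite lee_fin mulr_ge0|exact: Hr].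
rewrite -EFinM lee_fin /s.
rewrite (_ : k.+1%:R * C * (2 * (2 * k.+1%:R^-1) * (e / (4 * C + 1))) = (4 * C) * e / (4 * C + 1)); last first.
  have E (K D : R) : K != 0 -> D != 0 -> K * C * (2 * (2 / K) * (e / D)) = 4 * C * e / D.
    by move=> K0 D0; field; rewrite K0 D0.
  by apply: E; [rewrite pnatr_eq0|rewrite gt_eqF// ltr_wpDl// mulr_ge0].
rewrite ler_pdivrMr; last by lra.
rewrite mulrC ler_wpM2l ?(ltW e0)//; lra.
Unshelve. all: by end_near. Qed.

End steps.

(** * The continuous profile *)

Lemma ge0_subset_Rintegral d (T : measurableType d) (R : realType)
    (mu : {measure set T -> \bar R}) (A B : set T) (f : T -> R) :
  measurable A -> measurable B -> mu.-integrable B (EFin \o f) -> A `<=` B ->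
  (forall x, B x -> 0 <= f x) ->
  \int[mu]_(x in A) f x <= \int[mu]_(x in B) f x.
Proof.
move=> mA mB iB AB f0; have iA := integrableS mB mA AB iB.
rewrite -lee_fin /Rintegral (fineK (integrable_fin_num mA iA)) (fineK (integrable_fin_num mB iB)).
by apply: ge0_subset_integral => //; exact: measurable_int iB.
Qed.

Lemma integrable_continuous (R : realType) (f : R -> R) (a b : R) : continuous f ->
  (@lebesgue_measure R).-integrable `[a, b] (EFin \o f).
Proof.
move=> cf; apply: continuous_compact_integrable; first exact: segment_compact.
exact: continuous_subspaceT.
Qed.

Lemma integrable_continuous_oc (R : realType) (f : R -> R) (a b : R) : continuous f ->
  (@lebesgue_measure R).-integrable `]a, b] (EFin \o f).
Proof.
move=> /(@integrable_continuous _ _ a b); apply: integrableS => //.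
by move=> t; rewrite /= !in_itv/= => /andP[/ltW -> ->].
Qed.

Section flux.
Context {R : realType} {n : nat}.
Notation leb := (@lebesgue_measure R).
Notation lebn := (@lebesgue_row R n).
Hypothesis n2 : (2 < n)%N.
Variables (u : 'rV[R]_n -> R) (g : 'rV[R]_n -> 'rV[R]_n) (F : R -> R).
Hypothesis wg : weak_gradient u g.
Hypothesis mF : measurable_fun [set: measurableTypeR R] (F : _ -> measurableTypeR R).
Hypothesis uF : {ae lebn, forall x, hball x -> u x = F (nsq x)}.
Implicit Types (a b p q : R).

Local Notation C := (nsq_weight (R := R) (n := n)).
Local Notation flux := (radial_flux g).

Let gi : forall i, locally_integrable_ball (fun x => g x 0 i).
Proof. by case: wg. Qed.

Lemma smooth1_sqrtV_mul (eta : R -> R) a k : smooth1 eta -> 0 < a ->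
  (forall t, t < a -> eta t = 0) -> smooth1 (fun t => (Num.sqrt t)^-1 ^+ k * eta t).
Proof.
move=> seta a0 eta0 m; apply: (Cn_extend0 a0) => [t /eta0 ->|]; first by rewrite mulr0.
apply: CnM; last exact: CnS (seta m).
apply: CnX; apply: CnV; last exact: Cn_sqrt.
by move=> t /= t0; rewrite gt_eqF// sqrtr_gt0.
Qed.

(** Integrability of [u] on the shell gives that of [F] times the density, and for [a > 0] the
    density is bounded below on [[a, b]] and can be divided out. *)
Lemma integrable_profile a b : 0 < a -> b < 1 -> leb.-integrable `[a, b] (EFin \o F).
Proof.
move=> a0 b1.
have [ui _ _] := wg.
have mS := @measurable_shell R n a b.
have mFn : measurable_fun (shell a b) (fun x : 'rV[R]_n => F (nsq x)).
  by apply: (measurableT_comp mF); apply: measurable_funTS; exact: measurable_nsq.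
have I1 : lebn.-integrable (shell a b) (fun x => (F (nsq x))%:E).
  apply/integrableP; split; first exact/measurable_EFinP.
  have /integrableP[mu uoo] := integrable_shell a ui b1.
  rewrite (_ : (\int[lebn]_(x in shell a b) _)%E = (\int[lebn]_(x in shell a b) `|(u x)%:E|)%E)//.
  apply: ae_eq_integral => //.
  - by apply: measurableT_comp => //; exact/measurable_EFinP.
  - exact: measurableT_comp.
  - by apply: filterS uF => x ux /(shell_hball b1)/ux ->.
have I2 := integrable_nsq n2 (k := F) (D := `[a, b]%classic) (measurable_itv _)
  (measurable_funTS mF) I1.
have cw := @continuous_nsq_density R n.
have w0 t : t \in `[a, b] -> nsq_density (n := n) a <= nsq_density (n := n) t.
  rewrite in_itv/= => /andP[at_ _]; rewrite /nsq_density ler_pM2l ?nsq_weight_gt0//.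
  by rewrite lerXn2r ?nnegrE ?sqrtr_ge0// ler_wsqrtr.
have wa : 0 < nsq_density (n := n) a.
  by rewrite mulr_gt0 ?nsq_weight_gt0// exprn_gt0// sqrtr_gt0.
have I3 : leb.-integrable `[a, b] (EFin \o
   (fun t => F t * nsq_density (n := n) t * (nsq_density (n := n) t) `^ (-1))).
  apply: (@integrable_mul_bounded _ _ _ _ _ _ _ (nsq_density (n := n) a)^-1) => //.
    apply: measurable_funTS.
    apply: (measurableT_comp (f := fun t : R => t `^ (-1))); first exact: measurable_powR.
    exact: measurable_nsq_density.
  move=> t /w0 wt; rewrite powR_inv1 ?nsq_density_ge0// ger0_norm ?invr_ge0 ?nsq_density_ge0//.
  by rewrite lef_pV2 ?posrE// (lt_le_trans wa wt).
apply: eq_integrable I3 => // t /set_mem tab.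
by rewrite /= powR_inv1 ?nsq_density_ge0// mulfK// gt_eqF// (lt_le_trans wa (w0 _ tab)).
Qed.

(* The weak gradient tested with [x_i chi(|x|^2)] for [chi t = t^(-n/2) eta t]: the divergence of
   [x chi(|x|^2)] is then [2 t^(1-n/2) eta' t]. *)
Lemma flux_test (eta : R -> R) a b : smooth1 eta -> 0 < a -> b < 1 ->
  (forall t, ~ (a <= t <= b) -> eta t = 0) ->
  2 * C * \int[leb]_(t in `[a, b]) (F t * derive1 eta t) =
  - \int[lebn]_(x in shell a b) (flux x * eta (nsq x)).
Proof.
move=> seta a0 b1 eta0.
have etaa t : t < a -> eta t = 0 by move=> ta; apply: eta0 => /andP[]; rewrite leNgt ta.
have etab t : b < t -> eta t = 0 by move=> ta; apply: eta0 => /andP[_]; rewrite leNgt ta.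
pose chi t := (Num.sqrt t)^-1 ^+ n * eta t.
have schi : smooth1 chi by exact: smooth1_sqrtV_mul etaa.
have chi0 t : ~ (a <= t <= b) -> chi t = 0 by move=> /eta0 e0; rewrite /chi e0 mulr0.
have chib t : b < t -> chi t = 0 by move=> /etab e0; rewrite /chi e0 mulr0.
have cchi := smooth1_continuous schi.
have cdchi := smooth1_continuous (smooth1_derive1 schi).
have dchi0 := derive1_supp chi0.
have := weak_gradient_radial wg schi b1 chib.
have [[mu _] _ _] := wg.
pose v t := n%:R * chi t + 2 * t * derive1 chi t.
have cv : continuous v.
  move=> t; apply: cvgD; apply: cvgM => //; [exact: cvg_cst|exact: cchi| |exact: cdchi].
  by apply: cvgM; [exact: cvg_cst|exact: cvg_id].
have -> : \int[lebn]_(x in hball) (u x * (n%:R * chi (nsq x) + 2 * nsq x * derive1 chi (nsq x))) =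
    2 * C * \int[leb]_(t in `[a, b]) (F t * derive1 eta t).
  rewrite (@Rintegral_hball_profile _ _ n2 u F id v a b)//; last 2 first.
  - by apply: continuous_measurable_fun.
  - by move=> t tab; rewrite /v chi0// dchi0// !mulr0 addr0.
  rewrite -RintegralZl//; last first.
    have cde := smooth1_continuous (smooth1_derive1 seta).
    have [ab|ab] := leP a b; last by rewrite set_itv_ge -?ltNge//; exact: integrable_set0.
    have [D HD] := bounded_continuous_segment ab cde.
    apply: (@integrable_mul_bounded _ _ _ _ _ _ _ D) => //.
    - exact: integrable_profile.
    - by apply: measurable_funTS; exact: continuous_measurable_fun.
  apply: eq_Rintegral => t; rewrite inE/= in_itv/= => /andP[at_ tb].
  have t0 : 0 < t by exact: lt_le_trans at_.
  have s0 : 0 < Num.sqrt t by rewrite sqrtr_gt0.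
  have dchi : derive1 chi t = n%:R * (Num.sqrt t)^-1 ^+ n.-1 *
      (- (Num.sqrt t) ^- 2 * (2 * Num.sqrt t)^-1) * eta t + (Num.sqrt t)^-1 ^+ n * derive1 eta t.
    rewrite [in LHS]derive1E; have ds := is_derive1_sqrt t0.
    have dv := is_deriveV (lt0r_neq0 s0) ds.
    have de := smooth1_is_derive t seta.
    have := is_derive1_mul (is_derive1_exp n dv) de.
    by move=> D; rewrite derive_val /GRing.scale/=.
  rewrite /v /nsq_density dchi /chi.
  case: n n2 => [//|[//|[//|m]]] _; rewrite subSS subSS subn0 /=.
  have -> : t = Num.sqrt t ^+ 2 by rewrite sqr_sqrtr ?ltW.
  set s := Num.sqrt t in s0 *; rewrite (_ : Num.sqrt (s ^+ 2) = s); last first.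
    by rewrite sqrtr_sqr ger0_norm// ltW.
  rewrite /idfun. set X := derive1 eta _. set Y := eta _. set Z := F _.
  rewrite /nsq_weight !exprS !exprVn.
  by field; rewrite expf_neq0 gt_eqF.
move=> ->; congr (- _); rewrite (@Rintegral_supp _ _ _ lebn (shell a b)).
- by apply: eq_Rintegral => x _; rewrite /chi mulrA.
- exact: shell_hball.
- by move=> x _; rewrite /shell/= in_itv/= => /chi0 ->; rewrite mulr0.
Qed.

Lemma cvg_flux_steps a b p q : 0 < a -> a < p -> p < q -> q < b -> b < 1 ->
  \int[lebn]_(x in shell a b) (flux x * (stepk k p (nsq x) - stepk k q (nsq x))) @[k --> \oo]
  --> \int[lebn]_(x in nsq @^-1` `]p, q]) flux x.
Proof.
move=> a0 ap pq qb b1.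
apply: cvg_Rintegral_stepk; [exact: measurable_shell| | |exact: ltW|].
- exact: (integrable_radial_flux n2 gi).
- by apply: measurable_funTS; exact: measurable_nsq.
- move=> x; rewrite /shell/= !in_itv/= => /andP[px xq].
  by rewrite (le_trans (ltW ap) (ltW px)) (le_trans xq (ltW qb)).
Qed.

(** This is [flux_test] for [stepk k p - stepk k q] as [k] grows: the left side tends to point
    evaluations of [F], the right side to the flux through the shell. *)
Lemma profile_increment a b p q : 0 < a -> a < p -> p < q -> q < b -> b < 1 ->
  lebesgue_pt (F \_ `[a, b]) p -> lebesgue_pt (F \_ `[a, b]) q ->
  2 * C * (F q - F p) = \int[lebn]_(x in nsq @^-1` `]p, q]) flux x.
Proof.
move=> a0 ap pq qb b1 Lp Lq.
have iF := integrable_profile a0 b1.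
have ab : a <= b by rewrite ltW// (lt_trans ap)// (lt_trans pq).
have H1 := cvg_flux_steps a0 ap pq qb b1.
have cS k r : continuous (derive1 (stepk k r) : R -> R).
  exact: smooth1_continuous (smooth1_derive1 (smooth1_stepk k r)).
have iS k r : leb.-integrable `[a, b] (EFin \o (fun t => F t * derive1 (stepk k r) t)).
  have [D HD] := bounded_continuous_segment ab (cS k r).
  apply: (@integrable_mul_bounded _ _ _ _ _ _ _ D) => //.
  by apply: measurable_funTS; exact: continuous_measurable_fun.
have dS k t : derive1 (fun t => stepk k p t - stepk k q t) t =
    derive1 (stepk k p) t - derive1 (stepk k q) t.
  have d1 := is_derive_stepk k p t; have d2 := is_derive_stepk k q t.
  by have := is_derive1_add d1 (is_derive1_opp d2) => D; rewrite derive1E derive_val.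
have H2 : - (2 * C * (\int[leb]_(t in `[a, b]) (F t * derive1 (stepk k p) t) -
    \int[leb]_(t in `[a, b]) (F t * derive1 (stepk k q) t))) @[k --> \oo] -->
    - (2 * C * (F p - F q)).
  apply: cvgN; apply: cvgM; first exact: cvg_cst.
  by apply: cvgB; apply: cvg_integral_derive1_stepk => //;
    rewrite ?ap ?qb ?(lt_trans ap pq) ?(lt_trans pq qb).
have -> : 2 * C * (F q - F p) = - (2 * C * (F p - F q)) by ring.
have qb0 : 0 < b - q by rewrite subr_gt0.
apply: (cvg_unique _ _ H1) => //.
apply: cvg_trans H2; apply: near_eq_cvg; near=> k.
rewrite -RintegralB//.
have kb : k.+1%:R^-1 < b - q.
  near: k; exact: near_infty_natSinv_lt (PosNum qb0).
under eq_Rintegral do rewrite -mulrBr -dS.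
rewrite (@flux_test (fun t => stepk k p t - stepk k q t) a b) ?opprK//.
  by move=> m; apply: CnB; exact: smooth1_stepk.
move=> t /negP; rewrite negb_and -!ltNge => /orP[ta|bt].
  by rewrite !stepk_le ?subrr// ltW// (lt_trans ta)// ?(lt_trans ap).
have qt : q + k.+1%:R^-1 <= t by rewrite -lerBrDl ltW// (lt_trans kb)// ltrD2r.
by rewrite !stepk_ge ?subrr// (le_trans _ qt)// lerD2r ltW.
Unshelve. all: by end_near. Qed.

Lemma integrable_flux_oc p q : 0 < p -> q < 1 ->
  lebn.-integrable (nsq @^-1` `]p, q]%classic) (EFin \o flux).
Proof.
move=> p0 q1; apply: (integrableS _ _ _ (integrable_radial_flux n2 gi p0 q1)).
- exact: measurable_shell.
- exact: measurable_nsq_preimage.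
- by move=> x; rewrite /shell/= !in_itv/= => /andP[/ltW -> ->].
Qed.

Lemma flux_additive p q r : 0 < p -> p <= q -> q <= r -> r < 1 ->
  \int[lebn]_(x in nsq @^-1` `]p, r]) flux x =
  \int[lebn]_(x in nsq @^-1` `]p, q]) flux x + \int[lebn]_(x in nsq @^-1` `]q, r]) flux x.
Proof.
move=> p0 pq qr r1.
rewrite -Rintegral_setU.
- congr Rintegral; apply/seteqP; split => x /=; rewrite !in_itv/=.
    by move=> /andP[px xr]; have [xq|qx] := leP (nsq x) q; [left|right]; apply/andP.
  by move=> [/andP[px xq]|/andP[qx xr]]; apply/andP; split => //;
    [exact: le_trans qr|exact: le_lt_trans qx].
- exact: measurable_nsq_preimage.
- exact: measurable_nsq_preimage.
- apply: (integrableS _ _ _ (integrable_flux_oc p0 r1)).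
  + exact: measurable_nsq_preimage.
  + by apply: measurableU; exact: measurable_nsq_preimage.
  + move=> x /=; rewrite !in_itv/= => -[/andP[px xq]|/andP[qx xr]]; apply/andP; split => //;
    [exact: le_trans qr|exact: le_lt_trans qx].
- apply/disj_set2P; apply/seteqP; split => x //=; rewrite !in_itv/= => -[/andP[_ xq] /andP[]].
  by rewrite ltNge xq.
Qed.

(** Between Lebesgue points the increments of [F] are integrals of the flux. Integrating the flux
    from one fixed Lebesgue point [p0] defines [Fc] everywhere and recovers [F] at all the
    others. *)
Lemma continuous_profile : exists Fc : R -> R,
  {ae leb, forall t : R, 0 < t < 1 -> F t = Fc t} /\
  (forall p q, 0 < p -> p <= q -> q < 1 ->
    2 * C * (Fc q - Fc p) = \int[lebn]_(x in nsq @^-1` `]p, q]) flux x).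
Proof.
(* [F] is known to be integrable only away from [0] and [1]; Lebesgue points are taken in windows
   exhausting []0, 1[]. *)
pose al (m : nat) : R := m.+2%:R^-1.
have al0 m : 0 < al m by rewrite invr_gt0.
have al1 m : 1 - al m < 1 by rewrite ltrBlDr ltrDl.
pose Fm m := F \_ `[al m, 1 - al m].
have good : {ae leb, forall t, forall m, lebesgue_pt (Fm m) t}.
  apply/ae_foralln => m; apply: lebesgue_differentiation.
  by apply: integrable_locally_restrict => //; exact: integrable_profile.
have sep p q : 0 < p -> q < 1 -> exists m, al m < p /\ q < 1 - al m.
  move=> p0 q1; have q10 : 0 < 1 - q by rewrite subr_gt0.
  near \oo => m; exists m.
  have alm : al m < m.+1%:R^-1 by rewrite ltf_pV2 ?posrE// ltr_nat.
  split; first by rewrite (lt_trans alm)//; near: m; exact: near_infty_natSinv_lt (PosNum p0).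
  rewrite ltrBrDl -ltrBrDr (lt_trans alm)//.
  by near: m; exact: near_infty_natSinv_lt (PosNum q10).
have [p0 [p00 p01 Gp0]] : exists p0 : R, [/\ 0 < p0, p0 < 1 & forall m, lebesgue_pt (Fm m) p0].
  apply: contrapT => no.
  have [A [mA A0 HA]] := good.
  have : (leb (`]0%R, 1%R[%classic : set R) <= 0)%E.
    rewrite -[leRHS]A0; apply: le_measure; rewrite ?inE// => t; rewrite /= in_itv/= => /andP[t0 t1].
    by apply: HA => /= Gt; apply: no; exists t.
  by rewrite lebesgue_measure_itv/= lte_fin ltr01 -EFinB lee_fin subr0 ler10.
have C0 : 2 * C != 0 by rewrite mulf_neq0// gt_eqF// nsq_weight_gt0.
(* The oriented integral from [p0] to [t]: at most one of the two shells is nonempty. *)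
pose J t := \int[lebn]_(x in nsq @^-1` `]p0, t]) flux x - \int[lebn]_(x in nsq @^-1` `]t, p0]) flux x.
pose Fc t := F p0 + (2 * C)^-1 * J t.
have J0 p q : q <= p -> \int[lebn]_(x in nsq @^-1` `]p, q]) flux x = 0.
  move=> qp; rewrite set_itv_ge ?preimage_set0 ?Rintegral_set0// bnd_simp -leNgt//.
have inc p q : 0 < p -> p < q -> q < 1 -> (forall m, lebesgue_pt (Fm m) p) ->
    (forall m, lebesgue_pt (Fm m) q) ->
    2 * C * (F q - F p) = \int[lebn]_(x in nsq @^-1` `]p, q]) flux x.
  move=> pp pq q1 Gp Gq; have [m [mp mq]] := sep p q pp q1.
  exact: (profile_increment (al0 m) mp pq mq (al1 m) (Gp m) (Gq m)).
exists Fc; split.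
- move: good; apply: filterS; first exact: (ae_filter_ringOfSetsType leb).
  move=> t Gt /andP[t0 t1]; rewrite /Fc /J.
  have [tp|pt|->] := ltgtP t p0; last by rewrite !J0// subrr mulr0 addr0.
    rewrite (J0 p0 t) ?ltW// sub0r -(inc t p0)// mulrN mulrA mulVf// mul1r; ring.
  by rewrite (J0 t p0) ?ltW// subr0 -(inc p0 t)// mulrA mulVf// mul1r addrC subrK.
- move=> p q pp pq q1; rewrite /Fc.
  have -> : 2 * C * (F p0 + (2 * C)^-1 * J q - (F p0 + (2 * C)^-1 * J p)) = J q - J p.
    have EE (K X Y Z : R) : K != 0 -> K * (X + K^-1 * Y - (X + K^-1 * Z)) = Y - Z.
      by move=> K0; field.
    exact: EE.
  rewrite /J; have [qp0|p0q] := leP q p0.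
    have pp0 := le_trans pq qp0.
    rewrite !(J0 p0)// !sub0r opprK (flux_additive pp pq qp0 p01); ring.
  have [pp0|p0p] := leP p p0.
    rewrite (J0 p0 p)// (J0 q p0) ?ltW// subr0 sub0r opprK.
    by rewrite (flux_additive pp pp0 (ltW p0q) q1) addrC.
  rewrite (J0 p p0) ?ltW// (J0 q p0) ?ltW// !subr0.
  by rewrite (flux_additive p00 (ltW p0p) pq q1) addrAC subrr add0r.
Unshelve. all: by end_near. Qed.

Definition flux_energy q : R := \int[lebn]_(x in nsq @^-1` `]-oo, q]) dotr (g x) (g x).

Hypothesis energy : lebn.-integrable hball (fun x => (dotr (g x) (g x))%:E).

Lemma dotr_ge0 (y : 'rV[R]_n) : 0 <= dotr y y.
Proof. exact: nsq_ge0. Qed.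

Lemma nsq_le_hball q : q < 1 -> nsq @^-1` `]-oo, q]%classic `<=` (hball : set 'rV[R]_n).
Proof. by move=> q1 x; rewrite /= in_itv/= hballE/= => /le_lt_trans; apply. Qed.

(* [|<x, g>| <= s |g|^2 + |x|^2 / s] for every [s > 0] *)
Lemma flux_bound p q s : 0 < p -> p <= q -> q < 1 -> 0 < s ->
  `| \int[lebn]_(x in nsq @^-1` `]p, q]) flux x | <=
  (Num.sqrt p)^-1 ^+ n * (s * flux_energy q + s^-1 * (C * Num.sqrt q ^+ n * (q - p))).
Proof.
move=> p0 pq q1 s0.
have q0 : 0 < q by exact: lt_le_trans pq.
set S := nsq @^-1` `]p, q]%classic.
have mS : measurable S by exact: measurable_nsq_preimage.
set K := (Num.sqrt p)^-1 ^+ n.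
have K0 : 0 <= K by rewrite exprn_ge0// invr_ge0 sqrtr_ge0.
have SB : S `<=` (nsq @^-1` `]-oo, q]%classic : set 'rV[R]_n).
  by move=> x; rewrite /S/= !in_itv/= => /andP[].
have mB : measurable (nsq @^-1` `]-oo, q]%classic : set 'rV[R]_n).
  exact: measurable_nsq_preimage.
have iS := integrable_flux_oc p0 q1.
have iE : lebn.-integrable (nsq @^-1` `]-oo, q]%classic) (fun x => (dotr (g x) (g x))%:E).
  apply: (integrableS _ _ _ energy) => //; [exact: measurable_hball|exact: nsq_le_hball].
have iES : lebn.-integrable S (fun x => (dotr (g x) (g x))%:E) by exact: integrableS iE.
move: pq; rewrite le_eqVlt => /predU1P[pq|pq].
  have E0 : 0 <= flux_energy q by apply: Rintegral_ge0 => x _; exact: dotr_ge0.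
  rewrite /S pq set_itv_ge ?bnd_simp ?ltxx// preimage_set0 Rintegral_set0 normr0.
  by rewrite subrr !mulr0 addr0 !mulr_ge0// ltW.
have finS : (lebn S < +oo)%E.
  by rewrite /S lebesgue_row_shell ?ltry ?ltW// ltnW// ltnW.
have mN : measurable_fun S (nsq : _ -> R) by apply: measurable_funTS; exact: measurable_nsq.
have iN : lebn.-integrable S (EFin \o nsq).
  apply: (@le_integrable _ _ _ _ _ mS _ (cst 1%:E)).
  - exact/measurable_EFinP.
  - move=> x; rewrite /S/= in_itv/= => /andP[_ xq].
    by rewrite lee_fin normr1 ger0_norm ?nsq_ge0// (le_trans xq (ltW q1)).
  - apply/integrableP; split; first exact: measurable_cst.
    under eq_integral do rewrite /= normr1.
    by rewrite integral_cst// mul1e.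
(* Here [t] times the density is [C t^(n/2)], bounded by its value at [q]. *)
have INle : \int[lebn]_(x in S) nsq x <= C * Num.sqrt q ^+ n * (q - p).
  rewrite (Rintegral_nsq n2 (k := id) (D := `]p, q]%classic))//.
  have cw := @continuous_nsq_density R n.
  have ct : continuous (fun t : R => t * nsq_density (n := n) t).
    by move=> t; apply: cvgM; [exact: cvg_id|exact: cw].
  have iT : leb.-integrable `]p, q] (EFin \o (fun t => t * nsq_density (n := n) t)).
    exact: integrable_continuous_oc.
  apply: (@le_trans _ _ (\int[leb]_(t in `]p, q]) (C * Num.sqrt q ^+ n))).
    apply: le_Rintegral => //.
      by apply: integrable_continuous_oc => t; exact: cvg_cst.
    move=> t; rewrite /= in_itv/= => /andP[pt tq].
    have t0 : 0 < t by exact: lt_trans pt.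
    rewrite /nsq_density mulrCA ler_pM2l ?nsq_weight_gt0//.
    rewrite -{1}(sqr_sqrtr (ltW t0)) -exprD addnC subnK; last exact: ltnW.
    by rewrite lerXn2r ?nnegrE ?sqrtr_ge0// ler_wsqrtr.
  rewrite Rintegral_cst// [X in fine X](_ : _ = (q - p)%:E)//.
  by rewrite [LHS]lebesgue_measure_itv/= lte_fin pq -EFinB.
apply: le_trans (le_normr_Rintegral mS iS) _.
have pw x : S x -> `|flux x| <= K * (s * dotr (g x) (g x) + s^-1 * nsq x).
  rewrite /S/= in_itv/= => /andP[px xq]; have x0 : 0 < nsq x by exact: lt_trans px.
  have sx0 : 0 < Num.sqrt (nsq x) by rewrite sqrtr_gt0.
  rewrite /radial_flux normrM mulrC; apply: ler_pM => //.
    rewrite ger0_norm ?exprn_ge0 ?invr_ge0 ?sqrtr_ge0//.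
    rewrite lerXn2r ?nnegrE ?invr_ge0 ?sqrtr_ge0//.
    by rewrite lef_pV2 ?posrE ?sqrtr_gt0// ler_wsqrtr// ltW.
  rewrite /nsq /dotr; apply: le_trans (ler_norm_sum _ _ _) _.
  rewrite !mulr_sumr -big_split/=; apply: ler_sum => i _.
  set X := x 0 i; set Y := g x 0 i.
  (* [e] stands for the two signs of [x_i g_i]; with [e^2 = 1] the difference of the two sides is
     [1/s] times a sum of squares. *)
  have E1 (e : R) : e ^+ 2 = 1 -> e * (X * Y) <= s * (Y * Y) + s^-1 * (X * X).
    move=> e2; rewrite -subr_ge0.
    rewrite (_ : _ - _ = s^-1 * ((s * Y - e * X / 2) ^+ 2 + 3 / 4 * X ^+ 2)); last first.
      rewrite -[X in _ - X]mul1r.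
      have -> : s^-1 * ((s * Y - e * X / 2) ^+ 2 + 3 / 4 * X ^+ 2) =
        s * Y ^+ 2 - e * X * Y + s^-1 * X ^+ 2 * (e ^+ 2 / 4 + 3 / 4).
        by field; rewrite gt_eqF.
      by rewrite e2; field; rewrite gt_eqF.
    by rewrite mulr_ge0 ?invr_ge0 ?(ltW s0)// addr_ge0 ?sqr_ge0// mulr_ge0 ?sqr_ge0// divr_ge0.
  rewrite ler_norml; apply/andP; split.
    rewrite lerNl -mulN1r; apply: E1; ring.
  rewrite -[leLHS]mul1r; apply: E1; ring.
have iR : lebn.-integrable S (EFin \o (fun x => s * dotr (g x) (g x) + s^-1 * nsq x)).
  rewrite (_ : _ \o _ = (fun x => s%:E * (dotr (g x) (g x))%:E) \+ (fun x => s^-1%:E * (EFin \o nsq) x))%E//.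
  by apply: integrableD => //; exact: integrableZl.
apply: (@le_trans _ _ (\int[lebn]_(x in S) (K * (s * dotr (g x) (g x) + s^-1 * nsq x)))).
  apply: le_Rintegral => //.
  - exact: integrable_norm.
  - rewrite (_ : _ \o _ = fun x => (K%:E * (EFin \o (fun x => s * dotr (g x) (g x) + s^-1 * nsq x)%R) x)%E)//.
    exact: integrableZl.
rewrite RintegralZl// ler_wpM2l//.
rewrite RintegralD//; last 2 first.
- rewrite (_ : _ \o _ = fun x => (s%:E * (dotr (g x) (g x))%:E)%E)//; exact: integrableZl.
- rewrite (_ : _ \o _ = fun x => (s^-1%:E * (EFin \o nsq) x)%E)//; exact: integrableZl.
rewrite !RintegralZl//; apply: lerD; rewrite ler_pM2l ?invr_gt0//.
by apply: ge0_subset_Rintegral => // x _; exact: dotr_ge0.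
Qed.

Lemma flux_energy_nd p q : p <= q -> q < 1 -> flux_energy p <= flux_energy q.
Proof.
move=> pq q1.
apply: ge0_subset_Rintegral.
- exact: measurable_nsq_preimage.
- exact: measurable_nsq_preimage.
- apply: (integrableS _ _ _ energy); [exact: measurable_hball| |exact: nsq_le_hball].
  exact: measurable_nsq_preimage.
- by move=> x; rewrite /= !in_itv/= => /le_trans; apply.
- by move=> x _; exact: dotr_ge0.
Qed.

(** By dominated convergence the limit is the energy of the single point [0], a null set. *)
Lemma cvg_flux_energy (r : nat -> R) : (forall k, 0 < r k < 1) -> r @ \oo --> (0 : R) ->
  flux_energy (r k) @[k --> \oo] --> (0 : R).
Proof.
move=> r01 r0.
have mh := @measurable_hball R n.
have mB q : measurable (nsq @^-1` `]-oo, q]%classic : set 'rV[R]_n).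
  exact: measurable_nsq_preimage.
have H := @cvg_Rintegral_bounded _ _ _ lebn (hball : set 'rV[R]_n) (fun x => dotr (g x) (g x))
  (fun k x => \1_(nsq @^-1` `]-oo, r k]%classic) x) (fun x => \1_(nsq @^-1` `]-oo, 0]%classic) x) 1
  mh energy.
have E q : q < 1 -> \int[lebn]_(x in hball) (dotr (g x) (g x) * \1_(nsq @^-1` `]-oo, q]%classic) x) =
    flux_energy q.
  move=> q1; rewrite (@Rintegral_supp _ _ _ lebn (nsq @^-1` `]-oo, q]%classic)).
  - by apply: eq_Rintegral => x xq; rewrite indicE xq mulr1.
  - exact: nsq_le_hball.
  - by move=> x _ nx; rewrite indicE memNset// mulr0.
have E0 : flux_energy 0 = 0.
  rewrite /flux_energy /Rintegral null_set_integral//.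
  - have iE : lebn.-integrable (nsq @^-1` `]-oo, (0 : R)]%classic) (fun x => (dotr (g x) (g x))%:E).
      apply: (integrableS _ _ _ energy) => //; exact: nsq_le_hball.
    exact: measurable_int iE.
  - rewrite (_ : _ @^-1` _ = [set x | nsq x <= 0]); first by apply: lebesgue_row_ball0; exact: (ltnW (ltnW n2)).
    by apply/seteqP; split => x /=; rewrite in_itv.
rewrite -E0 -E//.
apply: cvg_trans (H _ _ _).
- apply: near_eq_cvg; near=> k; rewrite E//.
  by have /andP[] := r01 k.
- move=> k; exact: measurable_indic.
- by move=> k x _; rewrite indicE; case: (_ \in _); rewrite ?normr1 ?normr0.
- move=> x _.
  have mq q : (x \in nsq @^-1` `]-oo, q]%classic) = (nsq x <= q).
    by apply/idP/idP; rewrite inE/= in_itv.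
  under eq_fun do rewrite indicE mq; rewrite indicE mq.
  have [x0|x0] := leP (nsq x) 0; apply: cvg_near_cst; near=> k.
    by rewrite (le_trans x0)//; have /andP[/ltW] := r01 k.
  by rewrite leNgt (_ : r k < nsq x)//; near: k; exact: cvgr_lt r0 _ x0.
Unshelve. all: by end_near. Qed.

End flux.

(** * Extension by clamping, and primitives *)

Section clamp.
Context {R : realType} (a b : R).
Hypothesis ab : a <= b.

(** Composition with [clamp] extends a function continuous on [[a, b]] to a continuous function on
    the line, without changing it on the segment. The profile and the coefficients, singular at [0]
    or [1], thereby fall under results for globally continuous functions. *)
Definition clamp (t : R) : R := Num.min (Num.max t a) b.

Lemma clamp_itv t : a <= clamp t <= b.
Proof. by rewrite /clamp le_min ge_min lexx orbT andbT le_max lexx orbT ab. Qed.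

Lemma clamp_id t : a <= t <= b -> clamp t = t.
Proof. by move=> /andP[at_ tb]; rewrite /clamp (max_idPl at_) (min_idPl tb). Qed.

Lemma continuous_clamp : continuous clamp.
Proof.
move=> t; apply: (@continuous_min _ _ (fun t => Num.max t a) (cst b)); last exact: cst_continuous.
by apply: (@continuous_max _ _ id (cst a)) => //; exact: cst_continuous.
Qed.

Lemma continuous_comp_clamp (f : R -> R) :
  (forall t, a <= t <= b -> {for t, continuous f}) -> continuous (f \o clamp).
Proof.
move=> cf t; apply: continuous_comp; first exact: continuous_clamp.
by apply: cf; exact: clamp_itv.
Qed.

End clamp.

Section primitive.
Context {R : realType}.
Notation leb := (@lebesgue_measure R).
Implicit Types (f : R -> R) (a b t : R).

Definition prim f t : R := \int[leb]_(s in `[0, t]) f s.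

Lemma is_derive_prim f t : continuous f -> 0 < t -> is_derive t 1 (prim f) (f t).
Proof.
move=> cf t0.
have t1 : t < t + 1 by rewrite ltrDl.
have [d1 d2] := continuous_FTC1_closed t1 (integrable_continuous 0 (t + 1) cf) t0 (cf t).
by have := derivableP d1; rewrite -derive1E d2.
Qed.

Lemma continuous_is_derive f t df : is_derive t 1 f df -> {for t, continuous f}.
Proof. by move=> [df' _]; apply/differentiable_continuous/derivable1_diffP. Qed.

Lemma prim_sub f a b : continuous f -> 0 < a -> a <= b ->
  prim f b - prim f a = \int[leb]_(t in `[a, b]) f t.
Proof.
move=> cf a0 ab; apply/esym.
have dF x : a < x < b -> is_derive x 1 (prim f) (f x).
  by move=> /andP[ax _]; apply: is_derive_prim => //; exact: lt_trans ax.
rewrite /Rintegral (FTC2_segment ab dF)// => x /andP[ax _]; last exact: cf.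
apply: (@continuous_is_derive _ _ (f x)); apply: is_derive_prim => //; exact: lt_le_trans ax.
Qed.

(** The zero mean makes the primitive vanish to the right of [b] too, so that it yields a radial
    test function. *)
Lemma smooth1_primitive f a b : smooth1 f -> 0 < a ->
  (forall t, ~ (a <= t <= b) -> f t = 0) ->
  \int[leb]_(t in `[a, b]) f t = 0 ->
  [/\ smooth1 (prim f), (forall t, 0 < t -> is_derive t 1 (prim f) (f t)) &
      (forall t, ~ (a <= t <= b) -> prim f t = 0)].
Proof.
move=> sf a0 f0 If.
have cf := smooth1_continuous sf.
have pa t : t < a -> prim f t = 0.
  move=> ta; rewrite /prim (@eq_Rintegral _ _ _ _ _ (cst 0)).
    by rewrite /Rintegral integral0.
  move=> s; rewrite inE/= in_itv/= => /andP[_ st]; rewrite f0// => /andP[as_ _].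
  by move: ta; rewrite ltNge (le_trans as_ st).
have d t : 0 < t -> is_derive t 1 (prim f) (f t) by exact: is_derive_prim.
split=> //.
- case=> [//|m]; apply: (Cn_extend0 a0 pa); exists f; split; first exact: d.
  exact: CnS (sf m).
- move=> t /negP; rewrite negb_and -!ltNge => /orP[/pa//|bt].
  have [ba|ab] := ltP b a.
    rewrite /prim (@eq_Rintegral _ _ _ _ _ (cst 0)); first by rewrite /Rintegral integral0.
    by move=> s _; rewrite f0// => /andP[as_ sb]; move: ba; rewrite ltNge (le_trans as_ sb).
  rewrite -If /prim; apply: Rintegral_supp.
    move=> s; rewrite /= !in_itv/= => /andP[as_ sb].
    by rewrite (le_trans (ltW a0) as_) (le_trans sb (ltW bt)).
  by move=> s _; rewrite /= in_itv/= => /f0.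
Qed.

End primitive.

Section profile_continuity.
Context {R : realType} {n : nat}.
Notation leb := (@lebesgue_measure R).
Notation lebn := (@lebesgue_row R n).
Hypothesis n2 : (2 < n)%N.
Variables (u : 'rV[R]_n -> R) (g : 'rV[R]_n -> 'rV[R]_n) (Fc : R -> R).
Hypothesis wg : weak_gradient u g.
Hypothesis energy : lebn.-integrable hball (fun x => (dotr (g x) (g x))%:E).
Local Notation C := (nsq_weight (R := R) (n := n)).
Local Notation flux := (radial_flux g).
Hypothesis FcE : forall p q, 0 < p -> p <= q -> q < 1 ->
    2 * C * (Fc q - Fc p) = \int[lebn]_(x in nsq @^-1` `]p, q]) flux x.
Implicit Types (p q s t : R).

Lemma flux_energy_ge0 q : 0 <= flux_energy g q.
Proof. by apply: Rintegral_ge0 => x _; exact: dotr_ge0. Qed.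

Lemma profile_bound p q s : 0 < p -> p <= q -> q < 1 -> 0 < s ->
  2 * C * `|Fc q - Fc p| <=
  (Num.sqrt p)^-1 ^+ n * (s * flux_energy g q + s^-1 * (C * Num.sqrt q ^+ n * (q - p))).
Proof.
move=> p0 pq q1 s0; have C0 := nsq_weight_gt0 (R := R) n2.
have C2 : 0 < 2 * C by rewrite mulr_gt0.
rewrite (_ : 2 * C * `|Fc q - Fc p| = `|2 * C * (Fc q - Fc p)|); last first.
  by rewrite [RHS]normrM (gtr0_norm C2).
rewrite FcE//.
exact: (flux_bound n2 wg energy).
Qed.

(** The parameter [s] of [profile_bound] replaces the Cauchy-Schwarz inequality: first [s] is taken
    small to absorb the energy, then [q - p] small compared with [s]. *)
Lemma continuous_profile_at t : 0 < t < 1 -> {for t, continuous Fc}.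
Proof.
move=> /andP[t0 t1]; have C0 := nsq_weight_gt0 (R := R) n2.
pose p0 := t / 2; pose q0 := (t + 1) / 2.
have p00 : 0 < p0 by rewrite divr_gt0.
have q01 : q0 < 1 by rewrite /q0; lra.
pose K := (Num.sqrt p0)^-1 ^+ n.
have K0 : 0 < K by rewrite exprn_gt0// invr_gt0 sqrtr_gt0.
pose A := flux_energy g q0.
have A0 : 0 <= A by exact: flux_energy_ge0.
have key p q s : p0 <= p -> p <= q -> q <= q0 -> 0 < s ->
    2 * C * `|Fc q - Fc p| <= K * (s * A + s^-1 * (C * (q - p))).
  move=> pp pq qq s0; have pp0 : 0 < p by exact: lt_le_trans pp.
  have q1 : q < 1 by exact: le_lt_trans q01.
  apply: le_trans (profile_bound pp0 pq q1 s0) _; apply: ler_pM.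
  - by rewrite exprn_ge0// invr_ge0 sqrtr_ge0.
  - rewrite addr_ge0// mulr_ge0 ?invr_ge0 ?(ltW s0) ?flux_energy_ge0//.
    by rewrite mulr_ge0 ?subr_ge0// mulr_ge0 ?exprn_ge0 ?sqrtr_ge0 ?(ltW C0).
  - rewrite lerXn2r ?nnegrE ?invr_ge0 ?sqrtr_ge0// lef_pV2 ?posrE ?sqrtr_gt0//.
    by rewrite ler_wsqrtr.
  - apply: lerD; first by rewrite ler_pM2l//; exact: flux_energy_nd.
    rewrite ler_pM2l ?invr_gt0// ler_wpM2r ?subr_ge0// ger_pMr// exprn_ile1 ?sqrtr_ge0//.
    by rewrite -sqrtr1 ler_wsqrtr// ltW.
apply/cvgrPdist_le => e e0.
(* With this [s] and the [d] below, [K s (A + 1)] and [K C d / s] both equal [C e], half of the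
   bound [2 C e]. *)
pose s := C * e / (K * (A + 1)).
have KA : 0 < K * (A + 1) by rewrite mulr_gt0// ltr_wpDl.
have s0 : 0 < s by rewrite divr_gt0// mulr_gt0.
pose d := s * e / K.
have d0 : 0 < d by apply: divr_gt0 => //; exact: mulr_gt0.
have fin p q : p0 <= p -> p <= q -> q <= q0 -> q - p <= d -> `|Fc q - Fc p| <= e.
  move=> pp pq qq qpd; have C2 : 0 < 2 * C by rewrite mulr_gt0.
  rewrite -(ler_pM2l C2); apply: le_trans (key p q s pp pq qq s0) _.
  have -> : 2 * C * e = K * (s * (A + 1) + s^-1 * (C * d)).
    rewrite /d /s; field.
    rewrite (gt_eqF C0) (gt_eqF K0) (gt_eqF e0)/=; lra.
  rewrite ler_pM2l//; apply: lerD; first by rewrite ler_pM2l// lerDl.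
  by rewrite ler_pM2l ?invr_gt0// ler_pM2l.
near=> r.
have rp : p0 <= r by near: r; apply: lt_le_nbhsr => //; rewrite /p0; lra.
have rq : r <= q0 by near: r; apply: lt_le_nbhsl; rewrite /q0; lra.
have rd : `|t - r| <= d by near: r; exact: cvgr_dist_le.
have tp : p0 <= t by rewrite /p0; lra.
have tq : t <= q0 by rewrite /q0; lra.
have [rt|tr] := leP r t.
  by apply: fin => //; move: rd; rewrite ger0_norm// subr_ge0.
rewrite distrC; apply: fin => //; first exact: ltW.
by move: rd; rewrite distrC ger0_norm// subr_ge0 ltW.
Unshelve. all: by end_near. Qed.

End profile_continuity.

(** * The equation of the profile *)

Section power.
Context {R : realType} (q : R).
Hypothesis q0 : 0 < q.
Implicit Types z : R.

Definition power z : R := `|z| `^ q * z.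

Definition power_prim z : R := `|z| `^ (q + 2) / (q + 2).

Let q2 : 0 < q + 2. Proof. by rewrite addr_gt0. Qed.

Lemma power_prim_ge0 z : 0 <= power_prim z.
Proof. by rewrite divr_ge0 ?powR_ge0// ltW. Qed.

Lemma powerE z : z * power z = (q + 2) * power_prim z.
Proof.
rewrite /power_prim [RHS]mulrCA mulfV ?gt_eqF// mulr1 /power mulrCA -expr2 -real_normK ?num_real//.
by rewrite -powR_mulrn// -powRD// gt_eqF.
Qed.

Lemma power_neq0_prim z : z != 0 -> power z = (q + 2) * power_prim z / z.
Proof. by move=> z0; rewrite -powerE mulrAC mulfV// mul1r. Qed.

Lemma is_derive_power_prim z : is_derive z 1 power_prim (power z).
Proof.
have D (x : R) : 0 < x -> is_derive x 1 (fun x => x `^ (q + 2) / (q + 2)) (x `^ (q + 1)).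
  move=> x0; have H := is_derive1_powR (q + 2) x0.
  have := is_derive1_mul H (is_derive_cst ((q + 2)^-1) x 1).
  rewrite mulr0 addr0 mulrAC mulfV ?gt_eqF// mul1r.
  by rewrite (_ : q + 2 - 1 = q + 1)//; ring.
have pE (x : R) : 0 < x -> x `^ (q + 1) = x `^ q * x.
  by move=> x0; rewrite powRD ?powRr1 ?ltW// gt_eqF ?addr_gt0.
have [z0|z0|->] := ltgtP z 0.
- have nz0 : 0 < - z by rewrite oppr_gt0.
  have H : is_derive z 1 (fun x => (- x) `^ (q + 2) / (q + 2)) (power z).
    have Dm := D (- z) nz0; have Do := is_derive1_opp (is_derive_id z (1 : R)).
    have := @is_derive1_comp _ (fun x => x `^ (q + 2) / (q + 2)) (fun x => - x) z _ _ Dm Do.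
    by rewrite pE// mulrN1 -mulrN opprK /power ltr0_norm.
  apply: (near_eq_is_derive _ H); near=> x.
  by rewrite /power_prim ltr0_norm//; near: x; exact: lt_nbhsl.
- have H := D z z0; rewrite pE// in H.
  rewrite /power gtr0_norm//.
  apply: (near_eq_is_derive _ H); near=> x.
  by rewrite /power_prim gtr0_norm//; near: x; exact: lt_nbhsr.
(* [is_derive0_quadratic] wants a bound on the whole line, whereas [|x|^(q+2) <= |x|^2] holds only
   for [|x| <= 1]: hence the truncation. *)
- pose f (x : R) := if `|x| <= 1 then power_prim x else 0.
  have H : is_derive (0 : R) 1 f 0.
    apply: (@is_derive0_quadratic _ _ (q + 2)^-1) => x; rewrite /f.
    case: ifPn => x1; last by rewrite normr0 mulr_ge0 ?sqr_ge0// invr_ge0 ltW.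
    rewrite ger0_norm ?power_prim_ge0// /power_prim mulrC ler_pM2l ?invr_gt0//.
    rewrite -real_normK ?num_real// -powR_mulrn//.
    rewrite powRD; last by rewrite gt_eqF.
    have xq : `|x| `^ q <= 1 `^ q by apply: ge0_ler_powR => //; rewrite ?nnegrE// ltW.
    by rewrite ler_piMl ?powR_ge0//; move: xq; rewrite powR1.
  rewrite /power mulr0; apply: (near_eq_is_derive _ H); near=> x.
  rewrite /f ifT//; near: x; exact: nbhs0_le.
Unshelve. all: by end_near. Qed.

Lemma le_power z M : `|z| <= M -> `|power z| <= M `^ q * `|z|.
Proof.
move=> zM; rewrite normrM ger0_norm ?powR_ge0// ler_wpM2r//.
by apply: ge0_ler_powR => //; rewrite ?nnegrE ?(le_trans _ zM)// ltW.
Qed.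

Lemma continuous_power : continuous power.
Proof.
have C z : z != 0 -> {for z, continuous power}.
  move=> z0; have H := is_derive_power_prim z.
  have cP := continuous_is_derive H.
  have cQ : {for z, continuous (fun x => (q + 2) * power_prim x * x^-1)}.
    apply: cvgM; last by apply: cvgV => //; exact: cvg_id.
    by apply: cvgM; [exact: cvg_cst|exact: cP].
  suff : power x @[x --> z] --> power z by [].
  rewrite (power_neq0_prim z0).
  apply: cvg_trans cQ; apply: near_eq_cvg; near=> x.
  rewrite power_neq0_prim//; near: x.
  by apply: (cvgr_neq0 (f := id)) z0; exact: cvg_id.
move=> z; have [->|/C//] := eqVneq z 0.
suff : power x @[x --> (0 : R)] --> power 0 by [].
have N d : 0 < d -> \forall x \near (0 : R), `|x| <= d by exact: nbhs0_le.
apply/cvgrPdist_le => e e0; near=> x; rewrite {1}/power mulr0 sub0r normrN.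
have x1 : `|x| <= 1 by near: x; exact: N.
apply: le_trans (le_power x1) _; rewrite powR1 mul1r; near: x.
exact: N.
Unshelve. all: by end_near. Qed.

End power.

Section equation.
Context {R : realType} {n : nat}.
Notation leb := (@lebesgue_measure R).
Notation lebn := (@lebesgue_row R n).
Hypothesis n2 : (2 < n)%N.
Variables (lambda q : R).
Hypothesis q0 : 0 < q.
Variables (u : 'rV[R]_n -> R) (g : 'rV[R]_n -> 'rV[R]_n) (F Fc : R -> R).
Hypothesis wg : weak_gradient u g.
Hypothesis mF : measurable_fun [set: measurableTypeR R] (F : _ -> measurableTypeR R).
Hypothesis uF : {ae lebn, forall x, hball x -> u x = F (nsq x)}.
Hypothesis FFc : {ae leb, forall t : R, 0 < t < 1 -> F t = Fc t}.
Local Notation C := (nsq_weight (R := R) (n := n)).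
Local Notation dens := (nsq_density (R := R) (n := n)).
Local Notation flux := (radial_flux g).
Hypothesis FcE : forall a b : R, 0 < a -> a <= b -> b < 1 ->
  2 * C * (Fc b - Fc a) = \int[lebn]_(x in nsq @^-1` `]a, b]) flux x.
Hypothesis cFc : forall t, 0 < t < 1 -> {for t, continuous Fc}.
Hypothesis weq : forall phi, test_function phi ->
    \int[lebn]_(x in hball) (hyp_grad_dot x (g x) (gradient phi x) * conformal x ^+ n)
    - lambda * \int[lebn]_(x in hball) (u x * phi x * conformal x ^+ n)
    = \int[lebn]_(x in hball) (power q (u x) * phi x * conformal x ^+ n).

(* At [t = |x|^2], the inverse of [4 |x|^n (conformal x)^(n-2)]. *)
Definition flux_coef (t : R) : R := (Num.sqrt t)^-1 ^+ n * (((1 - t) / 2) ^+ (n - 2) / 4).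

Definition reaction (t : R) : R :=
  (lambda * Fc t + power q (Fc t)) * (2 / (1 - t)) ^+ n.

Section window.
Variables (a b : R).
Hypotheses (a0 : 0 < a) (ab : a <= b) (b1 : b < 1).
Let cl := clamp a b.

Let cl01 t : 0 < cl t < 1.
Proof.
by have /andP[act tcb] := clamp_itv ab t; rewrite (lt_le_trans a0 act) (le_lt_trans tcb b1).
Qed.

Let cconf : continuous (fun t => (2 / (1 - cl t)) ^+ n).
Proof.
apply: (continuous_comp_clamp ab (f := fun t => (2 / (1 - t)) ^+ n)) => t /andP[_ tb].
apply: (@continuous_comp _ _ _ (fun t : R => 2 / (1 - t)) (fun x : R => x ^+ n)); last exact: exprn_continuous.
apply: cvgM; first exact: cvg_cst.
apply: cvgV; first by rewrite subr_eq0 gt_eqF// (le_lt_trans tb b1).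
by apply: cvgB; [exact: cvg_cst|exact: cvg_id].
Qed.

Let cprof : continuous (Fc \o cl).
Proof.
by apply: continuous_comp_clamp => // t /andP[at_ tb]; apply: cFc; rewrite (lt_le_trans a0 at_) (le_lt_trans tb b1).
Qed.

Let rdens t := reaction (cl t) * dens t.

Lemma continuous_rdens : continuous rdens.
Proof.
move=> t; apply: cvgM; last exact: continuous_nsq_density.
apply: cvgM; last exact: cconf.
apply: cvgD; first by apply: cvgM; [exact: cvg_cst|exact: cprof].
by apply: (continuous_comp (f := Fc \o cl)); [exact: cprof|exact: continuous_power].
Qed.

Lemma integrable_flux_comp (theta : R -> R) : continuous theta ->
  lebn.-integrable (shell a b) (EFin \o (fun x => flux x * theta (nsq x))).
Proof.
move=> ct; have [D HD] := bounded_continuous_segment ab ct.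
have [_ gi _] := wg.
apply: (@integrable_mul_bounded _ _ _ _ _ _ _ D).
- exact: measurable_shell.
- exact: (integrable_radial_flux n2 gi).
- exact: continuous_fun_nsq.
- by move=> x; rewrite /shell/= in_itv/=; exact: HD.
Qed.

(** [flux_coef] is chosen for this identity. The gradient of [psi(|x|^2)] is [2 psi' x], and if
    [psi' = theta flux_coef] all powers of [1 - |x|^2] coming from the metric cancel, leaving half
    of [theta] times the flux. *)
Lemma equation_test (psi theta : R -> R) : smooth1 psi -> continuous theta ->
  (forall t, ~ (a <= t <= b) -> psi t = 0) ->
  (forall t, 0 < t -> derive1 psi t = theta t * flux_coef t) ->
  2^-1 * \int[lebn]_(x in shell a b) (flux x * theta (nsq x)) =
  \int[leb]_(t in `[a, b]) (psi t * rdens t).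
Proof.
move=> spsi ctheta psi0 dpsi.
have [[mu _] _ _] := wg.
have psib t : b < t -> psi t = 0 by move=> bt; apply: psi0 => /andP[_]; rewrite leNgt bt.
have cpsi := smooth1_continuous spsi.
have := weq (test_function_comp spsi b1 psib).
have -> : \int[lebn]_(x in hball) (hyp_grad_dot x (g x) (gradient (fun x => psi (nsq x)) x) *
    conformal x ^+ n) = 2^-1 * \int[lebn]_(x in shell a b) (flux x * theta (nsq x)).
  have gE x : gradient (fun x => psi (nsq x)) x = \row_i (derive1 psi (nsq x) * (2 * x 0 i)).
    by apply/rowP => i; rewrite !mxE; have H := is_derive_comp_nsq i x spsi; rewrite derive_val.
  have dE x : dotr (g x) (gradient (fun x => psi (nsq x)) x) = 2 * derive1 psi (nsq x) * dotr x (g x).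
    by rewrite gE /dotr mulr_sumr; apply: eq_bigr => i _; rewrite mxE; ring.
  have dpsi0 := derive1_supp psi0.
  rewrite (@Rintegral_supp _ _ _ _ (shell a b)).
  - rewrite -RintegralZl; last 2 first.
    + exact: measurable_shell.
    + exact: integrable_flux_comp.
    apply: eq_Rintegral => x; rewrite inE /shell/= in_itv/= => /andP[ax xb].
    have x0 : 0 < nsq x by exact: lt_le_trans ax.
    rewrite /hyp_grad_dot dE /conformal enorm_sqr dpsi// /flux_coef /radial_flux.
    set s := Num.sqrt _; set D := dotr _ _; set T := theta _.
    have A0 : (1 - nsq x) / 2 != 0.
      by rewrite mulf_neq0 ?invr_eq0// subr_eq0 gt_eqF// (le_lt_trans xb).
    have -> : 2 / (1 - nsq x) = ((1 - nsq x) / 2)^-1 by rewrite invf_div.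
    move: A0; set A := _ / 2 => A0.
    have E : A ^+ 2 * A ^+ (n - 2) * A^-1 ^+ n = 1.
      by rewrite -exprD addnC subnK ?(ltnW n2)// exprVn mulfV// expf_neq0.
    transitivity (2^-1 * (D * s^-1 ^+ n * T) * (A ^+ 2 * A ^+ (n - 2) * A^-1 ^+ n)).
      by field.
    by rewrite E mulr1.
  - exact: shell_hball.
  - move=> x _; rewrite /shell/= in_itv/= => /dpsi0 d0.
    by rewrite /hyp_grad_dot dE d0 mulr0 mul0r mulr0 mul0r.
pose v t := psi t * (2 / (1 - cl t)) ^+ n.
have cv : continuous v by move=> t; apply: cvgM; [exact: cpsi|exact: cconf].
have v0 t : ~ (a <= t <= b) -> v t = 0 by move=> /psi0 p0; rewrite /v p0 mul0r.
have vE x : psi (nsq x) * conformal x ^+ n = v (nsq x).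
  rewrite /conformal enorm_sqr /v /cl.
  have [xab|/negP/psi0 ->] := boolP (a <= nsq x <= b); first by rewrite clamp_id.
  by rewrite !mul0r.
have trans (Phi : R -> R) : continuous Phi ->
    \int[lebn]_(x in hball) (Phi (u x) * psi (nsq x) * conformal x ^+ n) =
    \int[leb]_(t in `[a, b]) (Phi (Fc (cl t)) * v t * dens t).
  move=> cPhi; under eq_Rintegral do rewrite -mulrA vE.
  have mPhi : measurable_fun [set: measurableTypeR R] (Phi : _ -> measurableTypeR R).
    exact: continuous_measurable_fun.
  rewrite (Rintegral_hball_profile n2 mu mF mPhi uF _ v0 b1); last exact: continuous_measurable_fun.
  have mv : measurable_fun (`[a, b]%classic : set (measurableTypeR R)) (v : _ -> measurableTypeR R).
    by apply: measurable_funTS; exact: continuous_measurable_fun.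
  have md : measurable_fun (`[a, b]%classic : set (measurableTypeR R)) (dens : _ -> measurableTypeR R).
    by apply: measurable_funTS; exact: measurable_nsq_density.
  apply: ae_eq_Rintegral => //.
  - by apply: measurable_funM => //; apply: measurable_funM => //; apply: measurable_funTS; exact: measurableT_comp.
  - apply: measurable_funM => //; apply: measurable_funM => //; apply: measurable_funTS.
    apply: continuous_measurable_fun => t.
    by apply: (continuous_comp (f := Fc \o cl)); [exact: cprof|exact: cPhi].
  - move: FFc; apply: filterS; first exact: (ae_filter_ringOfSetsType leb).
    move=> t Ft; rewrite /= in_itv/= => tab.
    by rewrite /cl clamp_id// Ft//; have := cl01 t; rewrite /cl clamp_id.
rewrite (trans id)//; last by move=> t; exact: cvg_id.
rewrite (trans (power q)); last exact: continuous_power.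
have ci (Phi : R -> R) : continuous Phi ->
    leb.-integrable `[a, b] (EFin \o (fun t => Phi (Fc (cl t)) * v t * dens t)).
  move=> cPhi; apply: integrable_continuous => t.
  apply: cvgM; last exact: continuous_nsq_density.
  apply: cvgM; last exact: cv.
  by apply: (continuous_comp (f := Fc \o cl)); [exact: cprof|exact: cPhi].
have ii : leb.-integrable `[a, b] (EFin \o (fun t => id (Fc (cl t)) * v t * dens t)).
  by apply: (ci idfun) => t; exact: cvg_id.
move=> /eqP; rewrite subr_eq => /eqP ->.
rewrite -RintegralZl//.
rewrite -RintegralD//; first last.
- rewrite (_ : _ \o _ = fun t => (lambda%:E * (EFin \o (fun t => Fc (cl t) * v t * dens t)%R) t)%E)//.
  exact: integrableZl.
- by apply: ci; exact: continuous_power.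
apply: eq_Rintegral => t _; rewrite /rdens /reaction /v /=; ring.
Qed.


Variables (a' b' : R).
Hypotheses (aa' : a < a') (bb' : b' < b).

Let a'0 : 0 < a'. Proof. exact: lt_trans aa'. Qed.

Let coef := flux_coef \o cl.
Let H := prim rdens \o cl.

Let cl_supp t : a' <= t <= b' -> cl t = t.
Proof.
by move=> /andP[at_ tb]; rewrite /cl clamp_id// (le_trans (ltW aa') at_) (le_trans tb (ltW bb')).
Qed.

Let continuous_coef : continuous coef.
Proof.
apply: (continuous_comp_clamp ab) => t /andP[at_ _]; have t0 : 0 < t by exact: lt_le_trans at_.
apply: cvgM.
  apply: (@continuous_comp _ _ _ (fun t : R => (Num.sqrt t)^-1) (fun x : R => x ^+ n)); last exact: exprn_continuous.
  by apply: cvgV; [rewrite gt_eqF// sqrtr_gt0|exact: sqrt_continuous].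
apply: cvgM; last exact: cvg_cst.
apply: (@continuous_comp _ _ _ (fun t : R => (1 - t) / 2) (fun x : R => x ^+ (n - 2))); last exact: exprn_continuous.
by apply: cvgM; [apply: cvgB; [exact: cvg_cst|exact: cvg_id]|exact: cvg_cst].
Qed.

Let continuous_H : continuous H.
Proof.
apply: (continuous_comp_clamp ab) => t /andP[at_ _].
apply: (@continuous_is_derive _ _ _ (rdens t)); apply: is_derive_prim; first exact: continuous_rdens.
exact: lt_le_trans at_.
Qed.

Let smooth1_flux_coef (theta : R -> R) : smooth1 theta ->
  (forall t, ~ (a' <= t <= b') -> theta t = 0) -> smooth1 (fun t => theta t * flux_coef t).
Proof.
move=> st t0; rewrite (_ : (fun t => _) =
    fun t => (Num.sqrt t)^-1 ^+ n * (((1 - t) / 2) ^+ (n - 2) / 4 * theta t)); last first.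
  by apply/funext => t; rewrite mulrC mulrA.
apply: (smooth1_sqrtV_mul n _ a'0); last first.
  by move=> t ta; rewrite t0 ?mulr0// => /andP[]; rewrite leNgt ta.
move=> k; apply: CnM; last exact: st.
apply: CnM; last exact: Cn_cst.
by apply: CnX; apply: CnM; [apply: CnB; [exact: Cn_cst|exact: Cn_id]|exact: Cn_cst].
Qed.

Let Rint_supp (f : R -> R) : (forall t, ~ (a' <= t <= b') -> f t = 0) ->
  \int[leb]_(t in `[a, b]) f t = \int[leb]_(t in `[a', b']) f t.
Proof.
move=> f0; apply: Rintegral_supp.
  by move=> t; rewrite /= !in_itv/= => /andP[at_ tb]; rewrite (le_trans (ltW aa') at_) (le_trans tb (ltW bb')).
by move=> t _; rewrite /= in_itv/= => /f0.
Qed.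

(** Integration by parts against the primitive [psi] of [theta flux_coef], an admissible test
    function thanks to the zero mean. The boundary terms vanish since [[a', b']] lies strictly
    inside [[a, b]]. *)
Let equation_flux0 (theta : R -> R) : smooth1 theta ->
  (forall t, ~ (a' <= t <= b') -> theta t = 0) ->
  \int[leb]_(t in `[a, b]) (theta t * coef t) = 0 ->
  2^-1 * \int[lebn]_(x in shell a b) (flux x * theta (nsq x)) +
  \int[leb]_(t in `[a, b]) (theta t * (coef t * H t)) = 0.
Proof.
move=> st t0 I0.
pose eta t := theta t * flux_coef t.
have seta : smooth1 eta by exact: smooth1_flux_coef.
have eta0 t : ~ (a' <= t <= b') -> eta t = 0 by move=> /t0 E; rewrite /eta E mul0r.
have etaE t : eta t = theta t * coef t.
  have [/cl_supp E|/negP/t0 E] := boolP (a' <= t <= b'); first by rewrite /coef/= E.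
  by rewrite /eta E !mul0r.
have Ieta : \int[leb]_(t in `[a', b']) eta t = 0.
  by rewrite -Rint_supp// -I0; apply: eq_Rintegral => t _; rewrite etaE.
have [spsi dpsi psi0] := smooth1_primitive seta a'0 eta0 Ieta.
have psi0' t : ~ (a <= t <= b) -> prim eta t = 0.
  move=> tab; apply: psi0 => /andP[at_ tb]; apply: tab.
  by rewrite (le_trans (ltW aa') at_) (le_trans tb (ltW bb')).
rewrite (equation_test spsi _ psi0'); last 2 first.
- exact: smooth1_continuous.
- by move=> t /dpsi D; rewrite derive1E derive_val.
have cr := continuous_rdens.
have dP t : a < t < b -> is_derive t 1 (fun t => prim eta t * prim rdens t)
    (eta t * prim rdens (cl t) + prim eta t * rdens t).
  move=> /andP[at_ tb]; have t0' : 0 < t by exact: lt_trans at_.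
  by rewrite /cl clamp_id ?ltW//; exact: is_derive1_mul (dpsi _ t0') (is_derive_prim cr t0').
have cP t : a <= t <= b -> {for t, continuous (fun t => prim eta t * prim rdens t)}.
  move=> /andP[at_ tb]; have t0' : 0 < t by exact: lt_le_trans at_.
  exact: continuous_is_derive (is_derive1_mul (dpsi _ t0') (is_derive_prim cr t0')).
have c1 : continuous (fun t => prim eta t * rdens t).
  by move=> t; apply: cvgM; [exact: smooth1_continuous spsi t|exact: cr].
have c2 : continuous (fun t => eta t * prim rdens (cl t)).
  by move=> t; apply: cvgM; [exact: smooth1_continuous seta t|exact: continuous_H].
have c3 : continuous (fun t => eta t * prim rdens (cl t) + prim eta t * rdens t).
  by move=> t; apply: cvgD; [exact: c2|exact: c1].
under [X in _ + X]eq_Rintegral do rewrite mulrA -etaE.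
rewrite addrC -RintegralD//; last 2 first.
- exact: integrable_continuous c2.
- exact: integrable_continuous c1.
rewrite /Rintegral (FTC2_segment ab dP)//; last by move=> t _; exact: c3.
rewrite !psi0 ?mul0r ?subrr// => /andP[].
- by rewrite leNgt aa'.
- by rewrite [b <= _]leNgt bb'.
Qed.

Let linear_supp (theta theta0 : R -> R) (c : R) (f : R -> R) : continuous theta -> continuous theta0 ->
  continuous f ->
  \int[leb]_(t in `[a, b]) ((theta t - c * theta0 t) * f t) =
  \int[leb]_(t in `[a, b]) (theta t * f t) - c * \int[leb]_(t in `[a, b]) (theta0 t * f t).
Proof.
move=> ct ct0 cf.
have c1 (h : R -> R) : continuous h -> leb.-integrable `[a, b] (EFin \o (fun t => h t * f t)).
  by move=> ch; apply: integrable_continuous => t; apply: cvgM; [exact: ch|exact: cf].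
rewrite -RintegralZl//; last exact: c1.
rewrite -RintegralB//; last 2 first.
- exact: c1.
- apply: (integrable_continuous a b (f := fun t => c * (theta0 t * f t))) => t.
  by apply: cvgM; [exact: cvg_cst|apply: cvgM; [exact: ct0|exact: cf]].
by apply: eq_Rintegral => t _; rewrite mulrBl mulrA.
Qed.

(* Du Bois-Reymond: the constant is the Lagrange multiplier of the constraint [int theta coef = 0] *)
Lemma flux_multiplier : exists C0, forall theta : R -> R, smooth1 theta ->
  (forall t, ~ (a' <= t <= b') -> theta t = 0) ->
  2^-1 * \int[lebn]_(x in shell a b) (flux x * theta (nsq x)) =
  \int[leb]_(t in `[a, b]) (theta t * (coef t * (C0 - H t))).
Proof.
have cH : continuous (fun t => coef t * H t).
  by move=> t; apply: cvgM; [exact: continuous_coef|exact: continuous_H].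
have E C0 (theta : R -> R) : smooth1 theta -> \int[leb]_(t in `[a, b]) (theta t * (coef t * (C0 - H t))) =
    C0 * \int[leb]_(t in `[a, b]) (theta t * coef t) - \int[leb]_(t in `[a, b]) (theta t * (coef t * H t)).
  move=> st; have ct := smooth1_continuous st.
  have ci (h : R -> R) : continuous h -> leb.-integrable `[a, b] (EFin \o (fun t => theta t * h t)).
    by move=> ch; apply: integrable_continuous => t; apply: cvgM; [exact: ct|exact: ch].
  rewrite -RintegralZl//; last exact: ci.
  rewrite -RintegralB//; last 2 first.
  - apply: (integrable_continuous a b (f := fun t => C0 * (theta t * coef t))) => t.
    by apply: cvgM; [exact: cvg_cst|apply: cvgM; [exact: ct|exact: continuous_coef]].
  - exact: ci.
  by apply: eq_Rintegral => t _; ring.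
(* If every admissible [theta] has zero mean, the constraint is void and [0] is a multiplier.
   Otherwise a reference function [t0] fixes the multiplier, and [theta] minus a multiple of [t0]
   has zero mean. *)
have [[t0 [st0 s0 I0]]|no] := pselect (exists t0 : R -> R, [/\ smooth1 t0,
    (forall t, ~ (a' <= t <= b') -> t0 t = 0) &
    \int[leb]_(t in `[a, b]) (t0 t * coef t) != 0]); last first.
  exists 0 => theta st s; rewrite E// mul0r sub0r; apply/eqP; rewrite -addr_eq0; apply/eqP.
  apply: equation_flux0 => //; apply: contrapT => /eqP I0; apply: no.
  by exists theta.
exists ((2^-1 * \int[lebn]_(x in shell a b) (flux x * t0 (nsq x)) +
  \int[leb]_(t in `[a, b]) (t0 t * (coef t * H t))) / \int[leb]_(t in `[a, b]) (t0 t * coef t)).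
move=> theta st s; rewrite E//.
set I1 := \int[leb]_(t in `[a, b]) (t0 t * coef t) in I0 *.
set I := \int[leb]_(t in `[a, b]) (theta t * coef t).
have ct := smooth1_continuous st; have ct0 := smooth1_continuous st0.
have := @equation_flux0 (fun t => theta t - I / I1 * t0 t).
rewrite (linear_supp _ ct ct0 continuous_coef) (linear_supp _ ct ct0 cH) divfK// subrr.
have -> : \int[lebn]_(x in shell a b) (flux x * (theta (nsq x) - I / I1 * t0 (nsq x))) =
    \int[lebn]_(x in shell a b) (flux x * theta (nsq x)) -
    I / I1 * \int[lebn]_(x in shell a b) (flux x * t0 (nsq x)).
  have i1 := integrable_flux_comp ct; have i2 := integrable_flux_comp ct0.
  have mS := @measurable_shell R n a b.
  rewrite -RintegralZl// -RintegralB//.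
    by apply: eq_Rintegral => x _; rewrite mulrBr mulrCA.
  rewrite (_ : _ \o _ = fun x => ((I / I1)%:E * (EFin \o (fun x => flux x * t0 (nsq x))%R) x)%E)//.
  exact: integrableZl.
move=> /(_ _ _ erefl) L; set X := \int[lebn]_(x in _) _ in L *.
set Y := \int[lebn]_(x in _) _ in L *.
set Z := \int[leb]_(t in _) (t0 t * (coef t * H t)) in L *.
set T := \int[leb]_(t in _) (theta t * (coef t * H t)) in L *.
have {}L : 2^-1 * (X - I / I1 * Y) + (T - I / I1 * Z) = 0.
  apply: L; first by move=> k; apply: CnB => //; apply: CnM => //; exact: Cn_cst.
  by move=> t tab; rewrite s// s0// mulr0 subrr.
apply/eqP; rewrite -subr_eq0 -L; apply/eqP; field.
by [].
Qed.

(** [theta] is again a difference of steps. As [k] grows, the multiplier identity becomes one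
    between integrals over []p, r]], where the flux is [2 C] times the increment of [Fc]. *)
Lemma profile_increment_ode : exists C0, forall p r, a' < p -> p < r -> r < b' ->
  C * (Fc r - Fc p) = \int[leb]_(t in `]p, r]) (coef t * (C0 - H t)).
Proof.
have [C0 HC] := flux_multiplier; exists C0 => p r ap pr rb.
have ap' := lt_trans aa' ap; have rb'' := lt_trans rb bb'.
have H1 := cvg_flux_steps n2 wg a0 ap' pr rb'' b1.
have cK : continuous (fun t => coef t * (C0 - H t)).
  move=> t; apply: cvgM; first exact: continuous_coef.
  by apply: cvgB; [exact: cvg_cst|exact: continuous_H].
have sub : `]p, r]%classic `<=` `[a, b]%classic.
  move=> t; rewrite /= !in_itv/= => /andP[pt tr].
  by rewrite (le_trans (ltW ap') (ltW pt)) (le_trans tr (ltW rb'')).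
have H2 := @cvg_Rintegral_stepk _ _ _ leb `[a, b]%classic _ id p r (measurable_itv _)
  (integrable_continuous a b cK) (@measurable_id _ _ _) (ltW pr) sub.
have -> : C * (Fc r - Fc p) = 2^-1 * \int[lebn]_(x in nsq @^-1` `]p, r]) flux x.
  rewrite -FcE ?(ltW pr)//; [by field|exact: lt_trans a0 ap'|exact: lt_trans b1].
apply: (cvg_unique _ _ H2) => //.
have H3 : 2^-1 * \int[lebn]_(x in shell a b) (flux x * (stepk k p (nsq x) - stepk k r (nsq x)))
    @[k --> \oo] --> 2^-1 * \int[lebn]_(x in nsq @^-1` `]p, r]) flux x.
  by apply: cvgM; [exact: cvg_cst|exact: H1].
apply: cvg_trans H3; apply: near_eq_cvg.
have rb0 : 0 < b' - r by rewrite subr_gt0.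
near=> k.
have kb : k.+1%:R^-1 < b' - r by near: k; exact: near_infty_natSinv_lt (PosNum rb0).
rewrite (HC (fun t => stepk k p t - stepk k r t)).
- by apply: eq_Rintegral => t _; rewrite mulrC.
- by move=> m; apply: CnB; exact: smooth1_stepk.
- move=> t /negP; rewrite negb_and -!ltNge => /orP[ta|bt].
    by rewrite !stepk_le ?subrr// ltW// (lt_trans ta)// (lt_trans ap).
  have qt : r + k.+1%:R^-1 <= t by rewrite -lerBrDl ltW// (lt_trans kb)// ltrD2r.
  by rewrite !stepk_ge ?subrr// (le_trans _ qt)// lerD2r ltW.
Unshelve. all: by end_near. Qed.

Lemma profile_ode_window : exists W : R -> R, forall t, a' < t < b' ->
  is_derive t 1 Fc (flux_coef t * W t) /\
  is_derive t 1 W (- (reaction t * Num.sqrt t ^+ (n - 2))).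
Proof.
have [C0 HC] := profile_increment_ode.
have Cp := nsq_weight_gt0 (R := R) n2.
exists (fun t => C^-1 * (C0 - prim rdens t)) => t /andP[a't tb'].
have t0 : 0 < t by exact: lt_trans a't.
have cK : continuous (fun t => coef t * (C0 - H t)).
  move=> s; apply: cvgM; first exact: continuous_coef.
  by apply: cvgB; [exact: cvg_cst|exact: continuous_H].
pose K s := coef s * (C0 - H s).
have clt s : a' < s -> s < b' -> cl s = s by move=> /ltW as_ /ltW sb; apply: cl_supp; rewrite as_.
split.
- pose p := (a' + t) / 2.
  have a'p : a' < p by rewrite /p; lra.
  have pt : p < t by rewrite /p; lra.
  have D : is_derive t 1 (fun s => C^-1 * (prim K s - prim K p) + Fc p)
      (flux_coef t * (C^-1 * (C0 - prim rdens t))).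
    have D1 := is_derive1_add (is_derive_prim cK t0) (is_derive_cst (- prim K p) t 1).
    have D2 := is_derive1_add (is_derive1_mul (is_derive_cst (C^-1) t 1) D1) (is_derive_cst (Fc p) t 1).
    apply: (is_derive_eq D2); rewrite mul0r add0r !addr0 /coef /H /= clt//; ring.
  apply: (near_eq_is_derive _ D); near=> s.
  have ps : p < s by near: s; exact: lt_nbhsr.
  have sb : s < b' by near: s; exact: lt_nbhsl.
  have := HC p s a'p ps sb.
  rewrite Rintegral_itv_obnd_cbnd; last exact: integrable_continuous_oc.
  rewrite -prim_sub ?(ltW ps)//; last exact: lt_trans a'p.
  by move=> <-; rewrite mulKf ?gt_eqF// subrK.
- have cr := continuous_rdens.
  have D := is_derive1_mul (is_derive_cst (C^-1) t 1)
    (is_derive1_add (is_derive_cst C0 t 1) (is_derive1_opp (is_derive_prim cr t0))).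
  apply: (is_derive_eq D); rewrite mul0r !add0r /rdens clt// /nsq_density.
  by rewrite /cst mulrN mulrCA mulKf// gt_eqF.
Unshelve. all: by end_near. Qed.

End window.

(** Each window brings its own constant, but since [flux_coef] does not vanish, [W] is determined by
    [Fc]: it must be [Fc' / flux_coef], so the local solutions agree. *)
Lemma profile_ode : exists W : R -> R, forall t : R, 0 < t < 1 ->
  is_derive t 1 Fc (flux_coef t * W t) /\
  is_derive t 1 W (- (reaction t * Num.sqrt t ^+ (n - 2))).
Proof.
exists (fun t => derive1 Fc t / flux_coef t) => t /andP[t0 t1].
pose a := t / 4; pose a' := t / 2; pose b' := (1 + t) / 2; pose b := (3 + t) / 4.
have a0 : 0 < a by rewrite /a; lra.
have ab : a <= b by rewrite /a /b; lra.
have b1 : b < 1 by rewrite /b; lra.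
have aa' : a < a' by rewrite /a /a'; lra.
have bb' : b' < b by rewrite /b /b'; lra.
have [W HW] := profile_ode_window a0 ab b1 aa' bb'.
have WE s : a' < s -> s < b' -> derive1 Fc s / flux_coef s = W s.
  move=> as_ sb; have s0 : 0 < s by rewrite (lt_trans (lt_trans a0 aa') as_).
  have s1 : s < 1 by rewrite (lt_trans sb)// (lt_trans bb').
  have sab : a' < s < b' by rewrite as_.
  have [D _] := HW s sab.
  rewrite derive1E derive_val mulrAC mulfV ?mul1r// gt_eqF// mulr_gt0 ?exprn_gt0 ?invr_gt0 ?sqrtr_gt0//.
  by rewrite divr_gt0// exprn_gt0// divr_gt0// subr_gt0.
have at_ : a' < t by rewrite /a'; lra.
have tb : t < b' by rewrite /b'; lra.
have tab : a' < t < b' by rewrite at_.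
have [D1 D2] := HW t tab; split; first by rewrite WE.
apply: (near_eq_is_derive _ D2); near=> s; rewrite WE//; near: s; [exact: lt_nbhsr|exact: lt_nbhsl].
Unshelve. all: by end_near. Qed.

End equation.

(** * The equation in the geodesic distance *)

Lemma nincr_is_derive (R : realType) (f df : R -> R) (a b : R) : a <= b ->
  (forall t, a <= t <= b -> is_derive t 1 f (df t)) ->
  (forall t, a <= t <= b -> df t <= 0) -> f b <= f a.
Proof.
move=> ab fdf df0.
have cf : {within `[a, b], continuous f}.
  apply: continuous_in_subspaceT => t /set_mem; rewrite /= in_itv/= => /fdf.
  exact: continuous_is_derive.
have [t|c cab E] := MVT_segment (f := f) (df := df) ab _ cf.
  by rewrite in_itv/= => /andP[/ltW at_ /ltW tb]; apply: fdf; rewrite at_.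
rewrite -subr_le0 E mulr_le0_ge0 ?subr_ge0//; apply: df0.
by move: cab; rewrite in_itv.
Qed.

Lemma le0_linear_bound (R : realType) (x K s : R) : 0 < K -> 0 < s ->
  (forall e, 0 < e -> e <= 1 -> e <= s -> x <= K * e) -> x <= 0.
Proof.
move=> K0 s0 xK; apply/ler_addgt0Pr => d d0; rewrite add0r.
pose e := Num.min (Num.min 1 s) (d / K).
have e0 : 0 < e by rewrite !lt_min ltr01 s0 divr_gt0.
have e1 : e <= 1 by rewrite !ge_min lexx.
have es : e <= s by rewrite !ge_min lexx orbT.
apply: le_trans (xK e e0 e1 es) _.
by rewrite mulrC -ler_pdivlMr// !ge_min lexx orbT.
Qed.

(** * Hyperbolic functions *)

Section hyperbolic_functions.
Context {R : realType}.
Implicit Types s k : R.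

Definition sinh s : R := (expR s - expR (- s)) / 2.
Definition cosh s : R := (expR s + expR (- s)) / 2.

Let is_derive_expRN s : is_derive s 1 (fun s => expR (- s)) (- expR (- s)).
Proof.
have := @is_derive1_comp _ expR (fun s => - s) s _ _ (is_derive_expR (- s))
  (is_derive1_opp (is_derive_id s (1 : R))).
by rewrite mulrN1.
Qed.

Lemma is_derive_sinh s : is_derive s 1 sinh (cosh s).
Proof.
have D := is_derive1_mul (is_derive1_add (is_derive_expR s) (is_derive1_opp (is_derive_expRN s)))
  (is_derive_cst (2^-1 : R) s 1).
by apply: (is_derive_eq D); rewrite opprK mulr0 addr0.
Qed.

Lemma is_derive_cosh s : is_derive s 1 cosh (sinh s).
Proof.
have D := is_derive1_mul (is_derive1_add (is_derive_expR s) (is_derive_expRN s))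
  (is_derive_cst (2^-1 : R) s 1).
by apply: (is_derive_eq D); rewrite mulr0 addr0.
Qed.

Lemma is_derive_sinhZ k s : is_derive s 1 (fun s => sinh (k * s)) (k * cosh (k * s)).
Proof.
have D := @is_derive1_comp _ sinh (fun s => k * s) s _ _ (is_derive_sinh (k * s))
  (is_derive1_mul (is_derive_cst k s 1) (is_derive_id s (1 : R))).
by apply: (is_derive_eq D); rewrite /cst mul0r add0r mulr1 mulrC.
Qed.

Lemma is_derive_coshZ k s : is_derive s 1 (fun s => cosh (k * s)) (k * sinh (k * s)).
Proof.
have D := @is_derive1_comp _ cosh (fun s => k * s) s _ _ (is_derive_cosh (k * s))
  (is_derive1_mul (is_derive_cst k s 1) (is_derive_id s (1 : R))).
by apply: (is_derive_eq D); rewrite /cst mul0r add0r mulr1 mulrC.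
Qed.

Lemma sinh_ge0 s : 0 <= s -> 0 <= sinh s.
Proof. by move=> s0; rewrite divr_ge0// subr_ge0 ler_expR; lra. Qed.

Lemma sinh_gt0 s : 0 < s -> 0 < sinh s.
Proof. by move=> s0; rewrite divr_gt0// subr_gt0 ltr_expR; lra. Qed.

Lemma cosh_gt0 s : 0 < cosh s.
Proof. by rewrite divr_gt0// addr_gt0// expR_gt0. Qed.

Lemma ler_sinh : {homo sinh : s t / s <= t}.
Proof. by move=> s t st; rewrite ler_pM2r// lerB// ler_expR; lra. Qed.

Lemma cosh_sqr s : cosh s ^+ 2 = 1 + sinh s ^+ 2.
Proof.
have E : expR s * expR (- s) = 1 by rewrite expRxMexpNx_1.
have -> : cosh s ^+ 2 = expR s * expR (- s) + sinh s ^+ 2 by rewrite /cosh /sinh; field.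
by rewrite E.
Qed.

Lemma cosh_le s : 0 <= s -> cosh s <= 1 + sinh s.
Proof.
move=> s0; have S0 := sinh_ge0 s0; rewrite -(@ler_pXn2r _ 2) ?nnegrE ?(ltW (cosh_gt0 _)) ?addr_ge0//.
have -> : (1 + sinh s) ^+ 2 = 1 + sinh s ^+ 2 + 2 * sinh s by ring.
by rewrite cosh_sqr lerDl mulr_ge0.
Qed.

(** Equivalently [k tanh s <= tanh (k s)], the concavity of [tanh]. It fixes the sign of the
    derivative in [ode_zero_dim3]. *)
Lemma sinh_cosh_comparison k s : 0 <= k <= 1 -> 0 <= s ->
  k * cosh (k * s) * sinh s <= sinh (k * s) * cosh s.
Proof.
move=> /andP[k0 k1] s0; rewrite -subr_le0.
pose f s := k * cosh (k * s) * sinh s - sinh (k * s) * cosh s.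
have f0 : f 0 = 0 by rewrite /f mulr0 /sinh oppr0 subrr mul0r mulr0 mul0r subrr.
rewrite -[leRHS]f0.
apply: (@nincr_is_derive _ f (fun s => (k ^+ 2 - 1) * (sinh (k * s) * sinh s)) _ _ s0).
- move=> t _.
  have D := is_derive1_add
    (is_derive1_mul (is_derive1_mul (is_derive_cst k t 1) (is_derive_coshZ k t)) (is_derive_sinh t))
    (is_derive1_opp (is_derive1_mul (is_derive_sinhZ k t) (is_derive_cosh t))).
  by apply: (is_derive_eq D); rewrite /cst; ring.
- move=> t /andP[t0 _]; apply: mulr_le0_ge0; first by rewrite subr_le0 expr_le1.
  by rewrite mulr_ge0//; apply: sinh_ge0 => //; exact: mulr_ge0.
Qed.

End hyperbolic_functions.

(** * Uniqueness and monotone functions for the radial equation, with [m = n - 2] and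
    [w = S^(n-1) y'] *)

Section ode.
Context {R : realType} (m : nat) (lambda q : R) (y w : R -> R).
Hypothesis m0 : (0 < m)%N.
Hypothesis qE : q = 4 / m%:R.
Hypothesis dy : forall s : R, 0 < s -> is_derive s 1 y (w s / sinh s ^+ m.+1).
Hypothesis dw : forall s : R, 0 < s ->
  is_derive s 1 w (- (sinh s ^+ m.+1 * (lambda * y s + power q (y s)))).

Let q0 : 0 < q. Proof. by rewrite qE divr_gt0// ltr0n. Qed.

(* Gronwall for [y^2 + w^2], forwards and backwards *)
Lemma ode_unique s0 : 0 < s0 -> y s0 = 0 -> w s0 = 0 -> forall s, 0 < s -> y s = 0.
Proof.
move=> s00 ys0 ws0 s sp.
pose a := Num.min s s0; pose b := Num.max s s0.
have a0 : 0 < a by rewrite lt_min sp.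
have as_ : a <= s by rewrite ge_min lexx.
have as0 : a <= s0 by rewrite ge_min lexx orbT.
have sb : s <= b by rewrite le_max lexx.
have s0b : s0 <= b by rewrite le_max lexx orbT.
have ab : a <= b by exact: le_trans sb.
have pos t : a <= t -> 0 < t by exact: lt_le_trans.
have [M HM] : exists M, forall t, a <= t <= b -> `|y t| <= M.
  have cy : continuous (y \o clamp a b).
    apply: continuous_comp_clamp => // t /andP[at_ _].
    by apply: continuous_is_derive; apply: dy; exact: pos.
  have [M HM] := bounded_continuous_segment ab cy; exists M => t tab.
  by have := HM t tab; rewrite /= clamp_id.
(* The bound [M] for [|y|] makes the nonlinearity at most [M^q |y|], so that the derivative is at
   most [2 K |y| |w| <= K (y^2 + w^2)]. *)
pose K := (sinh a ^+ m.+1)^-1 + sinh b ^+ m.+1 * (`|lambda| + M `^ q).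
pose dPhi t := 2 * (y t * w t * ((sinh t ^+ m.+1)^-1 - sinh t ^+ m.+1 * lambda) - sinh t ^+ m.+1 * (w t * power q (y t))).
have D (t : R) : 0 < t -> is_derive t 1 (fun t => y t ^+ 2 + w t ^+ 2) (dPhi t).
  move=> t0; have D := is_derive1_add (is_derive1_exp 2 (dy t0)) (is_derive1_exp 2 (dw t0)).
  by apply: (is_derive_eq D); rewrite /dPhi /= !expr1; ring.
have bnd t : a <= t <= b -> `|dPhi t| <= K * (y t ^+ 2 + w t ^+ 2).
  move=> tab; have /andP[at_ tb] := tab; have t0 := pos _ at_.
  have St : 0 < sinh t ^+ m.+1 by rewrite exprn_gt0// sinh_gt0.
  have S1 : (sinh t ^+ m.+1)^-1 <= (sinh a ^+ m.+1)^-1.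
    rewrite lef_pV2 ?posrE// ?exprn_gt0 ?sinh_gt0//.
    by rewrite lerXn2r ?nnegrE ?sinh_ge0 ?(ltW a0) ?(ltW t0)//; exact: ler_sinh.
  have S2 : sinh t ^+ m.+1 <= sinh b ^+ m.+1.
    rewrite lerXn2r ?nnegrE ?sinh_ge0 ?(ltW t0)//; last exact: ler_sinh.
    by rewrite ltW// (lt_le_trans t0).
  have gy := le_power q0 (HM t tab).
  have H : `|dPhi t| <= 2 * (K * (`|y t| * `|w t|)).
    rewrite normrM ger0_norm// ler_pM2l//.
    apply: le_trans (ler_normB _ _) _.
    have -> : K * (`|y t| * `|w t|) = (`|y t| * `|w t|) * ((sinh a ^+ m.+1)^-1 + sinh b ^+ m.+1 * `|lambda|) +
        sinh b ^+ m.+1 * (`|w t| * (M `^ q * `|y t|)) by rewrite /K; ring.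
    apply: lerD.
      rewrite normrM normrM ler_wpM2l ?mulr_ge0//.
      apply: le_trans (ler_normB _ _) _; apply: lerD.
        by rewrite ger0_norm// invr_ge0 ltW.
      by rewrite normrM ger0_norm ?(ltW St)// ler_wpM2r.
    rewrite normrM ger0_norm ?(ltW St)//; apply: ler_pM => //; first exact: ltW.
    by rewrite normrM ler_wpM2l.
  apply: le_trans H _; rewrite mulrCA ler_wpM2l//.
    rewrite addr_ge0 ?invr_ge0 ?exprn_ge0 ?sinh_ge0 ?(ltW a0)//.
    rewrite mulr_ge0 ?addr_ge0 ?powR_ge0// exprn_ge0// sinh_ge0// (le_trans (ltW a0))//.
  rewrite -subr_ge0 -(real_normK (num_real (y t))) -(real_normK (num_real (w t))).
  rewrite (_ : _ - _ = (`|y t| - `|w t|) ^+ 2) ?sqr_ge0//; ring.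
have Phi0 : y s0 ^+ 2 + w s0 ^+ 2 = 0 by rewrite ys0 ws0 !expr0n addr0.
(* With [k = K] the product is nondecreasing, which carries the zero at [s0] backwards; with
   [k = - K] it is nonincreasing, which carries it forwards. *)
have Dk (k t : R) : 0 < t -> is_derive t 1 (fun t => (y t ^+ 2 + w t ^+ 2) * expR (k * t))
    ((dPhi t + k * (y t ^+ 2 + w t ^+ 2)) * expR (k * t)).
  move=> t0.
  have E := @is_derive1_comp _ expR (fun s => k * s) t _ _ (is_derive_expR (k * t))
    (is_derive1_mul (is_derive_cst k t 1) (is_derive_id t (1 : R))).
  have H := is_derive1_mul (D t t0) E.
  by apply: (is_derive_eq H); rewrite /cst /=; ring.
have Ps0 : y s ^+ 2 + w s ^+ 2 <= 0.
  have [ss0|s0s] := leP s s0.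
    have : - ((y s0 ^+ 2 + w s0 ^+ 2) * expR (K * s0)) <= - ((y s ^+ 2 + w s ^+ 2) * expR (K * s)).
      apply: (nincr_is_derive (f := fun t => - ((y t ^+ 2 + w t ^+ 2) * expR (K * t))) ss0).
        move=> t /andP[st _]; apply: is_derive1_opp (Dk _ _ _); exact: lt_le_trans st.
      move=> t /andP[st ts0]; rewrite oppr_le0 mulr_ge0 ?(ltW (expR_gt0 _))//.
      have := bnd t; rewrite (le_trans as_ st) (le_trans ts0 s0b) => /(_ isT).
      by rewrite ler_norml => /andP[]; rewrite lerNl -subr_ge0 opprK addrC.
    by rewrite Phi0 mul0r oppr0 oppr_ge0 pmulr_lle0// expR_gt0.
  have : (y s ^+ 2 + w s ^+ 2) * expR (- K * s) <= (y s0 ^+ 2 + w s0 ^+ 2) * expR (- K * s0).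
    apply: (nincr_is_derive (f := fun t => (y t ^+ 2 + w t ^+ 2) * expR (- K * t)) (ltW s0s)).
      move=> t /andP[st _]; apply: Dk; exact: lt_le_trans st.
    move=> t /andP[st ts0]; rewrite mulr_le0_ge0 ?(ltW (expR_gt0 _))//.
    have := bnd t; rewrite (le_trans as0 st) (le_trans ts0 sb) => /(_ isT).
    by rewrite ler_norml => /andP[_]; rewrite mulNr subr_le0.
  by rewrite Phi0 mul0r pmulr_lle0// expR_gt0.
apply/eqP; rewrite -sqrf_eq0; apply/eqP/le_anti; rewrite sqr_ge0 andbT.
by apply: le_trans Ps0; rewrite lerDl sqr_ge0.
Qed.

Hypothesis near0 : forall e, 0 < e -> exists s,
  [/\ 0 < s <= e, sinh s <= e, sinh s ^+ m * y s ^+ 2 <= e & w s ^+ 2 <= e * sinh s ^+ m].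

(* [p] is critical: [S^n |y|^(p+1) = (S^(n-2) y^2)^(n/(n-2))] with [n = m + 2], [p + 1 = q + 2]. *)
Lemma nonlinear_small s : 0 < s -> sinh s ^+ m * y s ^+ 2 <= 1 ->
  sinh s ^+ 2 * power_prim q (y s) <= y s ^+ 2.
Proof.
move=> s0 H; have S0 := sinh_gt0 s0; have mp : 0 < m%:R :> R by rewrite ltr0n.
have H1 : sinh s ^+ 2 * `|y s| `^ q <= 1.
  have : (sinh s ^+ m * y s ^+ 2) `^ (2 / m%:R) <= 1 `^ (2 / m%:R).
    have A0 : 0 <= 2 / m%:R :> R by rewrite divr_ge0// ltW.
    have B0 : 0 <= sinh s ^+ m * y s ^+ 2 by rewrite mulr_ge0 ?sqr_ge0// exprn_ge0// ltW.
    by apply: ge0_ler_powR; rewrite ?nnegrE.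
  have S0m : 0 <= sinh s ^+ m by rewrite exprn_ge0// ltW.
  rewrite powR1 (powRM _ S0m (sqr_ge0 (y s))) -(real_normK (num_real (y s))).
  rewrite -!powR_mulrn ?(ltW S0)// -!powRrM.
  rewrite (_ : m%:R * (2 / m%:R) = 2); last by field; rewrite gt_eqF.
  by rewrite (_ : 2 * (2 / m%:R) = q)// qE; field; rewrite gt_eqF.
rewrite /power_prim powRD; last by rewrite gt_eqF ?addr_gt0.
rewrite powR_mulrn// real_normK ?num_real//.
have -> : sinh s ^+ 2 * (`|y s| `^ q * y s ^+ 2 / (q + 2)) =
    (sinh s ^+ 2 * `|y s| `^ q) * ((q + 2)^-1) * y s ^+ 2 by ring.
have q2 : 0 < q + 2 by rewrite addr_gt0.
rewrite ler_piMl ?sqr_ge0// mulr_ile1//.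
- by apply: mulr_ge0; [exact: sqr_ge0|exact: powR_ge0].
- by rewrite invr_ge0 ltW.
- by rewrite invf_le1//; move: q0; lra.
Qed.

(** The opposite powers of [sinh s] in the two hypotheses cancel in [y^2 w^2]. *)
Lemma mul_small s e : 0 < s -> 0 <= e -> sinh s ^+ m * y s ^+ 2 <= e -> w s ^+ 2 <= e * sinh s ^+ m ->
  `|y s * w s| <= e.
Proof.
move=> s0 e0 H1 H2; have S0 : 0 < sinh s ^+ m by rewrite exprn_gt0// sinh_gt0.
rewrite -(@ler_pXn2r _ 2) ?nnegrE// real_normK ?num_real// exprMn.
have : y s ^+ 2 * w s ^+ 2 <= y s ^+ 2 * (e * sinh s ^+ m) by rewrite ler_wpM2l ?sqr_ge0.
move/le_trans; apply; rewrite mulrCA mulrC [X in X * e]mulrC expr2.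
by rewrite ler_wpM2r.
Qed.

(** [P] is the Pohozaev function written with [w] instead of [y']. Its coefficient
    [(lambda - m/2)/2] is the one cancelling the terms in [y w], where [m/2] comes from
    differentiating [cosh]. At [s0] only the term in [w^2] survives, and it has a positive
    coefficient. *)
Lemma ode_zero_low s0 : lambda <= (m%:R + 2) * m%:R / 4 -> 0 < s0 -> y s0 = 0 -> w s0 = 0.
Proof.
move=> hl s00 ys0; have mp : 0 < m%:R :> R by rewrite ltr0n.
pose G := power_prim q.
pose P s := w s ^+ 2 * (2 * sinh s ^+ m)^-1 + m%:R / 2 * cosh s * (y s * w s)
  + (lambda - m%:R / 2) / 2 * (sinh s ^+ m.+2 * y s ^+ 2) + sinh s ^+ m.+2 * G (y s).
have dP (s : R) : 0 < s -> is_derive s 1 P (sinh s ^+ m.+1 * cosh s * (lambda - (m%:R + 2) * m%:R / 4) * y s ^+ 2).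
  move=> sp; have Sp := sinh_gt0 sp; have dys := dy sp; have dws := dw sp.
  have dS := is_derive_sinh s; have dC := is_derive_cosh s.
  have dSm := is_derive1_exp m dS.
  have dSm2 := is_derive1_exp m.+2 dS.
  have Z0 : 2 * sinh s ^+ m != 0 by rewrite mulf_neq0// expf_neq0// gt_eqF.
  have dV := is_deriveV (f := fun s => 2 * sinh s ^+ m) Z0 (is_derive1_mul (is_derive_cst (2 : R) s 1) dSm).
  have dG : is_derive s 1 (fun s => G (y s)) (power q (y s) * (w s / sinh s ^+ m.+1)).
    exact: (is_derive1_comp (is_derive_power_prim q0 (y s)) dys).
  have cc (c : R) := is_derive_cst c s 1.
  have D := is_derive1_add (is_derive1_add (is_derive1_add
    (is_derive1_mul (is_derive1_exp 2 dws) dV)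
    (is_derive1_mul (is_derive1_mul (cc (m%:R / 2)) dC) (is_derive1_mul dys dws)))
    (is_derive1_mul (cc ((lambda - m%:R / 2) / 2)) (is_derive1_mul dSm2 (is_derive1_exp 2 dys))))
    (is_derive1_mul dSm2 dG).
  apply: (is_derive_eq D); rewrite /cst /GRing.scale /= !mul0r !add0r !expr1.
  have Gy := powerE q0 (y s); rewrite -/(G (y s)) in Gy.
  (* [q + 2 = (2 m + 4) / m] expresses criticality; the nonlinear terms cancel for this value. *)
  have GE : G (y s) = m%:R / (2 * m%:R + 4) * (y s * power q (y s)).
    by rewrite Gy qE; field; rewrite gt_eqF//= gt_eqF// addr_gt0// mulr_gt0.
  rewrite GE; clear dG dV Z0 dSm dSm2 dys dws GE Gy D.
  (* Writing [m = k + 1] turns the exponent [m.-1], produced by differentiating [sinh^m], into a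
     power that [field] can treat. *)
  case: m m0 mp => // k _ kp.
  rewrite /= !exprS; set Z := sinh s ^+ k; set S := sinh s in Sp *; set g := power q _.
  have Z0 : Z != 0 by rewrite expf_neq0// gt_eqF.
  have S0 : S != 0 by rewrite gt_eqF.
  rewrite -[k.+3]addn2 -[k.+1]addn1 !natrD.
  have k1 : (k%:R : R) + 1 != 0 by rewrite natr1.
  have k2 : (2 : R) * (k%:R + 1) + 4 != 0 by rewrite natr1 gt_eqF// addr_gt0// mulr_gt0.
  by field; rewrite Z0 S0 k2.
have mono s : 0 < s -> s <= s0 -> P s0 <= P s.
  move=> sp ss0.
  apply: (@nincr_is_derive _ P (fun s => sinh s ^+ m.+1 * cosh s * (lambda - (m%:R + 2) * m%:R / 4) * y s ^+ 2) _ _ ss0) => [t /andP[st _]|t /andP[st _]].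
    apply: dP; exact: lt_le_trans st.
  have tp : 0 < t by exact: lt_le_trans st.
  rewrite mulr_le0_ge0 ?sqr_ge0// mulr_ge0_le0 ?subr_le0//.
  by rewrite mulr_ge0 ?(ltW (cosh_gt0 _))// exprn_ge0// sinh_ge0// ltW.
(* The four terms of [P] contribute [1], [m], the absolute value and [1] to the constant;
   [sinh s <= 1] provides [cosh s <= 2]. *)
have small e : 0 < e -> e <= 1 -> e <= s0 -> P s0 <= (2 + m%:R + `|(lambda - m%:R / 2) / 2|) * e.
  move=> e0 e1 es0; have [s [/andP[sp se] Se H1 H2]] := near0 e0.
  apply: le_trans (mono s sp (le_trans se es0)) _.
  have Sp := sinh_gt0 sp; have Z0 : 0 < sinh s ^+ m by rewrite exprn_gt0.
  have S1 : sinh s ^+ 2 <= 1 by rewrite exprn_ile1 ?(ltW Sp)// (le_trans Se).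
  have T1 : w s ^+ 2 * (2 * sinh s ^+ m)^-1 <= e.
    rewrite ler_pdivrMr ?mulr_gt0//; apply: le_trans H2 _.
    by rewrite ler_pM2l// ler_peMl ?(ltW Z0)// ler1n.
  have T2 : m%:R / 2 * cosh s * (y s * w s) <= m%:R * e.
    have yw := mul_small sp (ltW e0) H1 H2.
    have C2 : cosh s <= 2.
      by apply: le_trans (cosh_le (ltW sp)) _; move: Se e1; lra.
    apply: le_trans (ler_norm _) _; rewrite normrM.
    apply: ler_pM => //.
    rewrite ger0_norm; last by rewrite mulr_ge0 ?(ltW (cosh_gt0 _))// divr_ge0// ltW.
    by rewrite -mulrA ler_piMr ?(ltW mp)//; lra.
  have Zy : sinh s ^+ m.+2 * y s ^+ 2 <= e.
    rewrite -[m.+2]addn2 exprD mulrAC; apply: le_trans H1.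
    by rewrite ler_piMr// mulr_ge0 ?sqr_ge0// ltW.
  have Zy0 : 0 <= sinh s ^+ m.+2 * y s ^+ 2 by rewrite mulr_ge0 ?sqr_ge0// exprn_ge0// ltW.
  have T3 : (lambda - m%:R / 2) / 2 * (sinh s ^+ m.+2 * y s ^+ 2) <= `|(lambda - m%:R / 2) / 2| * e.
    by apply: le_trans (ler_norm _) _; rewrite normrM (ger0_norm Zy0) ler_wpM2l.
  have T4 : sinh s ^+ m.+2 * G (y s) <= e.
    have := nonlinear_small sp (le_trans H1 e1) => N.
    rewrite -[m.+2]addn2 exprD -mulrA; apply: le_trans H1.
    by rewrite ler_pM2l.
  have -> : (2 + m%:R + `|(lambda - m%:R / 2) / 2|) * e = e + m%:R * e + `|(lambda - m%:R / 2) / 2| * e + e.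
    ring.
  by rewrite /P; apply: lerD T4; apply: lerD T3; exact: lerD.
set K := 2 + m%:R + _ in small.
have K0 : 0 < K by rewrite /K ltr_wpDr// addr_gt0.
have P0 : P s0 <= 0 by exact: le0_linear_bound K0 s00 small.
move: P0; rewrite /P ys0 mul0r mulr0 addr0 expr0n mulr0 mulr0 addr0.
have -> : G 0 = 0 by rewrite /G /power_prim normr0 powR0 ?mul0r// gt_eqF ?addr_gt0.
rewrite mulr0 addr0 pmulr_lle0; last by rewrite invr_gt0 mulr_gt0// exprn_gt0// sinh_gt0.
by move=> w0; apply/eqP; rewrite -sqrf_eq0; apply/eqP/le_anti; rewrite w0 sqr_ge0.
Qed.


(** The substitution [v = S y] removes the first-order term: [v'' = mu v - S |y|^4 y]. For the
    multiplier [a v' - a' v / 2], all linear terms form an exact derivative once [a'' = 4 mu a],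
    hence [a = sinh (k s)] with [k^2 = 4 mu]. There remains the nonlinear term, of sign given by
    [sinh_cosh_comparison]. *)
Lemma ode_zero_dim3 s0 : m = 1%N -> 3 / 4 < lambda < 1 -> 0 < s0 -> y s0 = 0 -> w s0 = 0.
Proof.
move=> m1 /andP[l34 l1] s00 ys0.
pose mu := 1 - lambda; pose k := 2 * Num.sqrt mu.
have mu0 : 0 < mu by rewrite subr_gt0.
have k0 : 0 < k by rewrite mulr_gt0// sqrtr_gt0.
have k2 : k ^+ 2 = 4 * mu by rewrite exprMn sqr_sqrtr ?ltW//; ring.
have k1 : k <= 1 by rewrite -(@ler_pXn2r _ 2) ?nnegrE ?(ltW k0)// k2 /mu; lra.
have dy' (s : R) : 0 < s -> is_derive s 1 y (w s / sinh s ^+ 2).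
  by move=> sp; have := dy sp; rewrite m1.
have dw' (s : R) : 0 < s -> is_derive s 1 w (- (sinh s ^+ 2 * (lambda * y s + power q (y s)))).
  by move=> sp; have := dw sp; rewrite m1.
pose G := power_prim q.
pose a s := sinh (k * s); pose a' s := k * cosh (k * s).
pose v s := sinh s * y s; pose v' s := cosh s * y s + w s * (sinh s)^-1.
pose P s := a s / 2 * v' s ^+ 2 + (- (1 / 2) * a' s * (v s * v' s) + mu / 2 * a s * v s ^+ 2)
  + a s * (sinh s ^+ 2 * G (y s)).
have dP (s : R) : 0 < s -> is_derive s 1 P (4 * (a' s * sinh s - a s * cosh s) * (sinh s * G (y s))).
  move=> sp; have Sp := sinh_gt0 sp; have S0 : sinh s != 0 by rewrite gt_eqF.
  have dys := dy' s sp; have dws := dw' s sp.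
  have dS := is_derive_sinh s; have dC := is_derive_cosh s.
  have cc (c : R) := is_derive_cst c s 1.
  have da : is_derive s 1 a (a' s) by exact: is_derive_sinhZ.
  (* [a'' = 4 mu a] is what cancels the terms in [v v']. *)
  have da' : is_derive s 1 a' (4 * mu * a s).
    apply: (is_derive_eq (is_derive1_mul (cc k) (is_derive_coshZ k s))).
    by rewrite mul0r add0r /cst mulrA -expr2 k2.
  have dv : is_derive s 1 v (v' s).
    apply: (is_derive_eq (is_derive1_mul dS dys)).
    by rewrite /v'; congr (_ + _); field.
  have dv' : is_derive s 1 v' (mu * v s - sinh s * power q (y s)).
    have dV := is_deriveV S0 dS.
    apply: (is_derive_eq (is_derive1_add (is_derive1_mul dC dys) (is_derive1_mul dws dV))).
    by rewrite /GRing.scale/= /v /mu; field.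
  have dG : is_derive s 1 (fun s => G (y s)) (power q (y s) * (w s / sinh s ^+ 2)).
    exact: (is_derive1_comp (is_derive_power_prim q0 (y s)) dys).
  have D := is_derive1_add (is_derive1_add
    (is_derive1_mul (is_derive1_mul da (cc (2^-1 : R))) (is_derive1_exp 2 dv'))
    (is_derive1_add
      (is_derive1_mul (is_derive1_mul (cc (- (1 / 2) : R)) da') (is_derive1_mul dv dv'))
      (is_derive1_mul (is_derive1_mul (cc (mu / 2)) da) (is_derive1_exp 2 dv))))
    (is_derive1_mul da (is_derive1_mul (is_derive1_exp 2 dS) dG)).
  apply: (is_derive_eq D); rewrite /cst /= !mul0r !mulr0 !add0r !addr0 !expr1.
  have Gy := powerE q0 (y s); rewrite -/(G (y s)) in Gy.
  have GE : G (y s) = y s * power q (y s) / 6.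
    by rewrite Gy qE m1; field.
  rewrite GE /v' /v; move: (a s) (a' s) (power q (y s)) (y s) (w s) (cosh s) => A A' g Y W C.
  by field.
have a0 (s : R) : 0 < s -> 0 < a s by move=> sp; apply: sinh_gt0; exact: mulr_gt0.
have mono s : 0 < s -> s <= s0 -> P s0 <= P s.
  move=> sp ss0.
  apply: (@nincr_is_derive _ P (fun s => 4 * (a' s * sinh s - a s * cosh s) * (sinh s * G (y s))) _ _ ss0) => [t /andP[st _]|t /andP[st _]].
    apply: dP; exact: lt_le_trans st.
  have tp : 0 < t by exact: lt_le_trans st.
  apply: mulr_le0_ge0; last by rewrite mulr_ge0 ?power_prim_ge0// ltW// sinh_gt0.
  rewrite mulr_ge0_le0// subr_le0; apply: sinh_cosh_comparison; last exact: ltW.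
  by rewrite (ltW k0).
(* The terms are at most [5 e], [3 e], [mu e] and [e]; the constant leaves a slack of [e]. *)
have small e : 0 < e -> e <= 1 -> e <= s0 -> P s0 <= (10 + mu) * e.
  move=> e0 e1 es0; have [s [/andP[sp se] Se H1 H2]] := near0 e0.
  apply: le_trans (mono s sp (le_trans se es0)) _.
  have Sp := sinh_gt0 sp; have yw := mul_small sp (ltW e0) H1 H2.
  have N := nonlinear_small sp (le_trans H1 e1).
  rewrite m1 expr1 in H1 H2 N.
  have C2 t : 0 <= t -> t <= s -> cosh t <= 2.
    move=> t0 ts; apply: le_trans (cosh_le t0) _.
    by have := ler_sinh ts; move: Se e1; lra.
  have ks : k * s <= s by rewrite ger_pMl.
  have ks0 : 0 <= k * s by rewrite mulr_ge0 ?ltW.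
  have aS : a s <= sinh s by exact: ler_sinh.
  have C2s := C2 s (ltW sp) (lexx s).
  have Cp := cosh_gt0 s.
  have ap := a0 s sp.
  have a'2 : a' s <= 2.
    by rewrite /a' -[leRHS]mul1r ler_pM ?(ltW k0) ?(ltW (cosh_gt0 _))//; exact: C2.
  have a'0 : 0 <= a' s by rewrite mulr_ge0 ?ltW// cosh_gt0.
  have w2 : w s ^+ 2 / sinh s <= e by rewrite ler_pdivrMr.
  have Y2 : 0 <= sinh s * y s ^+ 2 by rewrite mulr_ge0 ?sqr_ge0// ltW.
  have CC : cosh s ^+ 2 <= 4.
    by rewrite (_ : 4 = 2 ^+ 2) ?lerXn2r ?nnegrE ?(ltW Cp)//; ring.
  have T1 : a s / 2 * v' s ^+ 2 <= 5 * e.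
    apply: (@le_trans _ _ (sinh s / 2 * (2 * (cosh s ^+ 2 * y s ^+ 2 + (w s / sinh s) ^+ 2)))).
      apply: ler_pM; rewrite ?sqr_ge0//; [by rewrite divr_ge0// ltW|by rewrite ler_pM2r|].
      rewrite -subr_ge0 (_ : _ - _ = (cosh s * y s - w s * (sinh s)^-1) ^+ 2) ?sqr_ge0//.
      by rewrite /v'; ring.
    have -> : sinh s / 2 * (2 * (cosh s ^+ 2 * y s ^+ 2 + (w s / sinh s) ^+ 2)) =
        cosh s ^+ 2 * (sinh s * y s ^+ 2) + w s ^+ 2 / sinh s.
      by field; rewrite gt_eqF.
    rewrite (_ : 5 * e = 4 * e + e); last by ring.
    by apply: lerD => //; apply: ler_pM => //; exact: sqr_ge0.
  have T2 : - (1 / 2) * a' s * (v s * v' s) <= 3 * e.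
    have -> : v s * v' s = cosh s * (sinh s * y s ^+ 2) + y s * w s.
      by rewrite /v /v'; field; rewrite gt_eqF.
    have B : `|cosh s * (sinh s * y s ^+ 2) + y s * w s| <= 3 * e.
      rewrite (_ : 3 * e = 2 * e + e); last by ring.
      apply: le_trans (ler_normD _ _) _; apply: lerD => //.
      by rewrite (ger0_norm (mulr_ge0 (ltW Cp) Y2)); apply: ler_pM => //; exact: ltW.
    apply: le_trans (ler_norm _) _; rewrite normrM -[leRHS]mul1r; apply: ler_pM => //.
    rewrite normrM normrN ger0_norm ?divr_ge0// ger0_norm//; lra.
  have T3 : mu / 2 * a s * v s ^+ 2 <= mu * e.
    rewrite -mulrA -mulrA ler_pM2l//.
    apply: (@le_trans _ _ (2^-1 * (1 * (1 * e)))); last by rewrite !mul1r; lra.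
    rewrite ler_pM2l ?invr_gt0//.
    have S1 : sinh s <= 1 by exact: le_trans e1.
    apply: ler_pM; rewrite ?sqr_ge0 ?(ltW ap)//; first exact: le_trans aS _.
    rewrite /v exprMn expr2 -mulrA; apply: ler_pM => //; exact: ltW.
  have T4 : a s * (sinh s ^+ 2 * G (y s)) <= e.
    apply: le_trans H1; apply: ler_pM => //; first exact: ltW.
    by rewrite mulr_ge0 ?sqr_ge0// power_prim_ge0.
  rewrite /P; have -> : (10 + mu) * e = 5 * e + (3 * e + mu * e) + (e + e) by ring.
  apply: lerD; first by apply: lerD => //; exact: lerD.
  by rewrite (le_trans T4)// lerDl ltW.
set K := 10 + mu in small.
have K0 : 0 < K by rewrite /K addr_gt0.
have P0 : P s0 <= 0 by exact: le0_linear_bound K0 s00 small.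
have Sp := sinh_gt0 s00.
move: P0; rewrite /P /v /v' ys0 !mulr0 !mul0r add0r mulr0 expr0n/= mulr0 !addr0.
have -> : G 0 = 0 by rewrite /G /power_prim normr0 powR0 ?mul0r// gt_eqF ?addr_gt0.
rewrite !mulr0 addr0 pmulr_rle0; last by rewrite divr_gt0// a0.
move=> w0; have : (w s0 / sinh s0) ^+ 2 == 0 by rewrite eq_le w0 sqr_ge0.
by rewrite sqrf_eq0 mulf_eq0 invr_eq0 (gt_eqF Sp) orbF => /eqP.
Qed.

End ode.

(** * The profile near the origin *)

Lemma cvg_contraction (R : realType) (X d : nat -> R) (rho : R) : 0 <= rho < 1 ->
  (forall k, 0 <= X k) -> (forall k, X k.+1 <= rho * X k + d k) ->
  d @ \oo --> (0 : R) -> X @ \oo --> (0 : R).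
Proof.
move=> /andP[r0 r1] X0 HX d0; apply/cvgrPdist_le => e e0.
have r10 : 0 < 1 - rho by rewrite subr_gt0.
have e1 : 0 < e * (1 - rho) / 2 by rewrite divr_gt0 ?mulr_gt0.
have [N _ HN] : \forall k \near \oo, d k <= e * (1 - rho) / 2.
  by near=> k; apply: le_trans (ler_norm _) _; near: k; exact: cvgr0_norm_le.
(* [e / 2] is the fixed point of [x |-> rho x + e (1 - rho) / 2]. *)
have B j : X (N + j)%N <= rho ^+ j * X N + e / 2.
  elim: j => [|j IH]; first by rewrite addn0 expr0 mul1r lerDl divr_ge0// ltW.
  rewrite addnS; apply: le_trans (HX _) _.
  have -> : rho ^+ j.+1 * X N + e / 2 = rho * (rho ^+ j * X N + e / 2) + e * (1 - rho) / 2.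
    by rewrite exprS; field.
  by apply: lerD; [exact: ler_wpM2l|exact: HN (leq_addr _ _)].
have g0 : rho ^+ j * X N @[j --> \oo] --> (0 : R).
  rewrite -[X in _ --> X](mul0r (X N)); apply: cvgM; last exact: cvg_cst.
  by apply: cvg_expr; rewrite ger0_norm.
have [M _ HM] : \forall j \near \oo, rho ^+ j * X N <= e / 2.
  near=> k; apply: le_trans (ler_norm _) _; near: k.
  by apply: cvgr0_norm_le => //; rewrite divr_gt0.
exists (N + M)%N => // k /= NMk; rewrite sub0r normrN ger0_norm//.
rewrite -(@subnKC N k) ?(leq_trans (leq_addr _ _) NMk)//.
apply: le_trans (B _) _; rewrite [leRHS](splitr e) lerD2r; apply: HM => /=.
by rewrite leq_subRL ?(leq_trans (leq_addr _ _) NMk).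
Unshelve. all: by end_near. Qed.

Lemma halving_sequence (R : realType) : exists r : nat -> R,
  [/\ forall k, 0 < r k, forall k, r k.+1 = r k / 2, forall k, r k <= 2^-1 & r @ \oo --> (0 : R)].
Proof.
have h1 : (2^-1 : R) < 1 by rewrite invf_lt1// ltr1n.
exists (fun k => 2^-1 ^+ k.+1); split=> [k|k|k|].
- by rewrite exprn_gt0// invr_gt0.
- by rewrite exprSr.
- by rewrite exprS ler_piMr ?invr_ge0// exprn_ile1 ?invr_ge0// ltW.
- have H : (2^-1 : R) ^+ k @[k --> \oo] --> (0 : R).
    by apply: cvg_expr; rewrite ger0_norm ?invr_ge0.
  by have := H; rewrite -(cvg_shiftS (fun k => (2^-1 : R) ^+ k)).
Qed.

Section origin.
Context {R : realType} {m : nat}.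
Notation leb := (@lebesgue_measure R).
Notation lebn := (@lebesgue_row R m.+2).
Hypothesis m0 : (0 < m)%N.
Let n2 : (2 < m.+2)%N := m0.
Variables (u : 'rV[R]_m.+2 -> R) (g : 'rV[R]_m.+2 -> 'rV[R]_m.+2) (Fc W : R -> R).
Hypothesis wg : weak_gradient u g.
Hypothesis energy : lebn.-integrable hball (fun x => (dotr (g x) (g x))%:E).
Local Notation C := (nsq_weight (R := R) (n := m.+2)).
Hypothesis FcE : forall a b : R, 0 < a -> a <= b -> b < 1 ->
  2 * C * (Fc b - Fc a) = \int[lebn]_(x in nsq @^-1` `]a, b]) radial_flux g x.
Hypothesis dFc : forall t : R, 0 < t < 1 -> is_derive t 1 Fc (flux_coef (n := m.+2) t * W t).

Variable r : nat -> R.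
Hypotheses (r_gt0 : forall k, 0 < r k) (rS : forall k, r k.+1 = r k / 2).
Hypotheses (r_le : forall k, r k <= 2^-1) (cvg_r : r @ \oo --> (0 : R)).

Let sqr_r k : r k ^+ 2 <= 4^-1.
Proof.
have <- : 2^-1 ^+ 2 = 4^-1 :> R by field.
by rewrite lerXn2r ?nnegrE ?(ltW (r_gt0 k)) ?invr_ge0.
Qed.

(* [flux_bound] with [s] scaled so that both terms have the order of [r^(-(n-2)/2)], [r = r k.+1] *)
Let osc_bound k t s : r k.+1 ^+ 2 <= t <= r k ^+ 2 -> 0 < s ->
  2 * C * (Num.sqrt (r k.+1 ^+ m) * `|Fc t - Fc (r k.+1 ^+ 2)|) <=
  s * flux_energy g (r k ^+ 2) + 3 * 2 ^+ m.+2 * C / s.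
Proof.
move=> /andP[rt tr] s0; have C0 := nsq_weight_gt0 (R := R) n2.
set p := r k.+1; have p0 : 0 < p by exact: r_gt0.
have rp : r k = 2 * p by rewrite /p rS; field.
set K := Num.sqrt _; have K0 : 0 < K by rewrite sqrtr_gt0 exprn_gt0.
have K2 : K ^+ 2 = p ^+ m by rewrite sqr_sqrtr// exprn_ge0// ltW.
have t1 : t < 1 by apply: le_lt_trans tr _; apply: le_lt_trans (sqr_r k) _; rewrite invf_lt1// ltr1n.
have t0 : 0 < t by apply: lt_le_trans rt; rewrite exprn_gt0.
have sp : 0 < s * p ^+ m.+2 / K by rewrite divr_gt0// mulr_gt0// exprn_gt0.
have B := profile_bound n2 wg energy FcE (exprn_gt0 2 p0) rt t1 sp.
rewrite sqrtr_sqr (gtr0_norm p0) in B.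
have -> : 2 * C * (K * `|Fc t - Fc (p ^+ 2)|) = K * (2 * C * `|Fc t - Fc (p ^+ 2)|) by ring.
apply: (@le_trans _ _ (K * (p^-1 ^+ m.+2 * (s * p ^+ m.+2 / K * flux_energy g t +
    (s * p ^+ m.+2 / K)^-1 * (C * Num.sqrt t ^+ m.+2 * (t - p ^+ 2)))))).
  by rewrite ler_pM2l.
have -> : K * (p^-1 ^+ m.+2 * (s * p ^+ m.+2 / K * flux_energy g t +
    (s * p ^+ m.+2 / K)^-1 * (C * Num.sqrt t ^+ m.+2 * (t - p ^+ 2)))) =
    s * flux_energy g t + K ^+ 2 / (s * p ^+ m.+2) / p ^+ m.+2 * (C * Num.sqrt t ^+ m.+2 * (t - p ^+ 2)).
  rewrite exprVn; set Z := p ^+ m.+2.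
  have Z0 : Z != 0 by rewrite expf_neq0// gt_eqF.
  by field; rewrite Z0 !gt_eqF.
apply: lerD.
  rewrite ler_pM2l//; apply: (flux_energy_nd energy tr).
  by apply: le_lt_trans (sqr_r k) _; rewrite invf_lt1// ltr1n.
have T : C * Num.sqrt t ^+ m.+2 * (t - p ^+ 2) <= C * (2 ^+ m.+2 * p ^+ m.+2) * (3 * p ^+ 2).
  apply: ler_pM.
  - by rewrite mulr_ge0 ?exprn_ge0 ?sqrtr_ge0// ltW.
  - by rewrite subr_ge0.
  - rewrite ler_pM2l// -exprMn lerXn2r ?nnegrE ?sqrtr_ge0 ?mulr_ge0 ?(ltW p0)//.
    by rewrite -rp -[leRHS](gtr0_norm (r_gt0 k)) -sqrtr_sqr ler_wsqrtr.
  - by move: tr; rewrite rp; lra.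
apply: (@le_trans _ _ (K ^+ 2 / (s * p ^+ m.+2) / p ^+ m.+2 * (C * (2 ^+ m.+2 * p ^+ m.+2) * (3 * p ^+ 2)))).
  apply: ler_wpM2l => //; apply: divr_ge0; last by rewrite exprn_ge0// ltW.
  by apply: divr_ge0; rewrite ?sqr_ge0// mulr_ge0 ?exprn_ge0 ?(ltW s0) ?(ltW p0).
rewrite K2 -[m.+2]addn2 !exprD le_eqVlt; apply/orP; left; apply/eqP.
set Z := p ^+ m; set T2 := 2 ^+ m.
have Z0 : Z != 0 by rewrite expf_neq0// gt_eqF.
by field; rewrite Z0 !gt_eqF.
Qed.

Let osc_small e : 0 < e -> \forall k \near \oo, forall t, r k.+1 ^+ 2 <= t <= r k ^+ 2 ->
  Num.sqrt (r k.+1 ^+ m) * `|Fc t - Fc (r k.+1 ^+ 2)| <= e.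
Proof.
move=> e0; have C0 := nsq_weight_gt0 (R := R) n2.
have c0 : 0 < 3 * 2 ^+ m.+2 :> R by rewrite mulr_gt0// exprn_gt0.
(* This [s] makes the second term of [osc_bound] equal to [C e]; it does not depend on [k], so the
   vanishing energy takes care of the first. *)
pose s := 3 * 2 ^+ m.+2 / e.
have s0 : 0 < s by exact: divr_gt0.
have r01 k : 0 < r k ^+ 2 < 1.
  by rewrite exprn_gt0//=; apply: le_lt_trans (sqr_r k) _; rewrite invf_lt1// ltr1n.
have cr2 : r k ^+ 2 @[k --> \oo] --> (0 : R).
  rewrite -[X in _ --> X](mul0r 0); under eq_fun do rewrite expr2; exact: cvgM.
have cE := cvg_flux_energy n2 energy r01 cr2.
have d0 : 0 < C * e / s by rewrite divr_gt0// mulr_gt0.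
near=> k => t tk.
have Ek : flux_energy g (r k ^+ 2) <= C * e / s.
  by apply: le_trans (ler_norm _) _; near: k; exact: cvgr0_norm_le.
have C2 : 0 < 2 * C by rewrite mulr_gt0.
rewrite -(ler_pM2l C2); apply: le_trans (osc_bound tk s0) _.
have -> : 2 * C * e = C * e + C * e by ring.
apply: lerD.
  by rewrite mulrC -ler_pdivlMr.
rewrite le_eqVlt; apply/orP; left; apply/eqP; rewrite /s.
set c := 3 * _ in c0 *; by field; rewrite !gt_eqF.
Unshelve. all: by end_near. Qed.

(** Halving the radius multiplies the weight [r^(m/2)] by [2^(-m/2)], a contraction as [m > 0]; the
    error at each stage is an oscillation, small by [osc_small]. *)
Let cvg_profile : Num.sqrt (r k ^+ m) * `|Fc (r k ^+ 2)| @[k --> \oo] --> (0 : R).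
Proof.
pose d k := Num.sqrt (r k.+1 ^+ m) * `|Fc (r k ^+ 2) - Fc (r k.+1 ^+ 2)|.
apply: (@cvg_contraction _ _ d (Num.sqrt (2^-1 ^+ m))).
- rewrite sqrtr_ge0/= -[X in _ < X]sqrtr1 ltr_sqrt// exprn_ilt1 ?invr_ge0 ?invf_lt1 ?ltr1n//.
  by rewrite -lt0n.
- by move=> k; rewrite mulr_ge0 ?sqrtr_ge0.
- move=> k; rewrite /d.
  have -> : Num.sqrt (2^-1 ^+ m) * (Num.sqrt (r k ^+ m) * `|Fc (r k ^+ 2)|) =
      Num.sqrt (r k.+1 ^+ m) * `|Fc (r k ^+ 2)|.
    by rewrite mulrA -sqrtrM ?exprn_ge0 ?invr_ge0// -exprMn rS [2^-1 * _]mulrC.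
  rewrite -mulrDr ler_wpM2l ?sqrtr_ge0//.
  rewrite -[X in `|X| <= _](subrK (Fc (r k ^+ 2))) addrC distrC.
  exact: le_trans (ler_normD _ _) _.
- apply/cvgrPdist_le => e e0; have [N _ HN] := osc_small e0.
  exists N => // k /HN osck; rewrite sub0r normrN ger0_norm ?mulr_ge0 ?sqrtr_ge0//.
  have rk : r k.+1 ^+ 2 <= r k ^+ 2 <= r k ^+ 2.
    rewrite lexx andbT lerXn2r ?nnegrE ?(ltW (r_gt0 _))// rS.
    by rewrite ler_pdivrMr// ler_peMr ?(ltW (r_gt0 _))// ler1n.
  exact: osck rk.
Qed.

(** [W] is controlled only through increments of [Fc]. The mean value theorem on
    [[r_(k+1)^2, r_k^2]] turns the small oscillation into a bound at one point, hence a statement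
    about some [t] instead of all small [t]. *)
Lemma profile_origin e : 0 < e -> exists t, [/\ 0 < t < 1, t <= e,
  Num.sqrt t ^+ m * Fc t ^+ 2 <= e & W t ^+ 2 <= e * Num.sqrt t ^+ m].
Proof.
move=> e0.
(* On [[p^2, 4 p^2]] with [4 p^2 <= 1/4] one has [flux_coef t >= c p^-(m+2)]: [2^-(m+2)] comes from
   [sqrt t <= 2 p], and [4^-m / 4] from [(1 - t) / 2 >= 1/4]. *)
have [c c0 cE] : exists2 c : R, 0 < c & c = 2^-1 ^+ m.+2 * (4^-1 ^+ m / 4).
  by exists (2^-1 ^+ m.+2 * (4^-1 ^+ m / 4)) => //; rewrite mulr_gt0 ?divr_gt0 ?exprn_gt0 ?invr_gt0.
have m0' : 0 < Num.min (2^-1 ^+ m / 4) ((3 * c) ^+ 2).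
  by rewrite lt_min; apply/andP; split; [rewrite divr_gt0// exprn_gt0// invr_gt0|rewrite exprn_gt0// mulr_gt0].
(* [d] will bound the weighted size and oscillation of [Fc]. The minimum provides for
   [2^m 4 d^2 <= e], used for [Fc], and [(d / (3 c))^2 <= e], used for [W]; [d <= 1] gives
   [d^2 <= d]. *)
have [d [d0 d1 de]] : exists d : R, [/\ 0 < d, d <= 1 & d <= e * Num.min (2^-1 ^+ m / 4) ((3 * c) ^+ 2)].
  exists (Num.min 1 (e * Num.min (2^-1 ^+ m / 4) ((3 * c) ^+ 2))).
  by rewrite lt_min ltr01 mulr_gt0//= !ge_min !lexx orbT.
have dd : d ^+ 2 <= d by rewrite expr2 ger_pMl.
have d2 : 2 ^+ m * (4 * d ^+ 2) <= e.
  apply: (@le_trans _ _ (2 ^+ m * (4 * (e * (2^-1 ^+ m / 4))))).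
    rewrite !ler_pM2l ?exprn_gt0//; apply: le_trans dd _; apply: le_trans de _.
    by rewrite ler_pM2l// ge_min lexx.
  rewrite exprVn le_eqVlt; apply/orP; left; apply/eqP.
  by field; rewrite expf_neq0.
have d3 : d ^+ 2 <= e * (3 * c) ^+ 2.
  apply: le_trans dd _; apply: le_trans de _.
  by rewrite ler_pM2l// ge_min lexx orbT.
have [k [osc Xk rk]] : exists k, [/\ forall t, r k.+1 ^+ 2 <= t <= r k ^+ 2 ->
   Num.sqrt (r k.+1 ^+ m) * `|Fc t - Fc (r k.+1 ^+ 2)| <= d,
   Num.sqrt (r k.+1 ^+ m) * `|Fc (r k.+1 ^+ 2)| <= d & r k <= e].
  near \oo => k; exists k; split.
  - by near: k; exact: osc_small.
  - apply: le_trans (ler_norm _) _; near: k.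
    have [N _ HN] : \forall k \near \oo, `|Num.sqrt (r k ^+ m) * `|Fc (r k ^+ 2)| | <= d.
      exact: cvgr0_norm_le.
    by exists N => // j /= Nj; apply: (HN j.+1); exact: leqW.
  - by apply: le_trans (ler_norm _) _; near: k; exact: cvgr0_norm_le.
set p := r k.+1 in osc Xk; have p0 : 0 < p by exact: r_gt0.
have rp : r k = 2 * p by rewrite /p rS; field.
have q1 : r k ^+ 2 < 1 by apply: le_lt_trans (sqr_r k) _; rewrite invf_lt1// ltr1n.
have pq : p ^+ 2 <= r k ^+ 2 by rewrite rp lerXn2r ?nnegrE ?mulr_ge0 ?(ltW p0)//; lra.
have p20 : 0 < p ^+ 2 by exact: exprn_gt0.
have [t||t tpq Et] := MVT_segment (f := Fc) (df := fun t => flux_coef (n := m.+2) t * W t) pq _ _.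
- rewrite in_itv/= => /andP[pt tr]; apply: dFc.
  by rewrite (lt_trans p20 pt) (lt_trans tr q1).
- apply: continuous_in_subspaceT => t /set_mem; rewrite /= in_itv/= => /andP[pt tr].
  by apply: continuous_is_derive; apply: dFc; rewrite (lt_le_trans p20 pt) (le_lt_trans tr q1).
move: tpq; rewrite in_itv/= => tpq; have /andP[pt tr] := tpq.
have t0 : 0 < t by exact: lt_le_trans pt.
have t1 : t < 1 by exact: le_lt_trans q1.
have pst : p <= Num.sqrt t by rewrite -[leLHS](gtr0_norm p0) -sqrtr_sqr ler_wsqrtr.
have stp : Num.sqrt t <= 2 * p by rewrite -rp -[leRHS](gtr0_norm (r_gt0 k)) -sqrtr_sqr ler_wsqrtr.
have pm : 0 < p ^+ m by exact: exprn_gt0.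
set K := Num.sqrt (p ^+ m) in osc Xk; have K0 : 0 < K by rewrite sqrtr_gt0.
have K2 : K ^+ 2 = p ^+ m by rewrite sqr_sqrtr// ltW.
exists t; split; first by rewrite t0.
- apply: le_trans tr _; apply: le_trans rk; rewrite expr2 ler_piMl ?(ltW (r_gt0 _))//.
  by apply: le_trans (r_le k) _; rewrite invf_le1// ler1n.
- have KF : K * `|Fc t| <= 2 * d.
    have -> : Fc t = Fc (p ^+ 2) + (Fc t - Fc (p ^+ 2)) by rewrite addrC subrK.
    have -> : 2 * d = d + d by ring.
    apply: (@le_trans _ _ (K * `|Fc (p ^+ 2)| + K * `|Fc t - Fc (p ^+ 2)|)).
      by rewrite -mulrDr ler_pM2l// ler_normD.
    by apply: lerD => //; exact: osc.
  apply: le_trans d2; apply: (@le_trans _ _ ((2 * p) ^+ m * Fc t ^+ 2)).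
    by rewrite ler_wpM2r ?sqr_ge0// lerXn2r ?nnegrE ?sqrtr_ge0 ?mulr_ge0 ?(ltW p0).
  rewrite exprMn -mulrA ler_pM2l ?exprn_gt0// -K2 -(real_normK (num_real (Fc t))) -exprMn.
  by rewrite (_ : 4 * d ^+ 2 = (2 * d) ^+ 2) ?lerXn2r ?nnegrE ?mulr_ge0 ?(ltW K0) ?(ltW d0)//; ring.
- have coefP : p^-1 ^+ m.+2 * c <= flux_coef (n := m.+2) t.
    rewrite cE mulrA -exprMn -invfM; apply: ler_pM.
    + by rewrite exprn_ge0// invr_ge0 mulr_ge0// ltW.
    + by rewrite divr_ge0// exprn_ge0.
    + rewrite lerXn2r ?nnegrE ?invr_ge0 ?sqrtr_ge0 ?mulr_ge0 ?(ltW p0)//.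
      by rewrite lef_pV2 ?posrE ?sqrtr_gt0 ?mulr_gt0// mulrC.
    + rewrite ler_pM2r// subn2/= lerXn2r ?nnegrE ?divr_ge0 ?subr_ge0 ?(ltW t1)//.
      by have := le_trans tr (sqr_r k); lra.
  have pc0 : 0 < p^-1 ^+ m.+2 * c by rewrite mulr_gt0// exprn_gt0// invr_gt0.
  have WB : K * `|W t| <= p ^+ m * (d / (3 * c)).
    have H : K * `|Fc (r k ^+ 2) - Fc (p ^+ 2)| <= d by apply: osc; rewrite pq/=.
    rewrite Et normrM normrM gtr0_norm in H; last exact: lt_le_trans coefP.
    have pq0 : 0 <= r k ^+ 2 - p ^+ 2 by rewrite subr_ge0.
    rewrite (ger0_norm pq0) in H.
    have H' : K * (p^-1 ^+ m.+2 * c * `|W t| * (3 * p ^+ 2)) <= d.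
      apply: le_trans H; rewrite ler_pM2l//.
      have -> : r k ^+ 2 - p ^+ 2 = 3 * p ^+ 2 by rewrite rp; ring.
      by rewrite ler_pM2r ?mulr_gt0// ler_wpM2r.
    rewrite mulrA ler_pdivlMr ?mulr_gt0//.
    have -> : K * `|W t| * (3 * c) = p ^+ m * (K * (p^-1 ^+ m.+2 * c * `|W t| * (3 * p ^+ 2))).
      rewrite exprVn -[m.+2]addn2 exprD.
      by field; rewrite expf_neq0 gt_eqF.
    by rewrite ler_pM2l.
  have c3 : 0 < 3 * c by rewrite mulr_gt0.
  have A1 : 0 <= K * `|W t| by rewrite mulr_ge0// ltW.
  have A2 : 0 <= p ^+ m * (d / (3 * c)) by rewrite ltW// mulr_gt0// divr_gt0.
  have : (K * `|W t|) ^+ 2 <= (p ^+ m * (d / (3 * c))) ^+ 2 by apply: lerXn2r; rewrite ?nnegrE.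
  rewrite exprMn real_normK ?num_real// K2 exprMn [X in _ <= X * _]expr2 -mulrA ler_pM2l// => H.
  apply: le_trans H _.
  apply: (@le_trans _ _ (p ^+ m * e)); last first.
    rewrite mulrC ler_pM2l// lerXn2r ?nnegrE ?sqrtr_ge0 ?(ltW p0)//.
  by rewrite ler_pM2l// expr_div_n ler_pdivrMr// exprn_gt0.
Unshelve. all: by end_near. Qed.

End origin.

(** * Change of variable and conclusion *)

(** With [A = (1 - |x|^2)/2 <= 1], the metric multiplies [|g|^2] by [A^(2-n) >= 1]: the Euclidean
    energy is at most the hyperbolic one. *)
Lemma integrable_energy (R : realType) n (u : 'rV[R]_n -> R) (g : 'rV[R]_n -> 'rV[R]_n) :
  (2 < n)%N -> weak_gradient u g ->
  (\int[lebesgue_row n]_(x in hball)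
     ((hyp_grad_dot x (g x) (g x) + u x ^+ 2) * conformal x ^+ n)%:E < +oo)%E ->
  (lebesgue_row n).-integrable hball (fun x => (dotr (g x) (g x))%:E).
Proof.
move=> n2 [[mu _] gi _] Eoo.
have mh := @measurable_hball R n.
have mg : measurable_fun hball (fun x : 'rV[R]_n => dotr (g x) (g x) : measurableTypeR R).
  apply: measurable_sum => i; apply: measurable_funM; exact: (gi i).1.
have lt1 (x : 'rV[R]_n) : hball x -> 0 < 1 - nsq x by rewrite hballE/= subr_gt0.
have mn : measurable_fun hball (fun x : 'rV[R]_n => nsq x : measurableTypeR R).
  by apply: measurable_funTS; exact: measurable_nsq.
have mc : measurable_fun hball (fun x : 'rV[R]_n => conformal x : measurableTypeR R).
  apply: (eq_measurable_fun (fun x : 'rV[R]_n => 2 * (1 - nsq x) `^ (-1))).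
    by move=> x /set_mem /lt1 x1; rewrite /conformal enorm_sqr powR_inv1// ltW.
  apply: measurable_funM; first exact: measurable_cst.
  apply: (measurableT_comp (f := fun t : R => t `^ (-1))); first exact: measurable_powR.
  by apply: measurable_funB => //; exact: measurable_cst.
apply/integrableP; split; first exact/measurable_EFinP.
apply: le_lt_trans Eoo; apply: ge0_le_integral => //.
- by apply: measurableT_comp => //; exact/measurable_EFinP.
- apply/measurable_EFinP; apply: measurable_funM; last exact: measurable_funX.
  apply: measurable_funD; last exact: measurable_funX.
  apply: measurable_funM => //; apply: measurable_funX.
  apply: (eq_measurable_fun (fun x : 'rV[R]_n => (1 - nsq x) / 2)).
    by move=> x _; rewrite enorm_sqr.
  by apply: measurable_funM; [apply: measurable_funB => //|]; exact: measurable_cst.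
- move=> x xh; have A0 := lt1 _ xh.
  rewrite lee_fin ger0_norm ?dotr_ge0// /hyp_grad_dot /conformal enorm_sqr.
  have -> : 2 / (1 - nsq x) = ((1 - nsq x) / 2)^-1 by rewrite invf_div.
  have A1 : (1 - nsq x) / 2 <= 1 by have := nsq_ge0 x; lra.
  have {}A0 : 0 < (1 - nsq x) / 2 by rewrite divr_gt0.
  move: A0 A1; set A := _ / 2 => A0 A1.
  have AV : 0 <= A^-1 ^+ n by rewrite exprn_ge0// invr_ge0 ltW.
  rewrite mulrDl ler_wpDr//; first by rewrite mulr_ge0 ?sqr_ge0.
  rewrite mulrAC ler_peMl ?dotr_ge0// -(subnKC (ltnW n2)) exprD mulrA -exprMn mulfV ?gt_eqF// expr1n mul1r.
  by rewrite exprn_ege1// invf_ge1.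
Qed.

(** Almost every value of [u] is a value of [Fc] on []0, 1[], so a sign missed by [Fc] everywhere is
    missed by [u] almost everywhere. *)
Lemma sign_changing_profile (R : realType) n (u : 'rV[R]_n -> R) (F Fc : R -> R) : (2 < n)%N ->
  {ae lebesgue_row n, forall x, hball x -> u x = F (nsq x)} ->
  {ae @lebesgue_measure R, forall t : R, 0 < t < 1 -> F t = Fc t} ->
  sign_changing u ->
  (exists2 t, 0 < t < 1 & 0 < Fc t) /\ (exists2 t, 0 < t < 1 & Fc t < 0).
Proof.
move=> n2 uF FFc [pos neg].
have n0 : (0 < n)%N by exact: ltn_trans n2.
have ae : {ae lebesgue_row n, forall x : 'rV[R]_n, hball x -> exists2 t, 0 < t < 1 & u x = Fc t}.
  have ae0 : {ae lebesgue_row n, forall x : 'rV[R]_n, 0 < nsq x}.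
    exists [set x : 'rV[R]_n | nsq x <= 0]; split.
    - rewrite (_ : [set _ | _] = nsq @^-1` `]-oo, (0 : R)]%classic); first exact: measurable_nsq_preimage.
      by apply/seteqP; split => x /=; rewrite in_itv.
    - exact: lebesgue_row_ball0.
    - by move=> x /= /negP; rewrite -leNgt.
  have aeF := negligible_preimage_nsq n2 FFc.
  apply: filterS (filterI ae0 (filterI aeF uF)) => x [x0 [xF xu]] xh.
  have x01 : 0 < nsq x < 1 by rewrite x0; move: xh; rewrite hballE.
  by exists (nsq x) => //; rewrite xu// xF.
split; apply: contrapT => no.
- apply: pos; apply: filterS ae => x xu /xu [t t01 ut]; rewrite /funrpos ut.
  by apply/max_idPr; rewrite leNgt; apply/negP => Ft; apply: no; exists t.
- apply: neg; apply: filterS ae => x xu /xu [t t01 ut]; rewrite /funrneg ut.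
  by apply/max_idPr; rewrite oppr_le0 leNgt; apply/negP => Ft; apply: no; exists t.
Qed.

Section substitution.
Context {R : realType}.
Implicit Types s t : R.

(* [tanh (s / 2)]: the Euclidean radius at hyperbolic distance [s] from the origin *)
Definition radius s : R := (expR s - 1) / (expR s + 1).

Let den_gt0 s : 0 < expR s + 1.
Proof. by rewrite addr_gt0// expR_gt0. Qed.

Lemma radius_gt0 s : 0 < s -> 0 < radius s.
Proof. by move=> s0; rewrite divr_gt0// subr_gt0 expR_gt1. Qed.

Lemma radius_lt1 s : radius s < 1.
Proof. by rewrite ltr_pdivrMr// mul1r ltrD2l; apply: (@lt_trans _ _ 0). Qed.

Lemma sinh_radius s : 0 < s -> sinh s = radius s / ((1 - radius s ^+ 2) / 2).
Proof.
move=> s0; rewrite /sinh expRN /radius.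
have := expR_gt0 s; have := den_gt0 s; set E := expR s => E1 E0.
have -> : 1 - ((E - 1) / (E + 1)) ^+ 2 = 4 * E / (E + 1) ^+ 2 by field; rewrite gt_eqF.
by field; rewrite !gt_eqF.
Qed.

Lemma is_derive_radius s : is_derive s 1 radius ((1 - radius s ^+ 2) / 2).
Proof.
have d0 : expR s + 1 != 0 by rewrite gt_eqF.
have D := is_derive1_mul (is_derive1_add (is_derive_expR s) (is_derive_cst (- 1 : R) s 1))
  (is_deriveV (f := fun s => expR s + 1) d0 (is_derive1_add (is_derive_expR s) (is_derive_cst (1 : R) s 1))).
apply: (is_derive_eq D); rewrite /cst /GRing.scale /radius /= !addr0.
by field.
Qed.

Lemma radius_surj t : 0 < t < 1 -> exists2 s, 0 < s & radius s ^+ 2 = t.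
Proof.
move=> /andP[t0 t1]; pose r := Num.sqrt t.
have r0 : 0 < r by rewrite sqrtr_gt0.
have r1 : r < 1 by rewrite /r -[X in _ < X]sqrtr1 ltr_sqrt.
have q0 : 0 < (1 + r) / (1 - r) by rewrite divr_gt0 ?subr_gt0// addr_gt0.
have q1 : 1 < (1 + r) / (1 - r) by rewrite ltr_pdivlMr ?subr_gt0// mul1r; lra.
(* This is [2 artanh r], the hyperbolic distance at Euclidean radius [r]. *)
exists (ln ((1 + r) / (1 - r))); first exact: ln_gt0.
rewrite /radius lnK ?posrE//.
rewrite -[RHS](sqr_sqrtr (ltW t0)) -/r; congr (_ ^+ 2).
have rn : 1 - r != 0 by rewrite gt_eqF// subr_gt0.
have -> : (1 + r) / (1 - r) + 1 = 2 / (1 - r) by field.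
by field; rewrite rn.
Qed.

Lemma le_sinh s : 0 <= s -> s <= sinh s.
Proof.
move=> s0; pose f t := t - sinh t.
have f0 : f 0 = 0 by rewrite /f /sinh oppr0 subrr mul0r subrr.
suff : f s <= f 0 by rewrite f0 subr_le0.
apply: (@nincr_is_derive _ f (fun s => 1 - cosh s) _ _ s0).
  by move=> t _; exact: is_derive1_add (is_derive_id t 1) (is_derive1_opp (is_derive_sinh t)).
move=> t _; rewrite subr_le0 -(@ler_pXn2r _ 2) ?nnegrE ?(ltW (cosh_gt0 _))//.
by rewrite cosh_sqr expr1n lerDl sqr_ge0.
Qed.

Variables (m : nat) (lambda q : R) (Fc W : R -> R).
Hypothesis dFc : forall t, 0 < t < 1 ->
  is_derive t 1 Fc (flux_coef (n := m.+2) t * W t) /\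
  is_derive t 1 W (- (reaction (n := m.+2) lambda q Fc t * Num.sqrt t ^+ (m.+2 - 2))).

Definition profile s : R := Fc (radius s ^+ 2).
(** With [r = radius s], [A = (1 - r^2)/2] and [sinh s = r / A], one has [dt/ds = 2 r A], and
    [flux_coef t] times it is [1 / (2 S^(n-1))]. The factor [1/2] thus makes [momentum] equal to
    [S^(n-1) y']. *)
Definition momentum s : R := W (radius s ^+ 2) / 2.

Let radius01 s : 0 < s -> 0 < radius s ^+ 2 < 1.
Proof.
by move=> s0; rewrite exprn_gt0 ?radius_gt0//= expr_lt1 ?radius_lt1// ltW// radius_gt0.
Qed.

Let drad2 s : is_derive s 1 (fun s => radius s ^+ 2) (2 * radius s * ((1 - radius s ^+ 2) / 2)).
Proof. by apply: (is_derive_eq (is_derive1_exp 2 (is_derive_radius s))); rewrite /= expr1. Qed.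

Lemma is_derive_profile s : 0 < s -> is_derive s 1 profile (momentum s / sinh s ^+ m.+1).
Proof.
move=> s0; have [dF _] := dFc (radius01 s0).
have := @is_derive1_comp _ Fc (fun s => radius s ^+ 2) s _ _ dF (drad2 s).
move=> D; apply: (is_derive_eq D).
have r0 := radius_gt0 s0; have /andP[_ r1] := radius01 s0.
rewrite sinh_radius// /momentum /flux_coef sqrtr_sqr gtr0_norm// subn2/=.
have : (1 - radius s ^+ 2) / 2 != 0 by rewrite gt_eqF// divr_gt0// subr_gt0.
have : radius s != 0 by rewrite gt_eqF.
have alg (r A w : R) : r != 0 -> A != 0 ->
    r^-1 ^+ m.+2 * (A ^+ m / 4) * w * (2 * r * A) = w / 2 / (r / A) ^+ m.+1.
  move=> rn A0; rewrite expr_div_n !exprVn !exprS; set Z := r ^+ m; set Y := A ^+ m.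
  have Z0 : Z != 0 by rewrite expf_neq0.
  have Y0 : Y != 0 by rewrite expf_neq0.
  by field; rewrite Z0 Y0 A0 rn.
exact: alg.
Qed.

Lemma is_derive_momentum s : 0 < s ->
  is_derive s 1 momentum (- (sinh s ^+ m.+1 * (lambda * profile s + power q (profile s)))).
Proof.
move=> s0; have [_ dW] := dFc (radius01 s0).
have D0 := @is_derive1_comp _ W (fun s => radius s ^+ 2) s _ _ dW (drad2 s).
have D := is_derive1_mul D0 (is_derive_cst (2^-1 : R) s 1).
apply: (is_derive_eq D); rewrite /cst mulr0 addr0.
have r0 := radius_gt0 s0; have /andP[_ r1] := radius01 s0.
rewrite sinh_radius// /reaction sqrtr_sqr gtr0_norm// subn2/= -/(profile s).
have -> : 2 / (1 - radius s ^+ 2) = ((1 - radius s ^+ 2) / 2)^-1 by rewrite invf_div.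
have : (1 - radius s ^+ 2) / 2 != 0 by rewrite gt_eqF// divr_gt0// subr_gt0.
have alg (r A w : R) : A != 0 ->
    - (w * A^-1 ^+ m.+2 * r ^+ m) * (2 * r * A) / 2 = - ((r / A) ^+ m.+1 * w).
  move=> A0; rewrite expr_div_n !exprVn !exprS; set Y := A ^+ m.
  have Y0 : Y != 0 by rewrite expf_neq0.
  by field; rewrite Y0 A0.
exact: alg.
Qed.

Hypothesis origin : forall e, 0 < e -> exists t, [/\ 0 < t < 1, t <= e,
  Num.sqrt t ^+ m * Fc t ^+ 2 <= e & W t ^+ 2 <= e * Num.sqrt t ^+ m].

Lemma profile_near0 e : 0 < e -> exists s,
  [/\ 0 < s <= e, sinh s <= e, sinh s ^+ m * profile s ^+ 2 <= e &
      momentum s ^+ 2 <= e * sinh s ^+ m].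
Proof.
move=> e0.
have c4 : 1 <= 4 ^+ m.+1 :> R by rewrite exprn_ege1// ler1n.
(* [d <= 1/2] gives [sinh s <= 4 radius s], then [16 d <= e^2] gives [sinh s <= e]; the factor [4^m]
   is the price of replacing [radius s] by [sinh s] in the weight of [profile]. *)
have [d d0 [d1 d2 d3 d4]] : exists2 d : R, 0 < d & [/\ d <= 2^-1, 16 * d <= e ^+ 2, 4 ^+ m * d <= e & d <= e].
  pose d := Num.min (Num.min 2^-1 (e ^+ 2 / 16)) (e / 4 ^+ m.+1).
  have p4 : 0 < 4 ^+ m.+1 :> R by rewrite exprn_gt0.
  have a1 : 0 < 2^-1 :> R by rewrite invr_gt0.
  have a2 : 0 < e ^+ 2 / 16 by rewrite divr_gt0// exprn_gt0.
  have a3 : 0 < e / 4 ^+ m.+1 by rewrite divr_gt0.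
  have d0 : 0 < d by rewrite !lt_min a1 a2.
  have dm : d <= e / 4 ^+ m.+1 by rewrite !ge_min lexx !orbT.
  have dm' : 4 ^+ m.+1 * d <= e by rewrite mulrC -ler_pdivlMr.
  exists d => //; split.
  - by rewrite !ge_min lexx.
  - by rewrite mulrC -ler_pdivlMr// !ge_min lexx orbT.
  - apply: le_trans dm'; rewrite [leRHS](_ : _ = 4 * (4 ^+ m * d)); last by rewrite exprS mulrA.
    by rewrite ler_peMl ?ler1n// mulr_ge0 ?exprn_ge0// ltW.
  - by apply: le_trans dm'; rewrite ler_peMl// ltW.
have [t [t01 td H1 H2]] := origin d0; have [s s0 E] := radius_surj t01.
have r0 := radius_gt0 s0.
have st : Num.sqrt t = radius s by rewrite -E sqrtr_sqr gtr0_norm.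
rewrite st -E in H1 H2.
have r2 : radius s ^+ 2 <= 2^-1 by rewrite E; exact: le_trans d1.
have A0 : 0 < (1 - radius s ^+ 2) / 2 by rewrite divr_gt0// subr_gt0; move: r2; lra.
have S1 : radius s <= sinh s.
  rewrite sinh_radius// ler_pdivlMr// ger_pMr//.
  by have := sqr_ge0 (radius s); lra.
have S4 : sinh s <= 4 * radius s.
  rewrite sinh_radius// ler_pdivrMr// mulrAC ler_peMl ?(ltW r0)//.
  by move: r2; set r := radius s; lra.
have R4 : 0 <= 4 * radius s by apply: mulr_ge0 => //; exact: ltW.
have Se : sinh s <= e.
  apply: le_trans S4 _; rewrite -(@ler_pXn2r _ 2) ?nnegrE ?(ltW e0)//.
  apply: le_trans d2; rewrite exprMn E (_ : 4 ^+ 2 = 16) ?ler_pM2l//; ring.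
have S0 := sinh_gt0 s0.
exists s; split => //.
- by rewrite s0 (le_trans (le_sinh (ltW s0))).
- apply: le_trans d3; apply: (@le_trans _ _ ((4 * radius s) ^+ m * profile s ^+ 2)).
    by rewrite ler_wpM2r ?sqr_ge0// lerXn2r ?nnegrE ?(ltW S0).
  by rewrite exprMn -mulrA ler_pM2l// exprn_gt0.
- rewrite /momentum expr_div_n; apply: (@le_trans _ _ (W (radius s ^+ 2) ^+ 2)).
    by rewrite ler_pdivrMr ?exprn_gt0// ler_peMr ?sqr_ge0// exprn_ege1// ler1n.
  apply: le_trans H2 _; apply: ler_pM; rewrite ?(ltW d0) ?exprn_ge0 ?(ltW r0)//.
  by rewrite lerXn2r ?nnegrE ?(ltW r0) ?(ltW S0).
Qed.

End substitution.

Lemma profile_constant_sign (R : realType) (m : nat) (lambda q : R) (Fc W : R -> R) : (0 < m)%N ->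
  q = 4 / m%:R ->
  (forall t : R, 0 < t < 1 -> is_derive t 1 Fc (flux_coef (n := m.+2) t * W t) /\
    is_derive t 1 W (- (reaction (n := m.+2) lambda q Fc t * Num.sqrt t ^+ (m.+2 - 2)))) ->
  (forall e : R, 0 < e -> exists t, [/\ 0 < t < 1, t <= e,
    Num.sqrt t ^+ m * Fc t ^+ 2 <= e & W t ^+ 2 <= e * Num.sqrt t ^+ m]) ->
  (lambda <= (m%:R + 2) * m%:R / 4 \/ m = 1%N /\ lambda < 1) ->
  ~ ((exists2 t, 0 < t < 1 & 0 < Fc t) /\ (exists2 t, 0 < t < 1 & Fc t < 0)).
Proof.
move=> m0 qE ode origin hl [[t1 t101 F1] [t2 t201 F2]].
have cF (t : R) : 0 < t < 1 -> {for t, continuous Fc}.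
  by move=> t01; have [D _] := ode t t01; exact: continuous_is_derive D.
have [t0 t001 F0] : exists2 t0, 0 < t0 < 1 & Fc t0 = 0.
  have key a b : 0 < a -> a <= b -> b < 1 -> Num.min (Fc a) (Fc b) <= 0 <= Num.max (Fc a) (Fc b) ->
      exists2 t0, 0 < t0 < 1 & Fc t0 = 0.
    move=> a0 ab b1 H; have [|c] := IVT ab _ H.
      apply: continuous_in_subspaceT => t /set_mem; rewrite /= in_itv/= => /andP[at_ tb].
      by apply: cF; rewrite (lt_le_trans a0 at_) (le_lt_trans tb b1).
    rewrite in_itv/= => /andP[ac cb] Fc0; exists c => //.
    by rewrite (lt_le_trans a0 ac) (le_lt_trans cb b1).
  have /andP[t10 t11] := t101; have /andP[t20 t21] := t201.
  have [t12|/ltW t21'] := leP t1 t2.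
    by apply: (key t1 t2) => //; rewrite ge_min le_max (ltW F1) (ltW F2) orbT.
  by apply: (key t2 t1) => //; rewrite ge_min le_max (ltW F1) (ltW F2) orbT.
have [s0 s00 E0] := radius_surj t001; have [s1 s10 E1] := radius_surj t101.
have dy := is_derive_profile ode; have dw := is_derive_momentum ode.
have near0 := profile_near0 origin.
have ys0 : profile Fc s0 = 0 by rewrite /profile E0.
have ws0 : momentum W s0 = 0.
  have [hl'|hl'] := leP lambda ((m%:R + 2) * m%:R / 4).
    exact: (ode_zero_low m0 qE dy dw near0 hl' s00 ys0).
  (* For [m = 1] the failed bound reads [3/4 < lambda], the range of [ode_zero_dim3]. *)
  case: hl => [hl|[m1 l1]]; first by move: hl'; rewrite ltNge hl.
  apply: (ode_zero_dim3 m0 qE dy dw near0 m1 _ s00 ys0).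
  by rewrite l1 andbT; move: hl'; rewrite m1; apply: le_lt_trans; rewrite le_eqVlt; apply/orP; left; apply/eqP; field.
have := ode_unique m0 qE dy dw s00 ys0 ws0 s10.
by rewrite /profile E1 => F10; move: F1; rewrite F10 ltxx.
Qed.

Unset Implicit Arguments.

Theorem theorem5p4 (R : realType) (N : nat) (lambda : R)
  (hN : (3 <= N)%N)
  (hlambda : lambda < ((N%:R - 1) / 2) ^+ 2)
  (hcase : lambda <= N%:R * (N%:R - 2) / 4 \/ N = 3%N) :
  ~ exists u : 'rV[R]_N -> R,
      [/\ weak_solution lambda ((N%:R + 2) / (N%:R - 2)) u,
          radial u & sign_changing u].
Proof.
move: hN hlambda hcase; case: N => [//|[//|m]] m0 hl hc [u [[[g wg Eoo] eq] ru su]].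
have n2 : (2 < m.+2)%N := m0.
have mp : 0 < m%:R :> R by rewrite ltr0n.
have mE : m.+2%:R = m%:R + 2 :> R by rewrite -addn2 natrD.
set p := (_ + 2) / _ in eq.
(* With [N = m + 2] the exponent of the nonlinearity in [power] is [p - 1 = 4 / (N - 2)]. *)
have q0E : p - 1 = 4 / m%:R.
  by rewrite /p mE addrK; field; rewrite gt_eqF.
have q0 : 0 < p - 1 by rewrite q0E divr_gt0.
have [[mu _] _ _] := wg.
have [F mF uF] := measurable_radial_profile n2 mu ru.
have energy := integrable_energy n2 wg Eoo.
have [Fc [FFc FcE]] := continuous_profile n2 wg mF uF.
have cFc := continuous_profile_at n2 wg energy FcE.
have [W ode] := profile_ode (lambda := lambda) n2 q0 wg mF uF FFc FcE cFc (eq g wg).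
have [r [r0 rS r1 cr]] := halving_sequence R.
have origin := profile_origin m0 wg energy FcE (fun t t01 => (ode t t01).1) r0 rS r1 cr.
apply: (profile_constant_sign m0 q0E ode origin) (sign_changing_profile n2 uF FFc su).
case: hc => [hc|[m1]].
  by left; apply: le_trans hc _; rewrite mE le_eqVlt; apply/orP; left; apply/eqP; field.
(* For [N = 3] the spectral bound [((N - 1) / 2)^2] equals [1]. *)
right; split=> //; move: hl; rewrite m1 => /lt_le_trans; apply.
by rewrite le_eqVlt; apply/orP; left; apply/eqP; field.
Qed.
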